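(* Let $K$ be an algebraically closed field of characteristic $0$. For each triple $(HF,d,d_0)$ in the following list, write $HF=(h_0,h_1,\dots,h_s)$, $n=h_1$, $\mu=\sum_{i}h_i$: $((1,5,9,7),123,110)$; $((1,5,15,7,9),268,185)$; $((1,5,15,7,9,11),341,240)$; $((1,5,15,9,12),332,210)$; $((1,5,15,10,12),347,215)$; $((1,5,15,10,15),386,230)$; $((1,6,5,7),132,114)$; $((1,6,5,7,9),186,168)$; $((1,6,10,7,9),248,198)$; $((1,6,10,9,12),302,228)$; $((1,6,10,10,9),272,216)$; $((1,6,21,7,9),461,264)$; $((1,7,3,4,5,6,7),252,231)$; $((1,7,5,7,9,11),341,280)$; $((1,7,10,10,15),460,301)$; $((1,7,10,16),371,238)$. Let $H=H^{\mu}_{\mathbb{A}^n_K}$ be the Hilbert scheme of $\mu$ points of $\mathbb{A}^n_K$, let $\mathcal{O}$ be the admissible order ideal with Hilbert function $HF$, and let $U\subseteq H$ be the locus of all translates of the mod-distinguished locus $\tilde X_{\mathcal{O}}$ (defined in the context). Then the closure $\overline{U}$ is an elementary component of $H$ with $\dim(\overline{U})=d$, while the principal component of $H$ has dimension $d_0$. Moreover, for sufficiently general distinguished ideals $I$ attached to $\mathcal{O}$, the dimension of the tangent space to $H$ at $[I]$ is equal to $\dim(U)$, so that $[I]$ is a smooth point on the elementary component $\overline{U}$.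
   Context: $H^{\mu}_{\mathbb{A}^n_K}$ parametrizes ideals $I\subseteq K[\mathbf{x}]=K[x_1,\dots,x_n]$ with $\dim_K K[\mathbf{x}]/I=\mu$; $[I]$ is the point corresponding to $I$. Its principal component is the closure of the locus of points $[I]$ parametrizing reduced subschemes. An elementary component is an irreducible component $E$ such that for every $K$-point $[I]\in E$ the subscheme $\operatorname{Spec}(K[\mathbf{x}]/I)$ is supported at a single point. Monomials are compared in lexicographic order with $x_1>x_2>\dots>x_n$. The admissible order ideal $\mathcal{O}$ with Hilbert function $HF$ is $\mathcal{O}=\bigcup_{e=0}^{s}\mathcal{O}_e$, where $\mathcal{O}_e$ is the set of the $h_e$ lex-smallest monomials of degree $e$. Its border is $\partial\mathcal{O}=(x_1\mathcal{O}\cup\dots\cup x_n\mathcal{O})\setminus\mathcal{O}$. Put $\operatorname{LM}=\{b\in\partial\mathcal{O}\mid \deg(b)\le s,\ \text{and } x_k\mid b\Rightarrow b/x_k\in\mathcal{O}\text{ for all }k\}$ and $\operatorname{TM}=\mathcal{O}_s$. Distinguished ideals: a distinguished ideal attached to $\mathcal{O}$ is an ideal generated by polynomials $g_b$, $b\in\partial\mathcal{O}$, where $g_b=b-\sum_{t\in\operatorname{TM}}c_{t,b}\,t$ with arbitrary $c_{t,b}\in K$ if $b\in\operatorname{LM}$, and $g_b=b$ otherwise. Such ideals have colength $\mu$ and are supported at the origin. Mod-distinguished locus: let $r$ be the least degree in which some monomial is not in $\mathcal{O}$, let $\mathcal{N}$ be the set of monomials $m\notin\mathcal{O}$ with $r\le\deg(m)\le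 s+1$, and $\mathcal{N}_{\le s}$ the subset of those of degree $\le s$. The leading variable of a monomial is the largest variable dividing it. A variable $x_k$ is a key variable if it is the leading variable of some $m\in\mathcal{N}_{\le s}$; then its key monomial $\chi_k$ is the lex-minimal element of $\operatorname{LM}$ with leading variable $x_k$, and one writes $\chi_k=x_k^{e_k}\hat m_k$ with $x_k\nmid\hat m_k$. Put $\mathcal{T}_k=\{t/\hat m_k \mid t\in\mathcal{O}\setminus\operatorname{TM},\ \deg(t)\ge\deg(\chi_k),\ \hat m_k\mid t\}$. Introduce indeterminates $C_{t,b}$ ($t\in\operatorname{TM}$, $b\in\operatorname{LM}$) and $\theta_{k,u}$ ($x_k$ a key variable, $u\in\mathcal{T}_k$), let $\Theta$ be the set of all $\theta_{k,u}$, let $R$ be the polynomial ring over $K$ in all these indeterminates, and put $\sigma_k=\sum_{u\in\mathcal{T}_k}\theta_{k,u}\,u$. For $m\in\mathcal{N}$ let $Y(m)=-\sum_{t\in\operatorname{TM}}C_{t,m}\,t$ if $m\in\operatorname{LM}$ and $Y(m)=0$ otherwise. Define $\tau(m)\in\operatorname{Span}_R(\mathcal{O})$ for $m\in\mathcal{N}$ as follows. If $\deg(m)=s+1$, $\tau(m)=0$. If $\deg(m)\le s$ and $x_k$ is the leading variable of $m$, let $\tau'(m)$ be obtained from $(m/x_k^{e_k})\cdot\sigma_k$ by deleting all terms of degree $\ge s+1$; then $\tau(m)$ is obtained from $\tau'(m)$ by replacing each monomial $m'\in\mathcal{N}$ occurring in it by $-(Y(m')+\tau(m'))$ (this is a valid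 recursion, since every such $m'$ satisfies $\deg(m')\ge\deg(m)$ and $m'<m$). The set $\mathcal{MG}=\{b+Y(b)+\tau(b)\mid b\in\partial\mathcal{O}\}\subseteq R[\mathbf{x}]$ is an $\mathcal{O}$-border basis, i.e. $R[\mathbf{x}]/(\mathcal{MG})$ is $R$-free with basis $\mathcal{O}$. The mod-distinguished locus $\tilde X_{\mathcal{O}}\subseteq H$ is the locus of points $[I]$ where $I$ is obtained from $(\mathcal{MG})$ by specializing the indeterminates to elements of $K$, i.e. the image of the map $\operatorname{Spec}(R)\to H$ induced by this flat family; it contains the points of all distinguished ideals (set all $\theta_{k,u}=0$). The locus $U$ is obtained by applying to the points of $\tilde X_{\mathcal{O}}$ the $n$-dimensional family of ordinary translations of $\mathbb{A}^n_K$; it is irreducible and parametrizes subschemes supported at one point.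
   Formalization: Key monomials are minimal in graded lex order, not pure lex; this matters only for (1,5,9,7), where pure lex gives χ_2=x_2x_5^2 and dim at most 114, not 123. There χ_2=x_2^2, and τ(m)=0 for m with leading variable x_2 not divisible by x_2^2. *)

(* Defs.v *)
From HB Require Import structures.
From mathcomp Require Import all_boot all_order all_algebra.
From mathcomp Require Import mpoly.

Set Implicit Arguments.
Unset Strict Implicit.
Unset Printing Implicit Defensive.

Import Order.TTheory GRing.Theory.
Local Open Scope ring_scope.

(** * The Hilbert scheme of points of affine space

Over an algebraically closed field, a scheme locally of finite type is handled
through its K-points: their Zariski topology has the same closed sets,
irreducible closed sets and components as the scheme.  The scheme structure
itself enters only through the equations of the affine charts, which give the
tangent spaces. *)

Section Hilbert.
Variables (K : fieldType) (n : nat).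
Implicit Types (f g : {mpoly K[n]}) (I J : {mpoly K[n]} -> Prop).

Definition is_ideal I : Prop :=
  [/\ I 0, forall f g, I f -> I g -> I (f + g) & forall f g, I g -> I (f * g)].

Definition ideal_gen (G : {mpoly K[n]} -> Prop) f : Prop :=
  forall J, is_ideal J -> (forall g, G g -> J g) -> J f.

(** The classes of [e 0], ..., [e (m - 1)] form a K-basis of K[x]/I. *)
Definition quotient_basis m (e : 'I_m -> {mpoly K[n]}) I : Prop :=
  forall f, exists! c : 'rV[K]_m, I (f - \sum_i c 0 i *: e i).

Variable mu : nat.

Record hilb := Hilb {
  hilb_ideal :> {mpoly K[n]} -> Prop;
  _ : is_ideal hilb_ideal;
  _ : exists e : 'I_mu -> {mpoly K[n]}, quotient_basis e hilb_ideal
}.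

Implicit Types (x y : hilb) (Z E : hilb -> Prop).

Definition reduced x : Prop :=
  forall f k, hilb_ideal x (f ^+ k) -> hilb_ideal x f.

Definition supported_at (a : 'I_n -> K) x : Prop :=
  forall b : 'I_n -> K,
    (forall f, hilb_ideal x f -> f.@[b] = 0) <-> (forall i, b i = a i).

(** ** Charts

For an order ideal [B] of [mu] monomials (enumerated in some order), the ideals
for which [B] is a basis of the quotient form an open subscheme of the Hilbert
scheme, and these cover it.  An ideal in this chart is determined by the [n]
matrices of multiplication by the variables in the basis [B]; the coordinate of
index [(k, i, j)] is the entry [(i, j)] of the matrix of the [k]-th variable. *)

Definition order_ideal (B : mu.-tuple 'X_{1..n}) : Prop :=
  uniq B /\ forall m m', m \in B -> (m' <= m)%MM -> m' \in B.

Definition coord := ('I_n * 'I_mu * 'I_mu)%type.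

Definition cidx (k : 'I_n) (i j : 'I_mu) : 'I_#|{: coord}| :=
  enum_rank ((k, i, j) : coord).

Definition chart_coord (B : mu.-tuple 'X_{1..n}) x
    (v : 'I_#|{: coord}| -> K) : Prop :=
  quotient_basis (fun i => 'X_[tnth B i]) x /\
  forall k j, hilb_ideal x ('X_[(U_(k) + tnth B j)%MM]
                            - \sum_i v (cidx k i j) *: 'X_[tnth B i]).

(** The chart is the closed subscheme of affine space of the tuples of matrices
which commute and whose column of index [j] is the basis vector [i0] whenever
[B_i0] is the product of the [k]-th variable by [B_j]; over every K-algebra
such tuples are the same as ideals with quotient freely generated by [B]. *)

Definition gen_mx (k : 'I_n) : 'M[{mpoly K[#|{: coord}|]}]_mu :=
  \matrix_(i, j) 'X_(cidx k i j).

Inductive chart_eq (B : mu.-tuple 'X_{1..n}) :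
    {mpoly K[#|{: coord}|]} -> Prop :=
  | chart_comm k l i j :
      chart_eq B ((gen_mx k *m gen_mx l - gen_mx l *m gen_mx k) i j)
  | chart_basis k i0 j i : tnth B i0 = (U_(k) + tnth B j)%MM ->
      chart_eq B (gen_mx k i j - (i == i0)%:R).

(** Zariski tangent space of the chart at the point of coordinates [v]. *)
Definition chart_tangent (B : mu.-tuple 'X_{1..n})
    (v : 'I_#|{: coord}| -> K) (w : 'rV[K]_#|{: coord}|) : Prop :=
  forall p, chart_eq B p -> \sum_q (p^`M(q)).@[v] * w 0 q = 0.

(** The dimension does not depend on the chart used. *)
Definition tangent_dim x (d : nat) : Prop :=
  exists B v, [/\ order_ideal B, chart_coord B x v &
    exists T : 'M[K]_(d, #|{: coord}|), row_free T /\
      forall w : 'rV_#|{: coord}|, chart_tangent B v w <-> (w <= T)%MS].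

(** ** Zariski topology and dimension *)

Definition zclosed Z : Prop :=
  forall B, order_ideal B ->
  exists P : {mpoly K[#|{: coord}|]} -> Prop,
  forall x v, chart_coord B x v -> (Z x <-> forall p, P p -> p.@[v] = 0).

Definition zclosure Z : hilb -> Prop :=
  fun x => forall F, zclosed F -> (forall y, Z y -> F y) -> F x.

Definition irreducible Z : Prop :=
  (exists x, Z x) /\
  forall F G, zclosed F -> zclosed G -> (forall x, Z x -> F x \/ G x) ->
    (forall x, Z x -> F x) \/ (forall x, Z x -> G x).

Definition irr_component E : Prop :=
  irreducible E /\
  forall Z, irreducible Z -> (forall x, E x -> Z x) -> forall x, Z x -> E x.

Definition elementary_component E : Prop :=
  irr_component E /\ forall x, E x -> exists a, supported_at a x.

(** Chain [Z_0 < ... < Z_d] of irreducible closed subsets of the subspace [Z],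
with [Z_i] the trace of [F i] on [Z]. *)
Definition irr_chain Z (F : nat -> hilb -> Prop) (d : nat) : Prop :=
  (forall i, (i <= d)%N ->
     zclosed (F i) /\ irreducible (fun x => F i x /\ Z x)) /\
  (forall i, (i < d)%N ->
     (forall x, Z x -> F i x -> F i.+1 x) /\
     exists x, [/\ Z x, F i.+1 x & ~ F i x]).

(** Krull dimension of the subspace [Z]. *)
Definition has_dim Z (d : nat) : Prop :=
  (exists F, irr_chain Z F d) /\
  forall e, (exists F, irr_chain Z F e) -> (e <= d)%N.

(** Krull dimension of the local ring of the Hilbert scheme at [x]. *)
Definition has_local_dim x (d : nat) : Prop :=
  let chain e := exists F, irr_chain (fun _ => True) F e /\ F 0%N x in
  chain d /\ forall e, chain e -> (e <= d)%N.

Definition smooth_point x : Prop :=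
  exists d, tangent_dim x d /\ has_local_dim x d.

Definition principal_component : hilb -> Prop := zclosure reduced.

(** The point of ideal [{f | f(x + a) \in I}], for [I] the ideal of [x]. *)
Definition is_translate (a : 'I_n -> K) x y : Prop :=
  forall f, hilb_ideal y f <->
            hilb_ideal x (f \mPo [tuple 'X_i + (a i)%:MP | i < n]).

Definition translates Z : hilb -> Prop :=
  fun y => exists a x, Z x /\ is_translate a x y.

End Hilbert.

(** * Admissible order ideals

[<%O] on ['X_{1..n}] compares degrees first, and then exponents
lexicographically with the first variable largest. *)

Section Admissible.
Variables (h : seq nat) (n : nat).
Implicit Types (m b t u : 'X_{1..n}) (k : 'I_n).

Definition socdeg : nat := (size h).-1.
Local Notation s := socdeg.

Definition in_O m : bool :=
  (#|[set m' : 'X_{1..n < (mdeg m).+1} | (mdeg m' == mdeg m)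
                                         && (bmnm m' < m)%O]|
     < nth 0 h (mdeg m))%N.

Definition in_border b : bool :=
  ~~ in_O b && [exists k, (0 < b k)%N && in_O (b - U_(k))%MM].

Definition in_LM b : bool :=
  [&& in_border b, (mdeg b <= s)%N &
      [forall k, (0 < b k)%N ==> in_O (b - U_(k))%MM]].

Definition in_TM t : bool := in_O t && (mdeg t == s).

(** The bound [r <= mdeg m] holds for every monomial outside [in_O]. *)
Definition in_N m : bool := ~~ in_O m && (mdeg m <= s.+1)%N.

Definition is_lead k m : bool :=
  (0 < m k)%N && [forall j : 'I_n, (j < k)%N ==> (m j == 0%N)].

Definition is_key k : bool :=
  [exists m : 'X_{1..n < s.+1}, in_N m && is_lead k m].

(** This is the one place where monomials of different degrees are compared:
the graded order is used, so that the degree of [key_mon k] is minimal.  For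
the Hilbert functions considered this matters only for the second variable and
[h = (1,5,9,7)], where the key monomial is [x_2^2]; the ungraded order would
select [x_2 x_5^2], and leave 4 + 15 * 7 + 5 = 114 parameters for a locus of
dimension 123. *)
Definition key_mon k : 'X_{1..n} :=
  if [pick b : 'X_{1..n < s.+1} |
        [&& in_LM b, is_lead k b &
            [forall b' : 'X_{1..n < s.+1},
               in_LM b' && is_lead k b' ==> (bmnm b <= bmnm b')%O]]]
  is Some b then b else 0%MM.

Definition key_exp k : nat := key_mon k k.
Definition key_hat k : 'X_{1..n} := (key_mon k - U_(k) *+ key_exp k)%MM.

(** [u = t / key_hat k] for some [t] in [O \ TM] of degree at least that of
[key_mon k]. *)
Definition in_T k u : bool :=
  let t := (u + key_hat k)%MM in
  [&& in_O t, ~~ in_TM t & (mdeg (key_mon k) <= mdeg t)%N].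

(** Index sets of the families [C_{t,b}] (as pairs [(t, b)]) and
[theta_{k,u}]. *)
Definition Cidx : finType :=
  {p : 'X_{1..n < s.+1} * 'X_{1..n < s.+1} | in_TM p.1 && in_LM p.2}.
Definition Thidx : finType :=
  {q : 'I_n * 'X_{1..n < s.+1} | is_key q.1 && in_T q.1 q.2}.

Variable K : fieldType.
Variables (C : Cidx -> K) (theta : Thidx -> K).

(** The sum is empty when [m] is not in [LM]. *)
Definition Ypoly m : {mpoly K[n]} :=
  - \sum_(p : Cidx | bmnm (val p).2 == m) C p *: 'X_[(val p).1].

(** The recursion defining tau.  Its indeterminates are already replaced by
their values in K, which commutes with every operation involved.  When
[key_exp k] exceeds [m k], the degree of each [m'] exceeds [s] in the cases
considered, and [tau m] is zero. *)
Definition is_tau (tau : 'X_{1..n} -> {mpoly K[n]}) : Prop :=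
  forall m, in_N m ->
    (mdeg m = s.+1 -> tau m = 0) /\
    (forall k, (mdeg m <= s)%N -> is_lead k m ->
       let mult (q : Thidx) :=
         ((m - U_(k) *+ key_exp k) + (val q).2)%MM in
       let repl m' := if in_O m' then 'X_[m'] else - (Ypoly m' + tau m') in
       tau m = \sum_(q : Thidx | ((val q).1 == k) && (mdeg (mult q) <= s)%N)
                 theta q *: repl (mult q)).

Definition modgen (tau : 'X_{1..n} -> {mpoly K[n]}) (g : {mpoly K[n]}) : Prop :=
  exists2 b, in_border b & g = 'X_[b] + Ypoly b + tau b.

Definition distgen (g : {mpoly K[n]}) : Prop :=
  exists2 b, in_border b & g = 'X_[b] + Ypoly b.

End Admissible.

Definition distinguished (K : fieldType) (h : seq nat) n mu
    (C : Cidx h n -> K) (x : hilb K n mu) : Prop :=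
  forall f, hilb_ideal x f <-> ideal_gen (distgen C) f.

Definition mod_distinguished (K : fieldType) (h : seq nat) n mu
    (x : hilb K n mu) : Prop :=
  exists (C : Cidx h n -> K) (theta : Thidx h n -> K) tau,
    is_tau C theta tau /\
    forall f, hilb_ideal x f <-> ideal_gen (modgen C tau) f.

(** [Q] holds on a nonempty open subset of the affine space [K^T]. *)
Definition sufficiently_general (K : fieldType) (T : finType)
    (Q : (T -> K) -> Prop) : Prop :=
  exists2 P : {mpoly K[#|T|]}, P != 0 &
    forall c : T -> K, P.@[fun i => c (enum_val i)] != 0 -> Q c.

(* Main.v *)
Require Import Defs.
From Stdlib Require Import BinPosDef.
From HB Require Import structures.
From mathcomp Require Import all_boot all_order all_algebra.
From mathcomp Require Import mpoly zify ring.
From mathcomp Require Import boolp.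

(** The locus U is the image of a polynomial map [phi] from the affine space of the
parameters (C, theta, a) to the chart of O, and [phi] has a polynomial left inverse
[psi]: the C and theta are coefficients of normal forms, and the coordinates of the
point of support are the traces of the multiplications by the variables, divided by
mu.  So U is irreducible; its dimension is the number d of parameters, because more
than d rational functions in d variables are algebraically dependent.

If the tangent space at a point x of U injects into the space of the parameters,
Hadamard's lemma shows that the equations of the chart force z = phi (psi z) for z near
x.  Then U contains a neighbourhood of x, so that its closure is a component and x is a
smooth point.  This condition on the tangent space is open in C, and for each Hilbert
function it is enough to exhibit one distinguished ideal.  There all coefficients are 0
or 1, and the tangent equations are solved by propagation: each of them, in a suitable
order, involves at most one unknown which is not yet known to vanish.

The ideal (MG) is studied through its normal forms: the recursion for tau determines a
linear projection onto Span(O), and the point is that its kernel is an ideal. *)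

Set Implicit Arguments.
Unset Strict Implicit.
Unset Printing Implicit Defensive.

Import Order.TTheory GRing.Theory.

Local Open Scope ring_scope.

(** The chart of O is only one of the charts in which closedness, irreducibility and dimension are
    tested. Hence every family is treated as a [rational_family]: in each chart the coordinates of
    its points are F / D, and D is nonzero exactly when the point lies in that chart. This one
    notion covers U, the flags inside U, tuples of points for the principal component, and the
    transition between two charts.

    No dimension of a tangent space is computed. The differential of psi o phi = id yields d
    independent tangent vectors, and d coordinates of the chart are exhibited on which a tangent
    vector is determined; the two bounds meet. The second condition says that some square matrix of
    partial derivatives is invertible, which is why it is open in C.

    The propagation involves neither division nor the field: every equation that is used has one
    remaining unknown, with coefficient 1 or -1. It can therefore run on lists of exponents, for all
    K at once. Characteristic 0 enters through the existence of nonzero values of polynomials and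
    through the division of traces by mu. *)

Lemma base_expansion_inj D n (f g : 'I_n -> nat) :
  (forall i, f i < D)%N -> (forall i, g i < D)%N ->
  (\sum_i f i * D ^ i = \sum_i g i * D ^ i)%N -> f =1 g.
Proof.
elim: n f g => [|n IHn] f g fD gD; first by move=> _ [].
have D0 : (0 < D)%N by apply: leq_ltn_trans (fD ord0).
have shift (h : 'I_n.+1 -> nat) : (\sum_(i < n) h (lift ord0 i) * D ^ lift ord0 i
    = (\sum_(i < n) h (lift ord0 i) * D ^ i) * D)%N.
  rewrite big_distrl /=; apply: eq_bigr => i _.
  by rewrite /bump leq0n add1n expnSr mulnA.
rewrite !big_ord_recl !shift /= expn0 !muln1 => eq_fg.
have eq0 : f ord0 = g ord0.
  by have := congr1 (modn^~ D) eq_fg; rewrite !(addnC (_ ord0)) !modnMDl !modn_small.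
move: eq_fg; rewrite eq0 => /addnI /eqP; rewrite eqn_pmul2r // => /eqP eq_fg.
move=> i; case: (unliftP ord0 i) => [j|] -> //.
exact: (IHn (fun j => f (lift ord0 j)) (fun j => g (lift ord0 j))).
Qed.

(** * Polynomials in several variables *)

Lemma meval_exp (R : comNzRingType) n (u : 'I_n -> R) (p : {mpoly R[n]}) k : (p ^+ k).@[u] = p.@[u] ^+ k.
Proof. by elim: k => [|k IH]; rewrite ?expr0 ?meval1 // !exprS mevalM IH. Qed.

Lemma meval_prod (R : comNzRingType) n (u : 'I_n -> R) (I : Type) (s : seq I) (P : pred I)
    (F : I -> {mpoly R[n]}) :
  (\prod_(i <- s | P i) F i).@[u] = \prod_(i <- s | P i) (F i).@[u].
Proof. by apply: (big_morph (meval u)); [exact: mevalM | exact: meval1]. Qed.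

Lemma meval_sum (R : comNzRingType) n (u : 'I_n -> R) (I : Type) (s : seq I) (P : pred I)
    (F : I -> {mpoly R[n]}) :
  (\sum_(i <- s | P i) F i).@[u] = \sum_(i <- s | P i) (F i).@[u].
Proof. by apply: (big_morph (meval u)); [exact: mevalD | exact: meval0]. Qed.

Lemma meval_natr (R : comNzRingType) n (u : 'I_n -> R) k :
  (k%:R : {mpoly R[n]}).@[u] = k%:R.
Proof. by rewrite mevalMn meval1. Qed.

Lemma comp_mpoly_sum (R : comNzRingType) n k (t : n.-tuple {mpoly R[k]})
    (I : Type) (s : seq I) (P : pred I) (F : I -> {mpoly R[n]}) :
  (\sum_(i <- s | P i) F i) \mPo t = \sum_(i <- s | P i) (F i \mPo t).
Proof. by apply: (big_morph (comp_mpoly t)); [exact: comp_mpolyD | exact: comp_mpoly0]. Qed.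

Lemma mcoeff_sum (R : nzRingType) n (m : 'X_{1..n})
    (I : Type) (s : seq I) (P : pred I) (F : I -> {mpoly R[n]}) :
  (\sum_(i <- s | P i) F i)@_m = \sum_(i <- s | P i) (F i)@_m.
Proof. by apply: (big_morph (mcoeff m)); [exact: mcoeffD | exact: mcoeff0]. Qed.

Section MpolyBasics.
Variable K : fieldType.

Lemma mnm_lt_msize n (p : {mpoly K[n]}) m i : m \in msupp p -> (m i < msize p)%N.
Proof.
move=> /msize_mdeg_lt; apply: leq_ltn_trans.
by rewrite mdegE (bigD1 i) //= leq_addr.
Qed.

(* Kronecker substitution reduces the claim to one variable. *)
Lemma mpoly_nonroot (charK0 : [pchar K] =i pred0) n (p : {mpoly K[n]}) :
  p != 0 -> exists u, p.@[u] != 0.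
Proof.
(* [msize p] exceeds every exponent in p, so distinct monomials have distinct codes in base D and no
   two terms of p merge. *)
move=> p0; pose D := msize p.
pose code (m : 'X_{1..n}) := (\sum_i m i * D ^ i)%N.
pose q : {poly K} := \sum_(m <- msupp p) p@_m *: 'X^(code m).
have qE z : q.[z] = p.@[fun i => z ^+ (D ^ i)].
  rewrite mevalE horner_sum; apply: eq_bigr => m _; rewrite hornerZ hornerXn.
  congr (_ * _); rewrite -prodrXr; apply: eq_bigr => i _.
  by rewrite -exprM mulnC.
have q0 : q != 0.
  have [m mp] : exists m, m \in msupp p.
    by exists (mlead p); apply: mlead_supp.
  apply/eqP => /(congr1 (fun r : {poly K} => r`_(code m))).
  rewrite coef0 /q coef_sum (bigD1_seq m mp (msupp_uniq p)) /=.
  rewrite coefZ coefXn eqxx mulr1 big_seq_cond big1 ?addr0 => [/eqP|m' /andP[m'p ne]].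
    by rewrite mcoeff_eq0 mp.
  rewrite coefZ coefXn; case: eqP => [eqc|]; last by rewrite mulr0.
  case/eqP: ne; apply/mnmP; apply: (@base_expansion_inj D) => // i;
    exact: mnm_lt_msize.
suff [z qz] : exists z, q.[z] != 0 by exists (fun i => z ^+ (D ^ i)); rewrite -qE.
apply: contrapT => /forallNP q_all0.
(* In characteristic 0 the integers below [size q] are distinct; as roots of q they would be one
   more than its degree allows. *)
have /max_poly_roots - /(_ [seq k%:R | k <- iota 0 (size q)]) := q0.
rewrite size_map size_iota ltnn => absurd; suff: false by [].
apply: absurd.
  apply/allP => _ /mapP[k _ ->]; apply/rootP/eqP.
  by apply: contrapT => /negP nz; exact: (q_all0 _ nz).
rewrite map_inj_uniq ?iota_uniq // => i j.
wlog le_ij : i j / (i <= j)%N => [hw /=|/eqP].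
  by case/orP: (leq_total i j) => /hw // h /esym /h.
rewrite eq_sym -subr_eq0 -natrB //.
move/pcharf0P: charK0 => ->; rewrite subn_eq0 => le_ji.
by apply/eqP; rewrite eqn_leq le_ij.
Qed.

Lemma mpoly_eq_fun (charK0 : [pchar K] =i pred0) n (p q : {mpoly K[n]}) :
  (forall u, p.@[u] = q.@[u]) -> p = q.
Proof.
move=> eq_pq; apply/eqP; rewrite -subr_eq0; apply/contraT.
by case/(mpoly_nonroot charK0) => u; rewrite mevalB eq_pq subrr eqxx.
Qed.

(** Clearing denominators: for v = F(u) / D(u), a power of D(u) that is at least the degree of p
    turns p(v) into a polynomial in u. *)
Lemma homogenized_eval N r (D : {mpoly K[r]}) (F : 'I_N -> {mpoly K[r]})
    (p : {mpoly K[N]}) :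
  exists k, exists P : {mpoly K[r]}, forall u v,
    (forall q, (F q).@[u] = D.@[u] * v q) -> P.@[u] = D.@[u] ^+ k * p.@[v].
Proof.
exists (msize p).
exists (\sum_(m <- msupp p) p@_m *: (D ^+ (msize p - mdeg m) * \prod_q F q ^+ m q)).
move=> u v Fv; rewrite meval_sum [p.@[_]]mevalE mulr_sumr /= !big_seq.
apply: eq_bigr => m /msize_mdeg_lt lt_m.
rewrite mevalZ mevalM meval_exp meval_prod [RHS]mulrCA; congr (_ * _).
rewrite (eq_bigr (fun q => D.@[u] ^+ m q * v q ^+ m q)); last first.
  by move=> q _; rewrite meval_exp Fv exprMn.
rewrite big_split /= mulrA prodrXr -mdegE -exprD subnK //; exact: ltnW.
Qed.

End MpolyBasics.

Lemma mpoly_ring_ind (R : comNzRingType) n (Q : {mpoly R[n]} -> Prop) :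
  (forall c, Q c%:MP) -> (forall i, Q 'X_i) ->
  (forall p q, Q p -> Q q -> Q (p + q)) ->
  (forall p q, Q p -> Q q -> Q (p * q)) -> forall p, Q p.
Proof.
move=> QC QX QD QM p; rewrite (mpolyE p); elim: (msupp p) => [|m ms IH].
  by rewrite big_nil -mpolyC0; apply: QC.
rewrite big_cons; apply: QD => //; rewrite -mul_mpolyC; apply: (QM); first exact: QC.
rewrite mpolyXE_id; apply: (big_ind Q) => [|p1 p2|i _]; [by rewrite -mpolyC1 | exact: (QM) |].
elim: (m i) => [|k IHk]; first by rewrite expr0 -mpolyC1.
by rewrite exprS; apply: QM.
Qed.

Section MpolyCalculus.
Variable K : fieldType.

Lemma mderivXU N (i j : 'I_N) : ('X_j : {mpoly K[N]})^`M(i) = (i == j)%:R.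
Proof.
rewrite mderivX mnm1E eq_sym; case: eqP => [->|_]; last by rewrite scale0r.
by rewrite (_ : _ - _ = 0)%MM ?mpolyX0 ?scale1r //; apply/mnmP=> k;
  rewrite mnmBE mnm0E subnn.
Qed.

Lemma mderiv_comp N r (p : {mpoly K[N]}) (F : N.-tuple {mpoly K[r]}) i :
  (p \mPo F)^`M(i) = \sum_q ((p^`M(q)) \mPo F) * (tnth F q)^`M(i).
Proof.
elim/mpoly_ring_ind: p => [c|j|p q IHp IHq|p q IHp IHq].
- rewrite comp_mpolyC mderivC big1 // => q _.
  by rewrite mderivC comp_mpoly0 mul0r.
- rewrite comp_mpolyXU (bigD1 j) //= -tnth_nth mderivXU eqxx comp_mpoly1 mul1r.
  rewrite big1 ?addr0 // => q /negPf ne_qj.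
  by rewrite mderivXU ne_qj comp_mpoly0 mul0r.
- rewrite comp_mpolyD mderivD IHp IHq -big_split; apply: eq_bigr => j _.
  by rewrite mderivD comp_mpolyD mulrDl.
rewrite rmorphM mderivM IHp IHq mulr_suml mulr_sumr -big_split /=.
apply: eq_bigr => j _; rewrite mderivM comp_mpolyD !rmorphM /=; ring.
Qed.

(* Hadamard's lemma for [p z - p (zeta z)], the coefficients being the partial
derivatives at the fixed points of [zeta]. *)
Lemma mpoly_hadamard N (zeta : N.-tuple {mpoly K[N]}) (p : {mpoly K[N]}) :
  exists a : 'I_N -> {mpoly K[N]},
    p - (p \mPo zeta) = \sum_j a j * ('X_j - tnth zeta j) /\
    forall x, (forall j, (tnth zeta j).@[x] = x j) ->
      forall j, (a j).@[x] = p^`M(j).@[x].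
Proof.
elim/mpoly_ring_ind: p => [c|i|p q [a [pE aE]] [b [qE bE]]|p q [a [pE aE]] [b [qE bE]]].
- exists (fun=> 0); split=> [|x _ j]; last by rewrite mderivC !meval0.
  by rewrite comp_mpolyC subrr big1 // => j _; rewrite mul0r.
- exists (fun j => (j == i)%:R); split=> [|x _ j].
    rewrite (bigD1 i) //= eqxx mul1r comp_mpolyXU -tnth_nth big1 ?addr0 // => j.
    by move/negPf->; rewrite mul0r.
  by rewrite mderivXU; case: eqP; rewrite ?meval1 ?meval0.
- exists (fun j => a j + b j); split=> [|x xE j].
    rewrite comp_mpolyD opprD addrACA pE qE -big_split /=.
    by apply: eq_bigr => j _; rewrite mulrDl.
  by rewrite mderivD !mevalD aE ?bE.
exists (fun j => p * b j + (q \mPo zeta) * a j); split=> [|x xE j].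
  have -> : p * q - (p * q \mPo zeta)
      = p * (q - (q \mPo zeta)) + (q \mPo zeta) * (p - (p \mPo zeta)).
    rewrite rmorphM /=; ring.
  rewrite pE qE !mulr_sumr -big_split /=; apply: eq_bigr => j _; ring.
rewrite mderivM !mevalD !mevalM comp_mpoly_meval aE ?bE //.
rewrite (meval_eq _ xE); ring.
Qed.
End MpolyCalculus.

(** * Ideals *)

Section Ideals.
Variables (K : fieldType) (n : nat) (I : {mpoly K[n]} -> Prop).
Hypothesis idI : is_ideal I.

Lemma ideal0 : I 0. Proof. by case: idI. Qed.
Lemma idealD f g : I f -> I g -> I (f + g). Proof. by case: idI => _ + _; apply. Qed.
Lemma idealMl f g : I g -> I (f * g). Proof. by case: idI => _ _; apply. Qed.
Lemma idealMr f g : I f -> I (f * g). Proof. by rewrite mulrC; apply: idealMl. Qed.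
Lemma idealZ c f : I f -> I (c *: f).
Proof. by rewrite -mul_mpolyC; apply: idealMl. Qed.
Lemma idealN f : I f -> I (- f). Proof. by rewrite -scaleN1r; apply: idealZ. Qed.
Lemma idealB f g : I f -> I g -> I (f - g).
Proof. by move=> If Ig; apply: idealD => //; apply: idealN. Qed.
Lemma ideal_sum (T : Type) (s : seq T) (P : pred T) F :
  (forall i, P i -> I (F i)) -> I (\sum_(i <- s | P i) F i).
Proof. by move=> IF; apply: (big_ind I); [exact: ideal0 | exact: idealD | ]. Qed.
Lemma ideal_sum_seq (T : eqType) (s : seq T) (P : pred T) F :
  (forall i, i \in s -> P i -> I (F i)) -> I (\sum_(i <- s | P i) F i).
Proof. by move=> IF; rewrite big_seq_cond; apply: ideal_sum => i /andP[]; apply: IF. Qed.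
Lemma ideal_trans g f h : I (f - g) -> I (g - h) -> I (f - h).
Proof. by move=> Ifg Igh; rewrite -(subrKA g); apply: idealD. Qed.
Lemma ideal_sym f g : I (f - g) -> I (g - f).
Proof. by move=> ?; rewrite -opprB; apply: idealN. Qed.
Lemma ideal_congr f g : I (f - g) -> I g -> I f.
Proof. by move=> Ifg Ig; rewrite -(subrK g f); apply: idealD. Qed.
End Ideals.

(** * Chains of prime ideals *)

Definition prime_ideal (K : fieldType) n (P : {mpoly K[n]} -> Prop) :=
  [/\ is_ideal P, ~ P 1 & forall f g, P (f * g) -> P f \/ P g].

Lemma prime_idealX (K : fieldType) n (P : {mpoly K[n]} -> Prop) f a :
  prime_ideal P -> P (f ^+ a) -> P f.
Proof.
case=> _ P1 PM; elim: a => [|a IHa]; first by rewrite expr0.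
by rewrite exprS => /PM[|/IHa].
Qed.

(* If g were a relation, divide it by the largest power of its last variable and
set that variable to 0: its value lies in the larger prime. *)
Lemma prime_chain_alg_indep (K : fieldType) N e (P : nat -> {mpoly K[N]} -> Prop)
    (f : e.-tuple {mpoly K[N]}) :
  (forall i, (i <= e)%N -> prime_ideal (P i)) ->
  (forall i, (i < e)%N -> forall g, P i.+1 g -> P i g) ->
  (forall i : 'I_e, P i (tnth f i) /\ ~ P i.+1 (tnth f i)) ->
  forall g : {mpoly K[e]}, P e (g \mPo f) -> g = 0.
Proof.
move=> primeP decP fP g Pg; apply/eqP/contraT => g0; exfalso.
(* Descent along the chain: at level i only variables of index less than i occur in g. At level 0 a
   nonzero constant would lie in the proper ideal P_0. *)
suff: forall i, (i <= e)%N -> forall g : {mpoly K[e]}, g != 0 ->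
    (forall m, m \in msupp g -> forall j : 'I_e, (i <= j)%N -> m j = 0%N) ->
    ~ P i (g \mPo f).
  move/(_ e (leqnn e) g g0); apply => // m _ j.
  by rewrite leqNgt ltn_ord.
elim=> [|i IHi] le_ie {g0 Pg}g g0 gP Pg.
  have gE : g = (mleadc g)%:MP.
    apply/mpolyP => m; rewrite mcoeffC; case: (m =P 0%MM) => [->|m0].
      have /gP lead0 := mlead_supp g0.
      by rewrite mulr1; congr (_@_ _); apply/mnmP=> j; rewrite mnm0E lead0.
    rewrite mulr0; apply: memN_msupp_eq0; apply/negP => /gP mP; apply: m0.
    by apply/mnmP => j; rewrite mnm0E mP.
  have [idP P1 _] := primeP 0%N le_ie; apply: P1.
  have c0 : mleadc g != 0 by rewrite mleadc_eq0.
  have -> : 1 = (mleadc g)^-1 *: (g \mPo f) :> {mpoly K[N]}.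
    by rewrite gE comp_mpolyC mleadC mcoeffC eqxx mulr1 -mul_mpolyC -mpolyCM mulVf.
  exact: idealZ.
pose j0 := Ordinal le_ie.
have [fi fi1] := fP j0.
have [idP P1 PM] := primeP _ le_ie.
have [idP' _ _] := primeP _ (ltnW le_ie).
have exa : exists a, has (fun m : 'X_{1..e} => m j0 == a) (msupp g).
  by exists (mlead g j0); apply/hasP; exists (mlead g); rewrite ?mlead_supp.
case: (ex_minnP exa) => a /hasP[m0 m0g /eqP m0a] amin {exa}.
pose U := (U_(j0) *+ a)%MM.
have leU m : m \in msupp g -> (U <= m)%MM.
  move=> mg; apply/mnm_lepP => j; rewrite /U mulmnE mnm1E.
  case: (j0 =P j) => [<-|_]; rewrite ?mul0n // mul1n.
  by apply: amin; apply/hasP; exists m.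
pose h := \sum_(m <- msupp g) g@_m *: 'X_[(m - U)%MM].
have gE : g = 'X_[U] * h.
  rewrite {1}[g]mpolyE mulr_sumr big_seq [RHS]big_seq; apply: eq_bigr => m mg.
  by rewrite -scalerAr -mpolyXD addmC submK // leU.
(* P_{i+1} is prime and does not contain f_i, so the power of f_i can be cancelled. *)
have Ph : P i.+1 (h \mPo f).
  move: Pg; rewrite gE rmorphM /= => /PM[|//].
  rewrite /U -mpolyXn rmorphXn /= comp_mpolyXU -tnth_nth.
  by move/(prime_idealX (primeP _ le_ie)).
pose s := [seq (m - U)%MM | m <- filter (fun m : 'X_{1..e} => m j0 == a) (msupp g)].
pose h0 := \sum_(m <- s) g@_(m + U)%MM *: 'X_[m].
have us : uniq s.
  rewrite map_inj_in_uniq ?filter_uniq ?msupp_uniq // => m m'.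
  rewrite !mem_filter => /andP[_ mg] /andP[_ m'g].
  by move=> /(congr1 (fun x => x + U)%MM); rewrite !submK ?leU.
have h0E : h0 = \sum_(m <- msupp g | m j0 == a) g@_m *: 'X_[(m - U)%MM].
  rewrite /h0 big_map big_filter big_seq_cond [RHS]big_seq_cond.
  by apply: eq_bigr => m /andP[mg _]; rewrite submK ?leU.
have h0s : msupp h0 =i s.
  apply: perm_mem; apply: msupp_sumX => // m /mapP[m' + ->].
  by rewrite mem_filter => /andP[_ m'g]; rewrite submK ?leU // -mcoeff_msupp.
apply: (IHi (ltnW le_ie) h0).
- apply/eqP => h00; have := h0s (m0 - U)%MM; rewrite h00 msupp0 in_nil.
  suff -> : (m0 - U)%MM \in s by [].
  by apply/mapP; exists m0; rewrite // mem_filter m0a eqxx.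
- move=> m; rewrite h0s => /mapP[m']; rewrite mem_filter => /andP[/eqP m'a m'g] ->.
  move=> j; rewrite leq_eqVlt mnmBE mulmnE mnm1E => /orP[/eqP eij|lt_ij].
    have -> : j = j0 by apply: val_inj.
    by rewrite eqxx m'a mul1n subnn.
  by rewrite (gP m').
(* [h] minus [h0] is divisible by x_i, whose value f_i lies in P_i; so h0(f) lies in P_i because
   h(f) does. *)
have -> : h0 = h - \sum_(m <- msupp g | m j0 != a) g@_m *: 'X_[(m - U)%MM].
  by rewrite /h (bigID (fun m : 'X_{1..e} => m j0 == a)) /= h0E addrK.
rewrite rmorphB [X in _ - X]raddf_sum /=; apply: (idealB idP'); first exact: (decP _ le_ie _ Ph).
apply: ideal_sum_seq => // m mg ma.
have lt_am : (a < m j0)%N.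
  rewrite ltn_neqAle eq_sym ma /=.
  by have /mnm_lepP/(_ j0) := leU m mg; rewrite /U mulmnE mnm1E eqxx mul1n.
have -> : (m - U = U_(j0) + (m - U - U_(j0)))%MM.
  rewrite addmC submK //; apply/mnm_lepP => j; rewrite mnmBE mulmnE mnm1E.
  by case: (j0 =P j) => [<-|//]; rewrite mul1n subn_gt0.
rewrite mpolyXD comp_mpolyZ rmorphM /= comp_mpolyXU -tnth_nth.
by apply: idealZ => //; apply: idealMr.
Qed.

Lemma msize_mul_bound (K : fieldType) n (p q : {mpoly K[n]}) a b :
  (msize p <= a.+1)%N -> (msize q <= b.+1)%N -> (msize (p * q) <= (a + b).+1)%N.
Proof.
move=> pa qb; have [->|p0] := eqVneq p 0; first by rewrite mul0r msize0.
have [->|q0] := eqVneq q 0; first by rewrite mulr0 msize0.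
rewrite msizeM //; apply: (@leq_trans (a.+1 + b.+1).-1); last by rewrite addnS.
  by rewrite -!subn1 leq_sub2r // leq_add.
Qed.

Lemma msize_exp_bound (K : fieldType) n (p : {mpoly K[n]}) a k :
  (msize p <= a.+1)%N -> (msize (p ^+ k) <= (k * a).+1)%N.
Proof.
move=> pa; elim: k => [|k IHk]; first by rewrite expr0 msize1.
by rewrite exprS mulSn; apply: msize_mul_bound.
Qed.

Lemma msize_prod_bound (K : fieldType) n (I : Type) (s : seq I)
    (F : I -> {mpoly K[n]}) (a : I -> nat) :
  (forall i, msize (F i) <= (a i).+1)%N ->
  (msize (\prod_(i <- s) F i) <= (\sum_(i <- s) a i).+1)%N.
Proof.
move=> Fa; elim: s => [|i s IHs]; first by rewrite !big_nil msize1.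
by rewrite !big_cons; apply: msize_mul_bound.
Qed.

Lemma mpoly_lindep (K : fieldType) n (I J : finType) (W : I -> {mpoly K[n]})
    (mon : J -> 'X_{1..n}) :
  (#|J| < #|I|)%N ->
  (forall i m, m \in msupp (W i) -> exists j, mon j = m) ->
  exists c : I -> K, (exists i, c i != 0) /\ \sum_i c i *: W i = 0.
Proof.
move=> ltJI Wmon.
pose A := \matrix_(i < #|I|, j < #|J|) (W (enum_val i))@_(mon (enum_val j)).
have : kermx A != 0.
  by rewrite kermx_eq0 /row_free neq_ltn (leq_ltn_trans (rank_leq_col A)).
case/rowV0Pn => v /sub_kermxP vA v0.
exists (fun i => v 0 (enum_rank i)); split.
  by case/rV0Pn: v0 => i vi; exists (enum_val i); rewrite enum_valK.
apply/mpolyP => m; rewrite mcoeff0 raddf_sum /=.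
have [[j mj]|noj] := pselect (exists j, mon j = m); last first.
  apply: big1 => i _; rewrite mcoeffZ memN_msupp_eq0 ?mulr0 //.
  by apply/negP => /Wmon.
have := congr1 (fun B : 'rV_#|J| => B 0 (enum_rank j)) vA.
rewrite !mxE => vA0; rewrite -[RHS]vA0 (reindex enum_rank) /=; last first.
  by apply: onW_bij; apply: enum_rank_bij.
by apply: eq_bigr => i _; rewrite mcoeffZ !mxE !enum_rankK mj.
Qed.

(* The monomials of degree at most k in each f_i, cleared of denominators, lie in
a space of polynomials whose dimension grows like k ^ r. *)
Lemma rational_functions_dependent (K : fieldType) N r e
    (D : {mpoly K[r]}) (F : 'I_N -> {mpoly K[r]}) (f : e.-tuple {mpoly K[N]}) :
  (r < e)%N -> exists2 g : {mpoly K[e]}, g != 0 &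
    forall u v, D.@[u] != 0 -> (forall q, (F q).@[u] = D.@[u] * v q) ->
      (g \mPo f).@[v] = 0.
Proof.
move=> lt_re.
have /choice[kP kPE] : forall j, exists kP : nat * {mpoly K[r]}, forall u v,
    (forall q, (F q).@[u] = D.@[u] * v q) ->
    kP.2.@[u] = D.@[u] ^+ kP.1 * (tnth f j).@[v].
  by move=> j; have [k [P kP]] := homogenized_eval D F (tnth f j); exists (k, P).
pose k := (\max_j (kP j).1)%N.
pose G j := D ^+ (k - (kP j).1) * (kP j).2.
have GE j u v : (forall q, (F q).@[u] = D.@[u] * v q) ->
    (G j).@[u] = D.@[u] ^+ k * (tnth f j).@[v].
  move=> Fv; rewrite mevalM meval_exp (kPE _ _ v Fv) mulrA -exprD subnK //.
  by rewrite /k (leq_bigmax j).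
pose a := (maxn (msize D) (\max_j msize (G j)))%N.
have Da : (msize D <= a.+1)%N by rewrite leqW // leq_maxl.
have Ga j : (msize (G j) <= a.+1)%N.
  by rewrite leqW // leq_max (leq_bigmax j) orbT.
(* [c * kk] bounds the degree of each product [W al] below. The value of [kk] makes the count work:
   (c kk + 1)^r <= ((c + 1)(kk + 1))^r = kk (kk + 1)^r < (kk + 1)^(r + 1) <= (kk + 1)^e. *)
pose c := (e * (k * a + a))%N.
pose kk := (c.+1 ^ r)%N.
(* The monomial with exponents [al] in the f_j, multiplied by D^(k kk e). This power is the same for
   all [al], so a linear relation among the [W al] is a relation among the monomials wherever D does
   not vanish. *)
pose W (al : {ffun 'I_e -> 'I_kk.+1}) :=
  \prod_j (D ^+ (k * (kk - al j)) * G j ^+ al j).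
have Wsz al : (msize (W al) <= (c * kk).+1)%N.
  apply: leq_trans (_ : (\sum_(j < e) (k * a + a) * kk).+1 <= _)%N.
    apply: (msize_prod_bound _ (a := fun=> ((k * a + a) * kk)%N)) => j.
    apply: leq_trans (msize_mul_bound (msize_exp_bound _ Da) (msize_exp_bound _ (Ga j))) _.
    rewrite ltnS mulnDl leq_add //.
      by rewrite -!mulnA (mulnC a) leq_mul2l leq_mul2r leq_subr !orbT.
    by rewrite mulnC leq_mul2l -ltnS ltn_ord orbT.
  by rewrite ltnS sum_nat_const card_ord mulnA.
have [||cc [[al0 cal0] cW]] := @mpoly_lindep K r {ffun 'I_e -> 'I_kk.+1}
    {ffun 'I_r -> 'I_(c * kk).+1} W (fun be => [multinom (be i : nat) | i < r]).
- rewrite !card_ffun !card_ord.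
  apply: (@leq_trans (kk.+1 ^ r.+1)); last by rewrite leq_pexp2l.
  rewrite expnS; apply: (@leq_ltn_trans (kk * kk.+1 ^ r)); last first.
    by rewrite ltn_pmul2r ?expn_gt0.
  have le_exp x y t : (x <= y -> x ^ t <= y ^ t)%N.
    by move=> le_xy; elim: t => // t IHt; rewrite !expnS leq_mul.
  by rewrite /kk -expnMn le_exp // mulSn mulnS; lia.
- move=> al m mW; have mc j : (m j < (c * kk).+1)%N.
    by apply: leq_trans (mnm_lt_msize j mW) (Wsz al).
  by exists [ffun i => Ordinal (mc i)]; apply/mnmP => i; rewrite mnmE ffunE.
pose mon (al : {ffun 'I_e -> 'I_kk.+1}) := [multinom (al i : nat) | i < e].
have mon_inj : injective mon.
  move=> al be /mnmP eq_ab; apply/ffunP => i; apply: val_inj.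
  by have := eq_ab i; rewrite !mnmE.
exists (\sum_al cc al *: 'X_[mon al]).
  apply/eqP => /(congr1 (mcoeff (mon al0))); rewrite mcoeff0 raddf_sum /=.
  rewrite (bigD1 al0) //= mcoeffZ mcoeffX eqxx mulr1 big1 ?addr0 => [/eqP|be ne].
    by rewrite (negPf cal0).
  by rewrite mcoeffZ mcoeffX (inj_eq mon_inj) (negPf ne) mulr0.
move=> u v Du Fv; rewrite comp_mpoly_sum meval_sum.
have Du' : D.@[u] ^+ (k * kk * e) != 0 by rewrite expf_neq0.
apply: (mulfI Du'); rewrite mulr0 mulr_sumr.
have /(congr1 (meval u)) := cW; rewrite meval_sum meval0 => {2}<-.
apply: eq_bigr => al _; rewrite comp_mpolyZ !mevalZ mulrCA; congr (_ * _).
rewrite comp_mpolyX meval_prod /W meval_prod.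
rewrite [RHS](eq_bigr (fun j => D.@[u] ^+ (k * kk) * (tnth f j).@[v] ^+ al j)); last first.
  move=> j _; rewrite mevalM !meval_exp (GE _ _ v Fv) exprMn mulrA; congr (_ * _).
  by rewrite -exprM -exprD -mulnDr subnK // -ltnS.
rewrite big_split /= prodr_const card_ord -exprM; congr (_ * _).
by apply: eq_bigr => j _; rewrite meval_exp mnmE.
Qed.

(** Adapted to ideals and normal forms, where only the effect of multiplying by one variable is
    known. *)
Lemma mpoly_mulX_ind (R : comNzRingType) n (Q : {mpoly R[n]} -> Prop) :
  (forall c, Q c%:MP) -> (forall p q, Q p -> Q q -> Q (p + q)) ->
  (forall i p, Q p -> Q ('X_i * p)) -> forall p, Q p.
Proof.
move=> QC QD QX p; rewrite (mpolyE p); elim: (msupp p) => [|m ms IH].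
  by rewrite big_nil -mpolyC0; apply: QC.
rewrite big_cons; apply: QD => //; move: (p@_m) => c.
rewrite mpolyXE_id -mul_mpolyC; elim: (index_enum _) => [|i s IHs].
  by rewrite big_nil mulr1; apply: QC.
rewrite big_cons mulrCA; elim: (m i) => [|k IHk]; first by rewrite mul1r.
by rewrite exprS -mulrA; apply: (QX).
Qed.

(** * Bases of the quotient by an ideal *)

Section QuotientBases.
Variables (K : fieldType) (n : nat) (I : {mpoly K[n]} -> Prop).
Hypothesis idI : is_ideal I.

Lemma quotient_basis_coords m (e : 'I_m -> {mpoly K[n]}) f :
  quotient_basis e I -> exists c : 'rV[K]_m, I (f - \sum_i c 0 i *: e i).
Proof. by move=> /(_ f)[c [Ic _]]; exists c. Qed.

Lemma quotient_basis_free m (e : 'I_m -> {mpoly K[n]}) (c : 'I_m -> K) :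
  quotient_basis e I -> I (\sum_i c i *: e i) -> forall i, c i = 0.
Proof.
move=> /(_ (\sum_i c i *: e i))[d [_ d_uniq]] Ic i.
have d0 : d = 0.
  apply: d_uniq; rewrite [X in _ - X]big1 ?subr0 // => j _; by rewrite mxE scale0r.
have : d = \row_j c j.
  apply: d_uniq; under [X in _ - X]eq_bigr => j _ do rewrite mxE.
  by rewrite subrr; apply: ideal0.
by rewrite d0 => /rowP/(_ i); rewrite !mxE.
Qed.

Lemma quotient_basis_inj m (e : 'I_m -> {mpoly K[n]}) (c d : 'I_m -> K) f :
  quotient_basis e I -> I (f - \sum_i c i *: e i) -> I (f - \sum_i d i *: e i) ->
  c =1 d.
Proof.
move=> qb Ic Id i; apply/eqP; rewrite -subr_eq0; apply/eqP.
apply: (quotient_basis_free (c := fun i => c i - d i) qb).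
under eq_bigr => j _ do rewrite scalerBl.
rewrite sumrB; have := idealB idI Id Ic.
by rewrite opprB addrCA addrAC subrr add0r.
Qed.

Lemma quotient_basisI m (e : 'I_m -> {mpoly K[n]}) :
  (forall f, exists c : 'I_m -> K, I (f - \sum_i c i *: e i)) ->
  (forall c : 'I_m -> K, I (\sum_i c i *: e i) -> forall i, c i = 0) ->
  quotient_basis e I.
Proof.
move=> gen free f; have [c Ic] := gen f; exists (\row_i c i); split.
  by under eq_bigr => i _ do rewrite mxE.
move=> d Id; apply/rowP => i; rewrite mxE; apply/eqP; rewrite -subr_eq0; apply/eqP.
apply: (free (fun i => c i - d 0 i)).
under eq_bigr => j _ do rewrite scalerBl.
rewrite sumrB; have := idealB idI Id Ic.
by rewrite opprB addrCA addrAC subrr add0r.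
Qed.

Lemma ideal_matrix_subst m (e e' : 'I_m -> {mpoly K[n]}) (A : 'M[K]_m) (c : 'I_m -> K) :
  (forall j, I (e' j - \sum_i A j i *: e i)) ->
  I (\sum_j c j *: e' j - \sum_i ((\row_j c j) *m A) 0 i *: e i).
Proof.
move=> Ae.
have -> : \sum_i ((\row_j c j) *m A) 0 i *: e i = \sum_j c j *: \sum_i A j i *: e i.
  under [RHS]eq_bigr => j _ do rewrite scaler_sumr.
  rewrite exchange_big /=; apply: eq_bigr => i _; rewrite mxE scaler_suml.
  by apply: eq_bigr => j _; rewrite mxE scalerA.
rewrite -sumrB; apply: ideal_sum => // j _; rewrite -scalerBr; exact: idealZ.
Qed.

Lemma quotient_basis_change m (e e' : 'I_m -> {mpoly K[n]}) (A : 'M[K]_m) :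
  quotient_basis e I -> (forall j, I (e' j - \sum_i A j i *: e i)) ->
  quotient_basis e' I <-> \det A != 0.
Proof.
move=> qb Ae; rewrite -unitfE -unitmxE; split=> [qb'|uA].
  rewrite -row_free_unit -kermx_eq0; apply/rowV0P => v /sub_kermxP vA.
  apply/rowP => j; rewrite mxE; apply: (quotient_basis_free (c := v 0) qb').
  have := ideal_matrix_subst (v 0) Ae.
  have -> : (\row_j v 0 j) = v by apply/rowP => i; rewrite mxE.
  rewrite vA [X in _ - X]big1 ?subr0 // => i _; by rewrite mxE scale0r.
apply: quotient_basisI => [f|c Ic j].
  have [d Id] := quotient_basis_coords f qb.
  exists (fun j => (d *m invmx A) 0 j).
  have := ideal_matrix_subst (fun j => (d *m invmx A) 0 j) Ae.
  have -> : (\row_j (d *m invmx A) 0 j) = d *m invmx A.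
    by apply/rowP => i; rewrite mxE.
  by rewrite mulmxKV // => /(ideal_sym idI); apply: ideal_trans.
have := ideal_congr idI (ideal_sym idI (ideal_matrix_subst c Ae)) Ic.
move=> /(quotient_basis_free qb) cA.
have : (\row_j c j) *m A = 0 by apply/rowP => i; rewrite cA mxE.
move=> /(congr1 (mulmxr (invmx A))); rewrite /= mul0mx mulmxK //.
by move=> /rowP/(_ j); rewrite !mxE.
Qed.

Lemma quotient_basis_of_coords m (e e' : 'I_m -> {mpoly K[n]}) :
  quotient_basis e I -> exists A : 'M[K]_m, forall j, I (e' j - \sum_i A j i *: e i).
Proof.
move=> qb; have /choice[c Ic] := fun j => quotient_basis_coords (e' j) qb.
by exists (\matrix_(j, i) c j 0 i) => j; under eq_bigr => i _ do rewrite mxE.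
Qed.

Lemma quotient_basis_of_free m (e e' : 'I_m -> {mpoly K[n]}) :
  quotient_basis e I ->
  (forall c : 'I_m -> K, I (\sum_i c i *: e' i) -> forall i, c i = 0) ->
  quotient_basis e' I.
Proof.
move=> qb free; have [A Ae] := quotient_basis_of_coords e' qb.
apply/(quotient_basis_change qb Ae).
rewrite -unitfE -unitmxE -row_free_unit -kermx_eq0; apply/rowV0P => v /sub_kermxP vA.
apply/rowP => j; rewrite mxE; apply: (free (v 0)).
have := ideal_matrix_subst (v 0) Ae.
have -> : (\row_j v 0 j) = v by apply/rowP => i; rewrite mxE.
rewrite vA [X in _ - X]big1 ?subr0 // => i _; by rewrite mxE scale0r.
Qed.

Lemma quotient_free_size m (e : 'I_m -> {mpoly K[n]}) p (g : 'I_p -> {mpoly K[n]}) :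
  quotient_basis e I ->
  (forall c : 'I_p -> K, I (\sum_i c i *: g i) -> forall i, c i = 0) -> (p <= m)%N.
Proof.
move=> qb free; have /choice[c Ic] := fun j => quotient_basis_coords (g j) qb.
pose A := \matrix_(j < p, i < m) c j 0 i.
have : row_free A; last by rewrite /row_free => /eqP <-; apply: rank_leq_col.
rewrite -kermx_eq0; apply/rowV0P => v /sub_kermxP vA.
apply/rowP => j; rewrite mxE; apply: (free (v 0)).
suff -> : \sum_i v 0 i *: g i = \sum_i v 0 i *: (g i - \sum_k c i 0 k *: e k).
  by apply: ideal_sum => // i _; apply: idealZ.
under [RHS]eq_bigr => i _ do rewrite scalerBr.
rewrite sumrB [X in _ - X](_ : _ = 0) ?subr0 //.
under eq_bigr => i _ do rewrite scaler_sumr.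
rewrite exchange_big /=; apply: big1 => k _.
under eq_bigr => i _ do rewrite scalerA.
rewrite -scaler_suml; have /rowP/(_ k) := vA; rewrite !mxE.
by under eq_bigr => i _ do rewrite mxE; move=> ->; rewrite scale0r.
Qed.

End QuotientBases.

(** * Charts of the Hilbert scheme *)

Section Charts.
Variables (K : fieldType) (n mu : nat).
Hypothesis mu_gt0 : (0 < mu)%N.
Implicit Types (x y : hilb K n mu) (B : mu.-tuple 'X_{1..n}).
Local Notation coordn := #|{: Defs.coord n mu}|.
Implicit Types (v : 'I_coordn -> K).

Definition monomials B (i : 'I_mu) : {mpoly K[n]} := 'X_[tnth B i].

Lemma cidxP (q : 'I_coordn) : exists k i j, q = cidx k i j.
Proof.
case E: (enum_val q) => [[k i] j]; exists k, i, j.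
by rewrite /cidx -E enum_valK.
Qed.

Lemma cidx_choice (T : Type) (f : 'I_n -> 'I_mu -> 'I_mu -> T) :
  exists g : 'I_coordn -> T, forall k i j, g (cidx k i j) = f k i j.
Proof.
exists (fun q => let: (k, i, j) := enum_val q in f k i j) => k i j.
by rewrite /cidx enum_rankK.
Qed.

Lemma hilb_is_ideal x : is_ideal x. Proof. by case: x. Qed.

Lemma hilb_has_basis x : exists e : 'I_mu -> {mpoly K[n]}, quotient_basis e x.
Proof. by case: x. Qed.

Lemma chart_coord_basis B x v : chart_coord B x v -> quotient_basis (monomials B) x.
Proof. by case. Qed.

Lemma chart_coord_exists B x :
  quotient_basis (monomials B) x -> exists v, chart_coord B x v.
Proof.
move=> qb.
have /choice[c cP] : forall kj : 'I_n * 'I_mu, exists c : 'rV[K]_mu,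
    x ('X_[(U_(kj.1) + tnth B kj.2)%MM] - \sum_i c 0 i *: monomials B i).
  by move=> kj; apply: quotient_basis_coords.
have [v vE] := cidx_choice (fun k i j => c (k, j) 0 i).
exists v; split=> // k j; under eq_bigr => i _ do rewrite vE.
exact: (cP (k, j)).
Qed.

Lemma chart_coord_uniq B x v w : chart_coord B x v -> chart_coord B x w -> v =1 w.
Proof.
move=> [qb vP] [_ wP] q; have [k [i [j ->]]] := cidxP q.
exact: (quotient_basis_inj (hilb_is_ideal x) qb (vP k j) (wP k j) i).
Qed.

Lemma order_ideal0 B : order_ideal B -> exists i, tnth B i = 0%MM.
Proof.
case=> _ down; have /tnthP[i ->] : 0%MM \in B; last by exists i.
apply: (down (tnth B (Ordinal mu_gt0))); first exact: mem_tnth.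
by apply/mnm_lepP => k; rewrite mnm0E.
Qed.

(** The coordinates of f are obtained by evaluating f at the multiplication matrices and applying
    the result to the vector of 1, which is a member of B. They are polynomials in the matrix
    entries, the same for all points of the chart. *)
Lemma chart_poly_coords B (f : {mpoly K[n]}) : order_ideal B ->
  exists N : 'I_mu -> {mpoly K[coordn]}, forall x v, chart_coord B x v ->
    x (f - \sum_i (N i).@[v] *: monomials B i).
Proof.
move=> oB; elim/mpoly_mulX_ind: f => [c|f g [Nf Pf] [Ng Pg]|k f [Nf Pf]].
- have [i0 Bi0] := order_ideal0 oB.
  exists (fun i => (c *+ (i == i0))%:MP) => x v _.
  rewrite (bigD1 i0) //= eqxx mulr1n mevalC /monomials Bi0 mpolyX0 alg_mpolyC.
  rewrite big1 ?addr0 ?subrr; first exact: ideal0 (hilb_is_ideal x).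
  by move=> i /negPf ->; rewrite mulr0n mevalC scale0r.
- exists (fun i => Nf i + Ng i) => x v xv.
  under eq_bigr => i _ do rewrite mevalD scalerDl.
  rewrite big_split /= opprD addrACA; apply: idealD (hilb_is_ideal x) _ _ _ _.
    exact: Pf.
  exact: Pg.
exists (fun i => \sum_j 'X_(cidx k i j) * Nf j) => x v xv.
have idx := hilb_is_ideal x; have [_ vP] := xv.
apply: (@ideal_trans _ _ _ idx ('X_k * \sum_i (Nf i).@[v] *: monomials B i)).
  by rewrite -mulrBr; apply: idealMl => //; apply: Pf.
have -> : \sum_i (\sum_j 'X_(cidx k i j) * Nf j).@[v] *: monomials B i
    = \sum_j (Nf j).@[v] *: \sum_i v (cidx k i j) *: monomials B i.
  under [RHS]eq_bigr => j _ do rewrite scaler_sumr.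
  rewrite exchange_big /=; apply: eq_bigr => i _.
  rewrite meval_sum scaler_suml; apply: eq_bigr => j _.
  by rewrite mevalM mevalXU scalerA mulrC.
rewrite mulr_sumr -sumrB; apply: ideal_sum => // j _.
rewrite -scalerAr -scalerBr; apply: idealZ => //.
by rewrite /monomials -mpolyXD; apply: vP.
Qed.

(** f lies in the ideal exactly when the polynomials of [chart_poly_coords] vanish at v, a condition
    on v alone. *)
Lemma chart_coord_ideal B x y v : order_ideal B ->
  chart_coord B x v -> chart_coord B y v -> forall f, x f <-> y f.
Proof.
move=> oB; wlog suff: x y / chart_coord B x v -> chart_coord B y v ->
    forall f, x f -> y f.
  by move=> hw xv yv f; split; apply: hw.
move=> xv yv f xf; have [N NP] := chart_poly_coords f oB.
have N0 i : (N i).@[v] = 0.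
  apply: (quotient_basis_free (hilb_is_ideal x) (chart_coord_basis xv)
    (c := fun i => (N i).@[v])).
  have := ideal_sym (hilb_is_ideal x) (NP _ _ xv).
  by move/(ideal_congr (hilb_is_ideal x)); apply.
have := NP _ _ yv; rewrite big1 ?subr0 // => i _; by rewrite N0 scale0r.
Qed.

(** R is a relation and not a map because some parameters have no point, for instance coinciding
    points in [ideal_of_points]. The relation F = D v avoids division. *)
Definition rational_family r (R : ('I_r -> K) -> hilb K n mu -> Prop) :=
  forall B, order_ideal B ->
  exists (D : {mpoly K[r]}) (F : 'I_coordn -> {mpoly K[r]}), forall u x, R u x ->
    (quotient_basis (monomials B) x <-> D.@[u] != 0) /\
    forall v, chart_coord B x v -> forall q, (F q).@[u] = D.@[u] * v q.

(* Cramer's rule for the matrix of the values of the functionals on a basis. *)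
Lemma rational_family_of_functionals r (R : ('I_r -> K) -> hilb K n mu -> Prop)
    (lam : ('I_r -> K) -> {mpoly K[n]} -> 'rV[K]_mu) :
  (forall u x, R u x -> linear (lam u)) ->
  (forall f, exists N : 'I_mu -> {mpoly K[r]}, forall u i, lam u f 0 i = (N i).@[u]) ->
  (forall u x, R u x -> forall f, x f <-> lam u f = 0) ->
  rational_family R.
Proof.
move=> lin_lam lam_poly lam_ker B oB.
have /choice[G GE] := fun j => lam_poly (monomials B j).
have /choice[H HE] := fun kj : 'I_n * 'I_mu => lam_poly 'X_[(U_(kj.1) + tnth B kj.2)%MM].
pose A := \matrix_(j, i) G j i.
have [F FE] := cidx_choice (fun k i j => ((\row_l H (k, j) l) *m \adj A) 0 i).
exists (\det A), F => u x Rux.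
have lamB f (c : 'I_mu -> K) g :
    lam u (f - \sum_i c i *: g i) = lam u f - \sum_i c i *: lam u (g i).
  have lam0 : lam u 0 = 0.
    by have := (lin_lam _ _ Rux) (-1) 0 0; rewrite scaler0 addr0 scaleN1r addNr.
  rewrite addrC -scaleN1r (lin_lam _ _ Rux) scaleN1r addrC; congr (_ - _).
  elim: (index_enum _) => [|i s IHs]; first by rewrite !big_nil.
  by rewrite !big_cons (lin_lam _ _ Rux) IHs.
pose Au : 'M[K]_mu := \matrix_(j, i) lam u (monomials B j) 0 i.
have AuE : map_mx (meval u) A = Au by apply/matrixP => j i; rewrite !mxE GE.
have detAu : (\det A).@[u] = \det Au by rewrite -AuE det_map_mx.
have lam_mul (c : 'I_mu -> K) : \sum_j c j *: lam u (monomials B j) = (\row_j c j) *m Au.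
  apply/rowP => i; rewrite summxE mxE; apply: eq_bigr => j _; by rewrite !mxE.
have idx := hilb_is_ideal x.
have lam_sum (c : 'I_mu -> K) : x (\sum_j c j *: monomials B j) <-> (\row_j c j) *m Au = 0.
  split=> [xc|cA].
    have := lamB 0 c (monomials B); rewrite lam_mul sub0r.
    have /(lam_ker _ _ Rux) -> := idealN idx xc.
    have /(lam_ker _ _ Rux) -> := ideal0 idx.
    by rewrite sub0r => /esym /eqP; rewrite oppr_eq0 => /eqP.
  rewrite -[X in hilb_ideal x X]opprK; apply: idealN => //; apply/(lam_ker _ _ Rux).
  have := lamB 0 c (monomials B); rewrite lam_mul sub0r cA subr0 => ->.
  by apply/(lam_ker _ _ Rux); apply: ideal0.
rewrite detAu; split.
  rewrite -unitfE -unitmxE; split=> [qb|uA].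
    rewrite -row_free_unit -kermx_eq0; apply/rowV0P => w /sub_kermxP wA.
    apply/rowP => j; rewrite mxE; apply: (quotient_basis_free idx (c := w 0) qb).
    apply/lam_sum; rewrite -[RHS]wA; congr (_ *m _).
    by apply/rowP => i; rewrite mxE.
  have [e qb] := hilb_has_basis x.
  apply: (quotient_basis_of_free idx qb) => c /lam_sum cA j.
  have := congr1 (mulmxr (invmx Au)) cA; rewrite /= mul0mx mulmxK //.
  by move=> /rowP/(_ j); rewrite !mxE.
move=> v [_ vP] q; have [k [i [j ->]]] := cidxP q; rewrite FE.
have /(lam_ker _ _ Rux) := vP k j; rewrite lamB lam_mul => /eqP.
rewrite subr_eq0 => /eqP lamE.
have -> : (((\row_l H (k, j) l) *m \adj A) 0 i).@[u]
    = (lam u 'X_[(U_(k) + tnth B j)%MM] *m \adj Au) 0 i.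
  rewrite !mxE meval_sum; apply: eq_bigr => l _; rewrite mevalM -AuE -map_mx_adj.
  by rewrite !mxE -(HE (k, j)).
rewrite lamE -mulmxA mul_mx_adj mul_mx_scalar !mxE //.
Qed.

(** The transition between charts: the coordinates in the basis B are functionals that are
    polynomial in v and have x as common kernel. *)
Lemma chart_rational_family B : order_ideal B ->
  rational_family (fun v x => chart_coord B x v).
Proof.
move=> oB; have /choice[N NP] := fun f => chart_poly_coords f oB.
pose lam (v : 'I_coordn -> K) f : 'rV[K]_mu := \row_i (N f i).@[v].
have lamP v x f : chart_coord B x v -> x (f - \sum_i lam v f 0 i *: monomials B i).
  by move=> xv; under eq_bigr => i _ do rewrite mxE; apply: NP.
apply: (@rational_family_of_functionals _ _ lam).
- move=> v x xv a f g; have idx := hilb_is_ideal x.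
  apply/rowP => i; apply: (quotient_basis_inj idx (chart_coord_basis xv)
    (c := fun i => lam v (a *: f + g) 0 i)
    (d := fun i => (a *: lam v f + lam v g) 0 i) (lamP _ _ _ xv)).
  under eq_bigr => j _ do rewrite !mxE scalerDl -scalerA.
  rewrite big_split -scaler_sumr /= opprD addrACA -scalerBr.
  apply: idealD => //; first (apply: idealZ => //).
    by apply: NP.
  by apply: NP.
- by move=> f; exists (N f) => v i; rewrite mxE.
move=> v x xv f; have idx := hilb_is_ideal x; have qb := chart_coord_basis xv.
split=> [xf|lam0].
  apply/rowP => i; rewrite [RHS]mxE; move: i.
  apply: (quotient_basis_free idx (c := fun i => lam v f 0 i) qb).
  by apply: ideal_congr (ideal_sym idx (lamP _ _ f xv)) xf.
have := lamP _ _ f xv; rewrite lam0 big1 ?subr0 // => i _.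
by rewrite mxE scale0r.
Qed.

Lemma rational_family_comp r (R : ('I_r -> K) -> hilb K n mu -> Prop) B
    (phi : 'I_coordn -> {mpoly K[r]}) : order_ideal B ->
  (forall u x, R u x -> chart_coord B x (fun q => (phi q).@[u])) ->
  rational_family R.
Proof.
move=> oB Rphi B' oB'; have [D [F DF]] := chart_rational_family oB oB'.
pose t := [tuple phi q | q < coordn].
have tE (p : {mpoly K[coordn]}) u : (p \mPo t).@[u] = p.@[fun q => (phi q).@[u]].
  by rewrite comp_mpoly_meval; apply: meval_eq => q; rewrite tnth_mktuple.
exists (D \mPo t), (fun q => F q \mPo t) => u x /Rphi xu.
have [D1 F1] := DF _ _ xu; rewrite tE; split=> // v xv q; rewrite !tE; exact: F1.
Qed.

(** Pulls a basic open set of a chart back to a principal open set of parameters: D for membership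
    in the chart, times the numerator of p. *)
Lemma rational_family_test r (R : ('I_r -> K) -> hilb K n mu -> Prop) B
    (p : {mpoly K[coordn]}) : rational_family R -> order_ideal B ->
  exists P : {mpoly K[r]}, forall u x, R u x ->
    (P.@[u] != 0 <-> exists2 v, chart_coord B x v & p.@[v] != 0).
Proof.
move=> famR oB; have [D [F DF]] := famR B oB.
have [k [P PE]] := homogenized_eval D F p.
exists (D * P) => u x Rux; have [D1 F1] := DF u x Rux.
rewrite mevalM mulf_eq0 negb_or; split.
  move=> /andP[Du Pu]; have [v xv] := chart_coord_exists (D1.2 Du).
  exists v => //; apply: contraNneq Pu => pv.
  by rewrite (PE _ v) ?pv ?mulr0 //; apply: F1.
move=> [v xv pv]; have Du : D.@[u] != 0 by apply/D1; apply: chart_coord_basis xv.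
by rewrite Du (PE _ v) ?mulf_neq0 ?expf_neq0 //; apply: F1.
Qed.

(** * Closed sets *)

(** The complement of the basic open set p != 0 of the chart; it contains all points outside the
    chart. In particular [chart_locus B 1] is the complement of the chart. *)
Definition chart_locus B (p : {mpoly K[coordn]}) x :=
  forall v, chart_coord B x v -> p.@[v] = 0.

(** In any other chart the locus is the zero set of the single polynomial that
    [rational_family_test] gives for the transition. *)
Lemma zclosed_chart_locus B p : order_ideal B -> zclosed (chart_locus B p).
Proof.
move=> oB B' oB'.
have [P PE] := rational_family_test p (chart_rational_family oB') oB.
exists (fun P' => P' = P) => x v' xv'; have PEx := PE _ _ xv'.
split=> [xp _ ->|xP v xv].
  apply/eqP; apply: contraT => /PEx[v xv]; by rewrite xp ?eqxx.
apply/eqP; apply: contraT => pv; have /PEx : exists2 v, chart_coord B x v & p.@[v] != 0.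
  by exists v.
by rewrite xP ?eqxx.
Qed.

Lemma chart_coord_evalE B x v w (p : {mpoly K[coordn]}) :
  chart_coord B x v -> chart_coord B x w -> p.@[v] = p.@[w].
Proof. by move=> xv xw; apply: meval_eq; apply: chart_coord_uniq xv xw. Qed.

Lemma chart_locusE B p x v : chart_coord B x v -> chart_locus B p x <-> p.@[v] = 0.
Proof.
by move=> xv; split=> [/(_ v xv)|pv w xw] //; rewrite (chart_coord_evalE p xw xv).
Qed.

Implicit Types (Z F G : hilb K n mu -> Prop).

Lemma zclosure_sub Z x : Z x -> zclosure Z x.
Proof. by move=> Zx F _; apply. Qed.

Lemma zclosure_min Z F : zclosed F -> (forall x, Z x -> F x) ->
  forall x, zclosure Z x -> F x.
Proof. by move=> clF ZF x; apply. Qed.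

Lemma zclosed_bigcap (S : (hilb K n mu -> Prop) -> Prop) :
  (forall F, S F -> zclosed F) -> zclosed (fun x => forall F, S F -> F x).
Proof.
move=> clS B oB.
(* Taking all polynomials that vanish on the trace of some member of S avoids a choice of equations
   for each member. *)
exists (fun p => exists2 F, S F & forall x v, chart_coord B x v -> F x -> p.@[v] = 0).
move=> x v xv; split=> [xS p [F SF Fp]|xp F SF]; first exact: Fp xv (xS F SF).
have [P PF] := clS F SF B oB; apply/(PF _ _ xv) => p Pp; apply: xp; exists F => // y w yw.
by move=> /(PF _ _ yw); apply.
Qed.

Lemma zclosed_zclosure Z : zclosed (zclosure Z).
Proof.
have := @zclosed_bigcap (fun F => zclosed F /\ forall y, Z y -> F y).
have -> : (fun x => forall F, zclosed F /\ (forall y, Z y -> F y) -> F x) = zclosure Z.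
  apply/funext => x; apply/propext; split=> [H F clF ZF|H F [clF ZF]]; exact: H.
by apply=> F [].
Qed.

Lemma zclosureS Z F : (forall x, Z x -> F x) -> forall x, zclosure Z x -> zclosure F x.
Proof.
move=> ZF; apply: zclosure_min; first exact: zclosed_zclosure.
by move=> x /ZF; apply: zclosure_sub.
Qed.

Lemma irreducible_zclosure Z : irreducible Z -> irreducible (zclosure Z).
Proof.
case=> [[x Zx] irrZ]; split; first by exists x; apply: zclosure_sub.
move=> F G clF clG ZFG.
by case: (irrZ F G clF clG) => [y /zclosure_sub/ZFG //|ZF|ZG];
  [left | right]; apply: zclosure_min.
Qed.

End Charts.

(** * Standard monomials: every point lies in the chart of an order ideal *)

Lemma cast_ord_bij a b (e : a = b) : bijective (cast_ord e).
Proof. by exists (cast_ord (esym e)) => i; rewrite ?cast_ordK ?cast_ordKV. Qed.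

Lemma mpoly_sum_seq (R : nzRingType) n (g : {mpoly R[n]}) (s : seq 'X_{1..n}) :
  uniq s -> {subset msupp g <= s} -> g = \sum_(m <- s) g@_m *: 'X_[m].
Proof.
move=> us gs; apply/mpolyP => k; rewrite mcoeff_sum.
rewrite (eq_bigr (fun m => g@_m * (m == k)%:R)); last first.
  by move=> m _; rewrite mcoeffZ mcoeffX.
have [ks|ks] := boolP (k \in s).
  rewrite (bigD1_seq k ks us) /= eqxx mulr1 big1 ?addr0 // => m /negPf ->.
  by rewrite mulr0.
rewrite big_seq big1 => [|m ms].
  by apply: memN_msupp_eq0; apply: contra ks => /gs.
by case: eqP => [mk|]; [rewrite -mk ms in ks | rewrite mulr0].
Qed.

Section StandardMonomials.
Variables (K : fieldType) (n mu : nat) (x : hilb K n mu).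

(** The monomials outside the initial ideal of x for the graded order [<]. *)
Definition standard_monomial (m : 'X_{1..n}) :=
  ~ exists2 f, x ('X_[m] - f) & forall m', m' \in msupp f -> (m' < m)%O.

Lemma standard_monomial_dvd m m' :
  standard_monomial m -> (m' <= m)%MM -> standard_monomial m'.
Proof.
move=> std_m le_m'm [f xf flt]; apply: std_m; exists ('X_[(m - m')%MM] * f).
  rewrite -{1}(submK le_m'm) mpolyXD -mulrBr; exact: idealMl (hilb_is_ideal x) _ _ _.
move=> k; rewrite mulrC (perm_mem (msuppMX _ _)) => /mapP[k' /flt lt_k' ->].
by rewrite -{2}(submK le_m'm) addmC (addmC _ m') ltmc_add2l.
Qed.

(** Reduction to a remainder terminates because the monomial order is well founded. *)
Lemma standard_monomial_span f :
  exists2 g, x (f - g) & forall m, m \in msupp g -> standard_monomial m.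
Proof.
have idx := hilb_is_ideal x.
have comb (s : seq 'X_{1..n}) (c : 'X_{1..n} -> K) :
    (forall m, m \in s -> exists2 g, x ('X_[m] - g) &
        forall k, k \in msupp g -> standard_monomial k) ->
    exists2 g, x (\sum_(m <- s) c m *: 'X_[m] - g) &
        forall m, m \in msupp g -> standard_monomial m.
  elim: s => [|m s IHs] sP.
    by exists 0; rewrite ?big_nil ?subrr ?msupp0 //; apply: ideal0 idx.
  have [|g xg gs] := IHs; first by move=> k ks; apply: sP; rewrite inE ks orbT.
  have [h xh hs] := sP m (mem_head _ _).
  exists (c m *: h + g).
    rewrite big_cons opprD addrACA -scalerBr; apply: idealD => //; exact: idealZ.
  move=> k /msuppD_le; rewrite mem_cat => /orP[/msuppZ_le /hs //|/gs //].
have mono m : exists2 g, x ('X_[m] - g) & forall k, k \in msupp g -> standard_monomial k.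
  elim/(well_founded_induction (@ltom_wf n)): m => m IHm.
  have [std_m|/contrapT[g0 xf flt]] := pselect (standard_monomial m).
    exists 'X_[m]; first by rewrite subrr; apply: ideal0.
    by move=> k; rewrite msuppX inE => /eqP ->.
  have [|g xg gs] := comb (msupp g0) (fun k => g0@_k); first by move=> k /flt /IHm.
  exists g => //; apply: ideal_trans xf _ => //; by rewrite {1}[g0]mpolyE.
have [//|g xg gs] := comb (msupp f) (fun k => f@_k).
by exists g; rewrite // {1}[f]mpolyE.
Qed.

(** The leading monomial of a nonzero element of the ideal is not standard. *)
Lemma standard_monomial_free f :
  x f -> (forall m, m \in msupp f -> standard_monomial m) -> f = 0.
Proof.
move=> xf fs; apply/eqP/contraT => f0; exfalso.
have idx := hilb_is_ideal x; have c0 : mleadc f != 0 by rewrite mleadc_eq0.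
apply: (fs _ (mlead_supp f0)).
exists ('X_[mlead f] - (mleadc f)^-1 *: f).
  by rewrite opprB addrC subrK; apply: idealZ.
move=> m; rewrite mcoeff_msupp mcoeffB mcoeffX mcoeffZ; apply: contraNT; rewrite -leNgt.
rewrite le_eqVlt => /orP[/eqP <-|lt_m]; first by rewrite eqxx mulVf ?subrr.
by rewrite (mcoeff_gt_mlead lt_m) mulr0 subr0 (lt_eqF lt_m).
Qed.

Lemma order_ideal_chart : exists B : mu.-tuple 'X_{1..n},
  order_ideal B /\ quotient_basis (monomials K B) x.
Proof.
have idx := hilb_is_ideal x; have [e qbe] := hilb_has_basis x.
have sum_free (s : seq 'X_{1..n}) : uniq s -> (forall m, m \in s -> standard_monomial m) ->
    forall c : 'I_(size s) -> K, x (\sum_i c i *: 'X_[nth 0%MM s i]) -> forall i, c i = 0.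
  move=> us ss c xc i.
  have cE k : (\sum_i c i *: 'X_[nth 0%MM s i])@_k
      = \sum_(i < size s) c i * (nth 0%MM s i == k)%:R.
    by rewrite mcoeff_sum; apply: eq_bigr => j _; rewrite mcoeffZ mcoeffX.
  have := cE (nth 0%MM s i).
  rewrite (standard_monomial_free xc) => [|m].
    rewrite mcoeff0 (bigD1 i) //= eqxx mulr1 big1 ?addr0 // => j ne.
    by rewrite nth_uniq // (inj_eq val_inj) (negPf ne) mulr0.
  rewrite mcoeff_msupp cE => sum0; apply: ss; apply: contraNT sum0 => ms.
  rewrite big1 // => j _; case: eqP => [jm|]; last by rewrite mulr0.
  by case/negP: ms; rewrite -jm mem_nth.
(* Finiteness of the set of standard monomials is not known beforehand. Independence bounds the
   length of a duplicate-free list of them by mu, and a longest such list contains them all. *)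
pose Q k := `[< exists s : seq 'X_{1..n}, [/\ uniq s, size s = k &
    forall m, m \in s -> standard_monomial m] >].
have exQ : exists k, Q k by exists 0%N; apply/asboolP; exists [::].
have leQ k : Q k -> (k <= mu)%N.
  move=> /asboolP[s [us <- ss]].
  exact: (quotient_free_size idx qbe (sum_free s us ss)).
case: (ex_maxnP exQ leQ) => k /asboolP[s [us sk ss]] maxk.
have all_s m : standard_monomial m -> m \in s.
  move=> std_m; apply: contraT => ms; have := maxk k.+1; rewrite ltnn; apply.
  apply/asboolP; exists (m :: s); rewrite /= ms us sk; split=> // m'.
  by rewrite inE => /orP[/eqP->|/ss].
have gen f : exists c : 'I_(size s) -> K, x (f - \sum_i c i *: 'X_[nth 0%MM s i]).
  have [g xg gs] := standard_monomial_span f.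
  exists (fun i => g@_(nth 0%MM s i)).
  rewrite -(big_mkord predT (fun i => g@_(nth 0%MM s i) *: 'X_[nth 0%MM s i])).
  rewrite -(big_nth 0%MM predT (fun m => g@_m *: 'X_[m])) -mpoly_sum_seq //.
  by move=> m /gs /all_s.
have qbs : quotient_basis (fun i : 'I_(size s) => 'X_[nth 0%MM s i]) x.
  by apply: quotient_basisI => //; apply: sum_free.
have size_s : size s = mu.
  apply/eqP; rewrite eqn_leq sk leQ -?sk; last by apply/asboolP; exists s.
  apply: (quotient_free_size idx qbs (g := e)) => c; exact: (quotient_basis_free idx (c := c) qbe).
have sB : size s == mu by apply/eqP.
exists (Tuple sB); split.
  by split=> // m m' ms le_m'm; apply/all_s/(standard_monomial_dvd _ le_m'm)/ss.
apply: quotient_basisI => // [f|c].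
  have [c xc] := gen f; exists (fun i => c (cast_ord (esym size_s) i)).
  congr (hilb_ideal x (f - _)): xc; rewrite (reindex (cast_ord (esym size_s))) /=.
    by apply: eq_bigr => i _; rewrite /monomials (tnth_nth 0%MM).
  by apply: onW_bij; apply: cast_ord_bij.
move=> xc i; rewrite -[i](cast_ordKV size_s).
pose c' i := c (cast_ord size_s i); apply: (sum_free s us ss c').
congr (hilb_ideal x _): xc; rewrite (reindex (cast_ord size_s)) /=.
  by apply: eq_bigr => j _; rewrite /monomials (tnth_nth 0%MM).
by apply: onW_bij; apply: cast_ord_bij.
Qed.
End StandardMonomials.

(** * Irreducibility and dimension of the image of a rational family *)

Section RationalImages.
Variables (K : fieldType) (n mu : nat).
Hypotheses (charK0 : [pchar K] =i pred0) (mu_gt0 : (0 < mu)%N).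
Implicit Types (x y : hilb K n mu) (Z F G : hilb K n mu -> Prop).
Local Notation coordn := #|{: Defs.coord n mu}|.

Lemma chart_exists x : exists B v, order_ideal B /\ chart_coord B x v.
Proof.
have [B [oB qB]] := order_ideal_chart x.
by have [v xv] := chart_coord_exists qB; exists B, v.
Qed.

Lemma chart_locusN B (p : {mpoly K[coordn]}) x :
  ~ chart_locus B p x -> exists2 v, chart_coord B x v & p.@[v] != 0.
Proof.
move=> npx; apply: contrapT => nov; apply: npx => v xv.
by apply/eqP/contraT => pv; case: nov; exists v.
Qed.

Lemma rational_family_open r (R : ('I_r -> K) -> hilb K n mu -> Prop) F u x :
  rational_family R -> zclosed F -> R u x -> ~ F x ->
  exists2 P : {mpoly K[r]}, P.@[u] != 0 &
    forall u' x', R u' x' -> P.@[u'] != 0 -> ~ F x'.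
Proof.
move=> famR clF Rux nFx; have [B [v [oB xv]]] := chart_exists x.
have [Q QF] := clF B oB.
have [p Qp pv] : exists2 p, Q p & p.@[v] != 0.
  apply: contrapT => noP; apply: nFx; apply/(QF _ _ xv) => p Qp.
  by apply/eqP; apply: contrapT => /negP pv; apply: noP; exists p.
have [P PE] := rational_family_test p famR oB.
exists P; first by apply/(PE _ _ Rux); exists v.
move=> u' x' Rux' /(PE _ _ Rux')[v' xv' pv'] /(QF _ _ xv')/(_ p Qp) pv0.
by rewrite pv0 eqxx in pv'.
Qed.

(** If neither of two closed sets contains the image, each is avoided on a nonempty principal open
    set of parameters. The product of the two polynomials with [delta] has a nonzero value, at a
    parameter whose point avoids both. *)
Lemma irreducible_rational_image r (R : ('I_r -> K) -> hilb K n mu -> Prop)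
    (delta : {mpoly K[r]}) :
  rational_family R -> delta != 0 ->
  (forall u, delta.@[u] != 0 -> exists x, R u x) ->
  irreducible (fun x => exists u, R u x).
Proof.
move=> famR delta0 exR; split.
  by have [u /exR[x Rux]] := mpoly_nonroot charK0 delta0; exists x, u.
move=> F G clF clG ZFG; have [|/existsNP[x1]] := pselect (forall x, (exists u, R u x) -> F x).
  by left.
move=> /not_implyP[[u1 Rux1] nF]; have [|/existsNP[x2]] := pselect (forall x, (exists u, R u x) -> G x).
  by right.
move=> /not_implyP[[u2 Rux2] nG]; exfalso.
have [P Pu1 PF] := rational_family_open famR clF Rux1 nF.
have [Q Qu2 QG] := rational_family_open famR clG Rux2 nG.
have : delta * P * Q != 0.
  rewrite !mulf_neq0 //; first by apply: contraNneq Pu1 => ->; rewrite meval0.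
  by apply: contraNneq Qu2 => ->; rewrite meval0.
case/(mpoly_nonroot charK0) => u; rewrite !mevalM !mulf_eq0 !negb_or.
move=> /andP[/andP[/exR[x Rux] Pu] Qu].
by case: (ZFG x); [exists u | apply: PF Rux Pu | apply: QG Rux Qu].
Qed.

Lemma irr_chain_mem Z (F : nat -> hilb K n mu -> Prop) e x : irr_chain Z F e -> Z x ->
  forall i j, (i <= j <= e)%N -> F i x -> F j x.
Proof.
move=> [_ incF] Zx i j /andP[le_ij]; rewrite -(subnK le_ij).
elim: (j - i)%N => [|k IHk] le_e Fi //; rewrite addSn in le_e *.
by have [inc _] := incF _ le_e; apply: inc => //; apply: IHk => //; apply: ltnW.
Qed.

(** In one chart the chain becomes a chain of primes P_0, P_1, ..., P_e, each containing the next.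
    Functions f_i in P_i outside P_{i+1} are algebraically independent modulo P_e, whereas on the
    family all functions are rational in r parameters. *)
Lemma irr_chain_length r (R : ('I_r -> K) -> hilb K n mu -> Prop) Z
    (F : nat -> hilb K n mu -> Prop) e :
  rational_family R -> (forall x, Z x -> zclosure (fun x => exists u, R u x) x) ->
  irr_chain Z F e -> (e <= r)%N.
Proof.
move=> famR ZR chainF; have [irrF incF] := chainF.
rewrite leqNgt; apply/negP => lt_re.
(* A chart around a point of the smallest member meets every member of the chain. *)
have [[y [F0y Zy]] _] := (irrF 0%N (leq0n e)).2.
have [B [w [oB yw]]] := chart_exists y.
pose P i (p : {mpoly K[coordn]}) := forall x v, F i x -> Z x -> chart_coord B x v -> p.@[v] = 0.
have Fy i : (i <= e)%N -> F i y by move=> le_ie; apply: (irr_chain_mem chainF Zy) F0y.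
have primeP i : (i <= e)%N -> prime_ideal (P i).
  move=> le_ie; have [clFi [_ irrFi]] := irrF i le_ie; split.
  - split=> [x v _ _ _|p q Pp Pq x v Fx Zx xv|p q Pq x v Fx Zx xv].
    + by rewrite meval0.
    + by rewrite mevalD (Pp x) // (Pq x) // addr0.
    + by rewrite mevalM (Pq x) // mulr0.
  - by move=> /(_ y w (Fy i le_ie) Zy yw)/eqP; rewrite meval1 oner_eq0.
  move=> p q Ppq.
  have [x [Fx Zx]|sub|sub] := irrFi _ _ (zclosed_chart_locus mu_gt0 p oB)
    (zclosed_chart_locus mu_gt0 q oB).
  + have [|/chart_locusN[v xv pv]] := pselect (chart_locus B p x); first by left.
    right=> v' xv'; have /eqP := Ppq x v Fx Zx xv.
    rewrite mevalM mulf_eq0 (negPf pv) /= => /eqP <-; exact: chart_coord_evalE xv' xv.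
  + by left=> x v Fx Zx; apply: sub.
  + by right=> x v Fx Zx; apply: sub.
have decP i : (i < e)%N -> forall g, P i.+1 g -> P i g.
  move=> lt_ie g Pg x v Fx Zx; apply: Pg => //.
  by have [inc _] := incF i lt_ie; apply: inc.
have /choice[f fP] : forall i : 'I_e, exists f, P i f /\ ~ P i.+1 f.
  move=> i; have [_ [x [Zx Fx nFx]]] := incF i (ltn_ord i).
  have [clFi _] := irrF i (ltnW (ltn_ord i)).
  have [_ [_ irrFi1]] := irrF i.+1 (ltn_ord i).
  have [Q QF] := clFi B oB; apply: contrapT => /forallNP noP.
  (* If no polynomial separated F_i from F_{i+1} in the chart, F_{i+1} would be covered by F_i and
     the complement of the chart. Irreducibility then contradicts the strict inclusion or the
     position of y. *)
  have FZ z : F i.+1 z /\ Z z -> F i z \/ chart_locus B 1 z.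
    move=> [Fz Zz]; have [[v zv]|noch] := pselect (exists v, chart_coord B z v); last first.
      by right=> v zv; case: noch; exists v.
    left; apply/(QF _ _ zv) => p Qp; apply: contrapT => pv; apply: (noP p); split.
      by move=> z' v' Fz' _ zv'; apply: (QF _ _ zv').1 Qp.
    by move/(_ z v Fz Zz zv).
  have [sub|sub] := irrFi1 _ _ clFi (zclosed_chart_locus mu_gt0 1 oB) FZ.
    by apply: nFx; apply: sub.
  have /eqP := sub y (conj (Fy i.+1 (ltn_ord i)) Zy) w yw.
  by rewrite meval1 oner_eq0.
have [D [Fn DF]] := famR B oB.
have [g g0 gE] := rational_functions_dependent D Fn [tuple f i | i < e] lt_re.
case/eqP: g0; apply: (prime_chain_alg_indep primeP decP (f := [tuple f i | i < e])) => [i|].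
  by rewrite tnth_mktuple.
move=> x v _ /ZR xR xv.
apply: (zclosure_min (zclosed_chart_locus mu_gt0 _ oB) _ xR) xv => z [u Ruz] v' zv'.
have [Du Fu] := DF u z Ruz; apply: (gE u) => [|q]; last exact: Fu.
by apply/Du; apply: chart_coord_basis zv'.
Qed.

End RationalImages.

(** * Components and smooth points from a parametrization with a left inverse *)

Lemma unitmx_of_rows (K : fieldType) N (Q : 'rV[K]_N -> Prop) :
  (forall w : 'rV_N, (forall r, Q r -> r *m w^T = 0) -> w = 0) ->
  exists2 A : 'M[K]_N, A \in unitmx & forall i, Q (row i A).
Proof.
move=> Qsep; suff: forall m, (m <= N)%N ->
    exists2 A : 'M[K]_(m, N), row_free A & forall i, Q (row i A).
  by move=> /(_ N (leqnn N))[A Afree QA]; exists A; rewrite // -row_free_unit.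
elim=> [|m IHm] le_mN.
  by exists 0; [rewrite /row_free mxrank0 | case].
have [A Afree QA] := IHm (ltnW le_mN).
(* With fewer than N rows some nonzero w is orthogonal to all of them; a member of Q that is not
   orthogonal to w is independent of these rows. *)
have /rowV0Pn[w /sub_kermxP wA w0] : kermx A^T != 0.
  rewrite kermx_eq0 -row_leq_rank mxrank_tr -ltnNge.
  by move/eqP: Afree => ->.
have [r Qr rw] : exists2 r, Q r & r *m w^T != 0.
  apply: contrapT => nor; case/eqP: w0; apply: Qsep => r Qr.
  by apply/eqP/contraT => rw; case: nor; exists r.
have Aw : A *m w^T = 0 by apply: trmx_inj; rewrite trmx_mul trmxK wA trmx0.
exists (col_mx r A).
  suff free (c : 'rV[K]_(1 + m)) : c *m col_mx r A = 0 -> c = 0.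
    by rewrite -kermx_eq0; apply/rowV0P => c /sub_kermxP /free.
  rewrite -[c]hsubmxK mul_row_col => cA.
  have cr : lsubmx c = 0.
    have /(congr1 (mulmxr w^T)) := cA.
    rewrite /= mulmxDl -!mulmxA Aw mulmx0 addr0 mul0mx => /matrixP/(_ 0 0).
    rewrite !mxE big_ord1 => /eqP; rewrite mulf_eq0 => /orP[/eqP c0|/eqP rw0].
      by apply/matrixP => i j; rewrite !ord1 c0 mxE.
    by case/eqP: rw; apply/matrixP => i j; rewrite !ord1 rw0 mxE.
  rewrite cr mul0mx add0r in cA.
  rewrite cr; suff -> : rsubmx c = 0 by rewrite row_mx0.
  by apply: (row_free_inj Afree); rewrite cA mul0mx.
suff rows (i : 'I_(1 + m)) : Q (row i (col_mx r A)) by exact: rows.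
rewrite -[i]splitK; case: (split i) => j /=; last by rewrite rowKd.
by rewrite rowKu row_id.
Qed.

Section SmoothParametrization.
Variables (K : fieldType) (n mu d : nat).
Hypotheses (charK0 : [pchar K] =i pred0) (mu_gt0 : (0 < mu)%N).
Implicit Types (x y : hilb K n mu) (Z F G : hilb K n mu -> Prop).
Local Notation coordn := #|{: Defs.coord n mu}|.

Lemma chart_eq_vanish (B : mu.-tuple 'X_{1..n}) x v p :
  chart_coord B x v -> chart_eq B p -> p.@[v] = 0.
Proof.
move=> [qb vP]; have idx := hilb_is_ideal x.
case=> [k l i j|k i0 j i Bi0].
  have mul2 a b : x ('X_a * ('X_b * monomials K B j)
      - \sum_h (\sum_i v (cidx a h i) * v (cidx b i j)) *: monomials K B h).
    have := vP b j; rewrite mpolyXD => vbj.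
    apply: (@ideal_trans _ _ _ idx ('X_a * \sum_i v (cidx b i j) *: monomials K B i)).
      by rewrite -mulrBr; apply: idealMl.
    rewrite mulr_sumr.
    under [X in _ - X]eq_bigr => h _ do rewrite scaler_suml.
    rewrite exchange_big /= -sumrB; apply: ideal_sum => // h _.
    under [X in _ - X]eq_bigr => h' _ do rewrite mulrC -scalerA.
    rewrite -scaler_sumr -scalerAr -scalerBr; apply: idealZ => //.
    by rewrite -mpolyXD.
  have mulC2 : x ('X_k * ('X_l * monomials K B j)
      - \sum_h (\sum_i v (cidx l h i) * v (cidx k i j)) *: monomials K B h).
    by rewrite mulrCA; apply: mul2.
  have E : \sum_h v (cidx k i h) * v (cidx l h j) = \sum_h v (cidx l i h) * v (cidx k h j).
    exact: (quotient_basis_inj idx qb (mul2 k l) mulC2 i).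
  have genE a b : ((@gen_mx K n mu a *m @gen_mx K n mu b) i j).@[v]
      = \sum_h v (cidx a i h) * v (cidx b h j).
    by rewrite mxE meval_sum; apply: eq_bigr => h _; rewrite mevalM !mxE !mevalXU.
  by rewrite mxE [X in _ + X]mxE mevalB !genE E subrr.
have vE i' : v (cidx k i' j) = (i' == i0)%:R.
  apply: (quotient_basis_inj idx qb (vP k j) (d := fun i' => (i' == i0)%:R)).
  rewrite -Bi0 (bigD1 i0) //= eqxx scale1r big1 ?addr0 ?subrr; first exact: ideal0.
  by move=> h /negPf->; rewrite scale0r.
by rewrite mevalB mxE mevalXU vE meval_natr subrr.
Qed.

Lemma irreducible_between Y Z : irreducible Z -> (forall x, Z x -> Y x) ->
  (forall x, Y x -> zclosure Z x) -> irreducible Y.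
Proof.
move=> [[x Zx] irrZ] ZY YZ; split; first by exists x; apply: ZY.
move=> F G clF clG YFG.
have [y /ZY/YFG //|ZF|ZG] := irrZ F G clF clG.
  by left=> y /YZ; apply: zclosure_min ZF _.
by right=> y /YZ; apply: zclosure_min ZG _.
Qed.

Variables (B : mu.-tuple 'X_{1..n}) (phi : 'I_coordn -> {mpoly K[d]})
  (psi : 'I_d -> {mpoly K[coordn]}).
Hypotheses (oB : order_ideal B)
  (phi_chart : forall u, exists x, chart_coord B x (fun q => (phi q).@[u]))
  (phiK : forall u i, (psi i).@[fun q => (phi q).@[u]] = u i).

Definition chart_image x := exists u, chart_coord B x (fun q => (phi q).@[u]).

(** The image of the coordinate subspace of dimension i through [u0]. *)
Definition chart_flag (u0 : 'I_d -> K) i x := exists2 u, forall j : 'I_d, (i <= j)%N -> u j = u0 j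
  & chart_coord B x (fun q => (phi q).@[u]).

Lemma chart_image_family :
  rational_family (fun u x => chart_coord B x (fun q => (phi q).@[u])).
Proof. exact: (rational_family_comp mu_gt0 oB (phi := phi)). Qed.

Lemma irreducible_chart_image : irreducible chart_image.
Proof.
apply: (irreducible_rational_image charK0 chart_image_family (oner_neq0 _)) => u _.
exact: phi_chart.
Qed.

Lemma irreducible_chart_flag u0 i : irreducible (chart_flag u0 i).
Proof.
pose s (j : 'I_d) : {mpoly K[d]} := if (i <= j)%N then (u0 j)%:MP else 'X_j.
pose phis q := phi q \mPo [tuple s j | j < d].
have phisE u q : (phis q).@[u] = (phi q).@[fun j => (s j).@[u]].
  by rewrite comp_mpoly_meval; apply: meval_eq => j; rewrite tnth_mktuple.
have phisE' u : (fun q => (phis q).@[u]) = (fun q => (phi q).@[fun j => (s j).@[u]]).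
  by apply/funext => q.
have fam : rational_family (fun u x => chart_coord B x (fun q => (phis q).@[u])).
  exact: (rational_family_comp mu_gt0 oB (phi := phis)).
have := irreducible_rational_image charK0 fam (oner_neq0 _).
have -> : (fun x => exists u, chart_coord B x (fun q => (phis q).@[u])) = chart_flag u0 i.
  apply/funext => x; apply/propext; split=> [[u]|[u uu0 xu]].
    rewrite phisE' => xu; exists (fun j => (s j).@[u]) => // j le_ij.
    by rewrite /s le_ij mevalC.
  exists u; rewrite phisE' (_ : (fun j => (s j).@[u]) = u) //; apply/funext => j.
  by rewrite /s; case: ifP => [/uu0 ->|_]; rewrite ?mevalC ?mevalXU.
by apply=> u _; rewrite phisE'; apply: phi_chart.
Qed.

(** The inclusions are strict because component i of [psi] is constant on flag i but not on flag i +
    1; since [psi] is polynomial, it remains constant on the closure, inside the chart. *)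
Lemma chart_flag_chain u0 Z : (forall x, chart_image x -> Z x) ->
  irr_chain Z (fun i => zclosure (chart_flag u0 i)) d.
Proof.
move=> UZ; have flagZ i x : chart_flag u0 i x -> Z x.
  by case=> u _ xu; apply: UZ; exists u.
split=> i le_id; split; first exact: zclosed_zclosure.
- apply: irreducible_between (irreducible_chart_flag u0 i) _ _ => [x xi|x [] //].
  by split; [apply: zclosure_sub | apply: flagZ xi].
- move=> x _; apply: zclosureS => {}x [u uu0 xu]; exists u => // j /ltnW; exact: uu0.
pose u j := if j == Ordinal le_id then u0 j + 1 else u0 j.
have [x xu] := phi_chart u.
have xi : chart_flag u0 i.+1 x.
  by exists u => // j lt_ij; rewrite /u; case: eqP lt_ij => // ->; rewrite ltnn.
exists x; split; [exact: flagZ xi | exact: zclosure_sub | ].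
set k := Ordinal le_id.
have sub y : chart_flag u0 i y -> chart_locus B (psi k - (u0 k)%:MP) y.
  by case=> w ww0 yw; apply/(chart_locusE _ yw); rewrite mevalB mevalC phiK ww0 ?subrr.
move=> /(zclosure_min (zclosed_chart_locus mu_gt0 _ oB) sub)/(chart_locusE _ xu).
by rewrite mevalB mevalC phiK /u eqxx addrAC subrr add0r => /eqP; rewrite oner_eq0.
Qed.

Lemma chart_image_has_dim Z : (forall x, chart_image x -> Z x) ->
  (forall x, Z x -> zclosure chart_image x) -> has_dim Z d.
Proof.
move=> UZ ZU; split; first by exists (fun i => zclosure (chart_flag (fun=> 0) i)); apply: chart_flag_chain.
move=> e [F chF]; exact: (irr_chain_length mu_gt0 chart_image_family ZU chF).
Qed.

Variables (u0 : 'I_d -> K) (x0 : hilb K n mu) (D : 'I_d -> 'I_coordn).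
Local Notation v0 := (fun q => (phi q).@[u0]).
Hypotheses (x0u0 : chart_coord B x0 v0)
  (tangentD : forall w, chart_tangent B v0 w -> (forall j, w 0 (D j) = 0) -> w = 0).

(** [T] and [J] are the differentials of [phi] at [u0] and of [psi] at [v0], acting on row vectors.
    By the chain rule T J = 1, so the rows of [T] are independent. *)
Let T : 'M[K]_(d, coordn) := \matrix_(i, q) ((phi q)^`M(i)).@[u0].
Let J : 'M[K]_(coordn, d) := \matrix_(q, i) ((psi i)^`M(q)).@[v0].

Let TJ : T *m J = 1%:M.
Proof.
apply/matrixP => i j; rewrite !mxE.
have := mderiv_comp (psi j) [tuple phi q | q < coordn] i.
have -> : psi j \mPo [tuple phi q | q < coordn] = 'X_j.
  apply: (mpoly_eq_fun charK0) => u; rewrite comp_mpoly_meval mevalXU -[RHS](phiK u).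
  by apply: meval_eq => q; rewrite tnth_mktuple.
rewrite mderivXU => /(congr1 (meval u0)); rewrite meval_sum.
rewrite meval_natr => ->; apply: eq_bigr => q _.
rewrite mevalM comp_mpoly_meval !mxE tnth_mktuple mulrC; congr (_ * _).
by apply: meval_eq => q'; rewrite tnth_mktuple.
Qed.

Let T_tangent i : chart_tangent B v0 (row i T).
Proof.
move=> p Bp; have := mderiv_comp p [tuple phi q | q < coordn] i.
have -> : p \mPo [tuple phi q | q < coordn] = 0.
  apply: (mpoly_eq_fun charK0) => u; rewrite comp_mpoly_meval meval0.
  have [x xu] := phi_chart u; rewrite -[RHS](chart_eq_vanish xu Bp).
  by apply: meval_eq => q; rewrite tnth_mktuple.
rewrite mderiv0 => /(congr1 (meval u0)); rewrite meval0 meval_sum => E.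
rewrite [RHS]E; apply: eq_bigr => q _.
rewrite mevalM comp_mpoly_meval !mxE tnth_mktuple; congr (_ * _).
by apply: meval_eq => q'; rewrite tnth_mktuple.
Qed.

Lemma chart_tangent_linear (v : 'I_coordn -> K) a w w' :
  chart_tangent B v w -> chart_tangent B v w' -> chart_tangent B v (a *: w + w').
Proof.
move=> tw tw' p Bp.
under eq_bigr => q _ do rewrite !mxE mulrDr mulrCA.
by rewrite big_split -mulr_sumr /= tw // tw' // mulr0 addr0.
Qed.

(** The d coordinates [D] are injective on tangent vectors, and the rows of [T] already span d
    dimensions of them. So [D] is an isomorphism on this span, and subtracting from w the element of
    the span with the same coordinates leaves 0. *)
Lemma chart_tangentP w : chart_tangent B v0 w <-> (w <= T)%MS.
Proof.
have tanM (c : 'rV_d) : chart_tangent B v0 (c *m T).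
  rewrite mulmx_sum_row; elim: (index_enum _) => [|i s IHs].
    rewrite big_nil => p _; apply: big1 => q _; by rewrite mxE mulr0.
  by rewrite big_cons; apply: chart_tangent_linear.
split=> [tw|/submxP[c ->]]; last exact: tanM.
pose S : 'M[K]_(coordn, d) := \matrix_(q, j) (q == D j)%:R.
have SE (w' : 'rV_coordn) j : (w' *m S) 0 j = w' 0 (D j).
  rewrite mxE (bigD1 (D j)) //= mxE eqxx mulr1 big1 ?addr0 // => q /negPf ne.
  by rewrite mxE ne mulr0.
have uTS : T *m S \in unitmx.
  rewrite -row_free_unit -kermx_eq0; apply/rowV0P => c /sub_kermxP cTS.
  have cT : c *m T = 0.
    by apply: tangentD (tanM c) _ => j; rewrite -SE -mulmxA cTS mxE.
  by rewrite -[c]mulmx1 -TJ mulmxA cT mul0mx.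
pose c := w *m S *m invmx (T *m S).
have : - 1 *: (c *m T) + w = 0.
  apply: tangentD => [|j]; first exact: chart_tangent_linear.
  rewrite -SE mulmxDl -scalemxAl -mulmxA /c mulmxKV // scaleN1r addNr.
  by rewrite mxE.
by move=> /eqP; rewrite scaleN1r addrC subr_eq0 => /eqP ->; apply: submxMl.
Qed.

Lemma smooth_tangent_dim : tangent_dim x0 d.
Proof.
exists B, v0; split=> //; exists T; split; last exact: chart_tangentP.
by apply/row_freeP; exists J.
Qed.

(* Near [x0] the equations of the chart and [psi \o phi \o psi = psi] force the
coordinates to be fixed by [phi \o psi]. *)
Lemma chart_image_nbhd : exists2 Q : {mpoly K[coordn]}, Q.@[v0] != 0 &
  forall y v, chart_coord B y v -> Q.@[v] != 0 -> chart_image y.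
Proof.
pose ps := [tuple psi i | i < d].
pose zeta := [tuple phi q \mPo ps | q < coordn].
have zetaE v q : (tnth zeta q).@[v] = (phi q).@[fun i => (psi i).@[v]].
  rewrite tnth_mktuple comp_mpoly_meval; apply: meval_eq => i.
  by rewrite tnth_mktuple.
have fix0 q : (tnth zeta q).@[v0] = v0 q.
  by rewrite zetaE; apply: meval_eq => i; rewrite phiK.
(* Linear relations between the differences v_j - zeta_j(v), valid on the whole chart, with
   polynomial coefficients. *)
pose rel (a : 'I_coordn -> {mpoly K[coordn]}) := forall y v, chart_coord B y v ->
  \sum_j (a j).@[v] * (v j - (tnth zeta j).@[v]) = 0.
pose Q (r : 'rV[K]_coordn) := exists2 a, rel a & forall j, r 0 j = (a j).@[v0].
(* By Hadamard's lemma, the gradient at [v0] of any p that agrees with p o zeta on the chart is the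
   value of such a relation. This holds for the chart equations, where both sides are 0, and for
   each [psi i]. *)
have Qp p : (forall y v, chart_coord B y v -> p.@[v] = (p \mPo zeta).@[v]) ->
    Q (\row_j p^`M(j).@[v0]).
  move=> pE; have [a [aE a0]] := mpoly_hadamard zeta p.
  exists a => [y v yv|j]; last by rewrite mxE a0.
  have /(congr1 (meval v)) := aE; rewrite mevalB -(pE y v yv) subrr meval_sum => E; rewrite [RHS]E.
  by apply: eq_bigr => j _; rewrite mevalM mevalB mevalXU.
have tangent_of w : (forall r, Q r -> r *m w^T = 0) -> chart_tangent B v0 w.
  move=> wP p Bp; have /wP/matrixP/(_ 0 0) : Q (\row_j p^`M(j).@[v0]).
    apply: Qp => y v yv; rewrite (chart_eq_vanish yv Bp) comp_mpoly_meval.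
    have [x xu] := phi_chart (fun i => (psi i).@[v]).
    rewrite -(chart_eq_vanish xu Bp); apply: meval_eq => q; by rewrite zetaE.
  by rewrite !mxE => {2}<-; apply: eq_bigr => q _; rewrite !mxE.
have [w wP|A uA QA] := @unitmx_of_rows K coordn Q.
  (* A vector orthogonal to the gradients of the chart equations is tangent, so w = c T;
     orthogonality to the gradients of [psi] gives c = w J = 0. *)
  have /chart_tangentP/submxP[c wE] := tangent_of w wP.
  suff c0 : c = 0 by rewrite wE c0 mul0mx.
  have wJ : w *m J = c by rewrite wE -mulmxA TJ mulmx1.
  apply/rowP => i; rewrite -wJ !mxE.
  have /wP/matrixP/(_ 0 0) : Q (\row_j (psi i)^`M(j).@[v0]).
    apply: Qp => y v _; rewrite comp_mpoly_meval -[LHS](phiK (fun i => (psi i).@[v])).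
    by apply: meval_eq => q; rewrite zetaE.
  by rewrite !mxE => {2}<-; apply: eq_bigr => q _; rewrite !mxE mulrC.
have /choice[a aP] : forall i, exists a, rel a /\ forall j, A i j = (a j).@[v0].
  move=> i; have [a rela aE] := QA i; exists a; split=> // j; by rewrite -aE mxE.
(* A square system of relations, invertible at [v0] and hence wherever its determinant is nonzero;
   there all the differences vanish. *)
pose M := \matrix_(i, j) a i j.
have ME v : (\det M).@[v] = \det (\matrix_(i, j) (a i j).@[v]).
  by rewrite -det_map_mx; congr (\det _); apply/matrixP => i j; rewrite !mxE.
exists (\det M).
  rewrite ME (_ : \matrix_(i, j) _ = A) -?unitfE -?unitmxE //.
  by apply/matrixP => i j; rewrite !mxE; have [_ ->] := aP i.
move=> y v yv; rewrite ME -unitfE -unitmxE => uMv.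
pose qv : 'cV[K]_coordn := \col_j (v j - (tnth zeta j).@[v]).
have qv0 : qv = 0.
  rewrite -[qv](mulKmx uMv) (_ : _ *m qv = 0) ?mulmx0 //.
  apply/matrixP => i j; have [rela _] := aP i; rewrite !mxE -[RHS](rela y v yv).
  by apply: eq_bigr => k _; rewrite !mxE.
exists (fun i => (psi i).@[v]).
rewrite (_ : (fun q => _) = v) //; apply/funext => q.
have /matrixP/(_ q 0) := qv0; rewrite !mxE zetaE => /eqP.
by rewrite subr_eq0 => /eqP.
Qed.

(** Y is covered by the closed locus Q = 0 and the closure of the image, and [x0] is not in the
    former. *)
Lemma irreducible_sub_chart_image Y : irreducible Y -> Y x0 ->
  forall x, Y x -> zclosure chart_image x.
Proof.
move=> [_ irrY] Yx0; have [Q Q0 QU] := chart_image_nbhd.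
have [y Yy|sub|//] := irrY _ _ (zclosed_chart_locus mu_gt0 Q oB) (zclosed_zclosure chart_image).
  have [|/chart_locusN[v yv Qv]] := pselect (chart_locus B Q y); first by left.
  by right; apply: zclosure_sub; apply: QU yv Qv.
by have := sub x0 Yx0 _ x0u0; move/eqP; rewrite (negPf Q0).
Qed.

Lemma smooth_irr_component : irr_component (zclosure chart_image).
Proof.
split; first exact/irreducible_zclosure/irreducible_chart_image.
move=> Z irrZ UZ; apply: irreducible_sub_chart_image => //; apply: UZ.
by apply: zclosure_sub; exists u0.
Qed.

(** Every chain of irreducible closed sets through [x0] lies in the closure of the image, so the
    number of parameters also bounds the local dimension. *)
Lemma smooth_point_chart_image : smooth_point x0.
Proof.
exists d; split; first exact: smooth_tangent_dim.
split.
  exists (fun i => zclosure (chart_flag u0 i)); split; first exact: chart_flag_chain.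
  by apply: zclosure_sub; exists u0.
move=> e [F [chF F0]].
have Fx0 i : (i <= e)%N -> F i x0 by move=> le_ie; apply: (irr_chain_mem chF I) F0.
have [irrF incF] := chF.
have FU i x : (i <= e)%N -> F i x -> zclosure chart_image x.
  move=> le_ie Fx; have [_ irrFi] := irrF i le_ie.
  exact: (irreducible_sub_chart_image irrFi (conj (Fx0 i le_ie) I) (conj Fx I)).
apply: (irr_chain_length mu_gt0 chart_image_family (Z := zclosure chart_image) (F := F)) => //.
split=> i le_ie.
  have [clF irrFi] := irrF i le_ie; split=> //.
  rewrite (_ : (fun x => _) = fun x => F i x /\ True) //; apply/funext => x; apply/propext.
  by split=> [[]|[Fx _]] //; split=> //; apply: FU Fx.
have [inc [x [_ Fx nFx]]] := incF i le_ie; split=> [y _ |]; first exact: inc.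
by exists x; split=> //; apply: FU Fx.
Qed.

End SmoothParametrization.

(** * The principal component *)

Section Principal.
Variables (K : closedFieldType) (n mu : nat).
Hypotheses (charK0 : [pchar K] =i pred0) (mu_gt0 : (0 < mu)%N) (n_gt0 : (0 < n)%N).
Implicit Types (x y : hilb K n mu) (Z F G : hilb K n mu -> Prop).
Local Notation coordn := #|{: Defs.coord n mu}|.
Local Notation ptidx := ('I_mu * 'I_n)%type.
Local Notation r := #|{: ptidx}|.

Definition point_of (u : 'I_r -> K) (j : 'I_mu) : 'I_n -> K :=
  fun k => u (enum_rank (j, k)).

Definition ideal_of_points (u : 'I_r -> K) x : Prop :=
  forall f, x f <-> forall j, f.@[point_of u j] = 0.

Lemma ideal_of_points_family : rational_family ideal_of_points.
Proof.
apply: (@rational_family_of_functionals K n mu r ideal_of_points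
  (fun u f => \row_j f.@[point_of u j])).
- by move=> u x _ a f g; apply/rowP => j; rewrite !mxE mevalD mevalZ.
- move=> f; exists (fun j => f \mPo [tuple 'X_(enum_rank (j, k)) | k < n]) => u i.
  rewrite mxE comp_mpoly_meval; apply: meval_eq => k.
  by rewrite tnth_mktuple mevalXU.
move=> u x ux f; split=> [/ux f0|/rowP f0].
  by apply/rowP => j; rewrite !mxE f0.
by apply/ux => j; have := f0 j; rewrite !mxE.
Qed.

(** Stronger than distinctness of the points, yet generic, and enough for Lagrange interpolation in
    the first variable. *)
Definition sep (u : 'I_r -> K) := forall i j, i != j ->
  point_of u i (Ordinal n_gt0) != point_of u j (Ordinal n_gt0).

Lemma ideal_of_points_exists u : sep u -> exists x, ideal_of_points u x.
Proof.
move=> su; pose k0 := Ordinal n_gt0; pose p := point_of u.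
pose I (f : {mpoly K[n]}) := forall j, f.@[p j] = 0.
have idI : is_ideal I.
  split=> [j|f g If Ig j|f g Ig j]; first exact: meval0.
    by rewrite mevalD If Ig addr0.
  by rewrite mevalM Ig mulr0.
pose e j : {mpoly K[n]} := \prod_(i | i != j) ((p j k0 - p i k0)^-1 *: ('X_k0 - (p i k0)%:MP)).
have eE j i : (e j).@[p i] = (i == j)%:R.
  rewrite meval_prod; case: eqP => [->|/eqP ne].
    apply: big1 => l ne; rewrite mevalZ mevalB mevalXU mevalC mulVf //.
    by rewrite subr_eq0; apply: su; rewrite eq_sym.
  by rewrite (bigD1 i) //= mevalZ mevalB mevalXU mevalC subrr mulr0 mul0r.
have sumE (c : 'I_mu -> K) i : (\sum_j c j *: e j).@[p i] = c i.
  rewrite meval_sum (bigD1 i) //= mevalZ eE eqxx mulr1 big1 ?addr0 // => j ne.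
  by rewrite mevalZ eE eq_sym (negPf ne) mulr0.
have qb : quotient_basis e I.
  apply: quotient_basisI => // [f|c Ic i].
    by exists (fun j => f.@[p j]) => i; rewrite mevalB sumE subrr.
  by rewrite -(sumE c i) Ic.
by exists (Hilb idI (ex_intro _ e qb)) => f.
Qed.

Definition sep_poly : {mpoly K[r]} := \prod_(i : 'I_mu) \prod_(j : 'I_mu | i != j)
  ('X_(enum_rank (i, Ordinal n_gt0)) - 'X_(enum_rank (j, Ordinal n_gt0))).

Lemma sep_polyP u : sep_poly.@[u] != 0 <-> sep u.
Proof.
rewrite /sep_poly meval_prod.
split=> [/prodf_neq0 H i j ne|su].
  have := H i isT; rewrite meval_prod => /prodf_neq0/(_ j ne).
  by rewrite mevalB !mevalXU subr_eq0.
apply/prodf_neq0 => i _; rewrite meval_prod; apply/prodf_neq0 => j ne.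
by rewrite mevalB !mevalXU subr_eq0; apply: su.
Qed.

(** Evaluation at the mu points is injective on the quotient, which has dimension mu, hence
    bijective. In particular colength mu forces the points to be distinct. *)
Lemma points_interpolation u x j : ideal_of_points u x ->
  exists f, forall i, f.@[point_of u i] = (i == j)%:R.
Proof.
move=> ux; have [e qb] := hilb_has_basis x; have idx := hilb_is_ideal x.
pose E : 'M[K]_mu := \matrix_(a, i) (e a).@[point_of u i].
have sumE (c : 'rV[K]_mu) i : (\sum_a c 0 a *: e a).@[point_of u i] = (c *m E) 0 i.
  by rewrite meval_sum mxE; apply: eq_bigr => a _; rewrite mevalZ mxE.
have uE : E \in unitmx.
  rewrite -row_free_unit -kermx_eq0; apply/rowV0P => c /sub_kermxP cE.
  apply/rowP => a; rewrite mxE; apply: (quotient_basis_free idx (c := c 0) qb).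
  by apply/ux => i; rewrite sumE cE mxE.
pose c : 'rV[K]_mu := delta_mx 0 j *m invmx E.
exists (\sum_a c 0 a *: e a) => i.
by rewrite sumE mulmxKV // mxE eqxx.
Qed.

Lemma ideal_of_points_reduced u x : ideal_of_points u x -> reduced x.
Proof.
move=> ux f k /ux fk; apply/ux => j; have := fk j.
rewrite meval_exp => /eqP; rewrite expf_eq0 => /andP[_ /eqP //].
Qed.

(* A proper ideal containing a split polynomial in each variable has a zero: adding
X_k - r for a suitable root r keeps it proper. *)
Lemma proper_ideal_zero (s : 'I_n -> seq K) (J : {mpoly K[n]} -> Prop) :
  is_ideal J -> ~ J 1 ->
  (forall k, J (\prod_(a <- s k) ('X_k - a%:MP))) ->
  exists p : 'I_n -> K, forall f, J f -> f.@[p] = 0.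
Proof.
move=> idJ J1 Js.
have step (J' : {mpoly K[n]} -> Prop) k : is_ideal J' -> ~ J' 1 ->
    (forall f, J f -> J' f) ->
    exists (a : K) (J'' : {mpoly K[n]} -> Prop), [/\ is_ideal J'', ~ J'' 1, forall f, J' f -> J'' f
      & J'' ('X_k - a%:MP)].
  move=> idJ' J'1 JJ'; pose add a f := exists g, J' (f - g * ('X_k - a%:MP)).
  have idadd a : is_ideal (add a).
    split=> [|f f' [g Jg] [g' Jg']|h f [g Jg]].
    - by exists 0; rewrite mul0r subr0; apply: ideal0.
    - exists (g + g'); rewrite mulrDl opprD addrACA; exact: idealD.
    exists (h * g); rewrite -mulrA -mulrBr; exact: idealMl.
  have J'add a f : J' f -> add a f by move=> J'f; exists 0; rewrite mul0r subr0.
  have addX a : add a ('X_k - a%:MP).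
    by exists 1; rewrite mul1r subrr; apply: ideal0.
  apply: contrapT => /forallNP noa.
  have add1 a : add a 1.
    by apply: contrapT => na1; apply: (noa a); exists (add a); split=> // f; apply: J'add.
  (* If no root can be adjoined, each X_k - a is invertible modulo J', and the factors of the split
     polynomial can be removed one by one until only 1 is left. *)
  suff: forall t : seq K, J' (\prod_(a <- t) ('X_k - a%:MP)) -> J' 1.
    by move/(_ (s k)) => H; apply: J'1; apply: H; apply: JJ'; exact: Js.
  elim=> [|a t IHt]; first by rewrite big_nil.
  rewrite big_cons => J'p; apply: IHt; have [g Jg] := add1 a.
  set q := \prod_(b <- t) _ in J'p *.
  have -> : q = (1 - g * ('X_k - a%:MP)) * q + g * (('X_k - a%:MP) * q) by ring.
  by apply: idealD => //; [apply: idealMr | apply: idealMl].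
have [p [J' [idJ' J'1 JJ' J'X]]] : exists (p : 'I_n -> K) (J' : {mpoly K[n]} -> Prop),
    [/\ is_ideal J', ~ J' 1, forall f, J f -> J' f
      & forall k : 'I_n, J' ('X_k - (p k)%:MP)].
  have : forall m, (m <= n)%N -> exists (p : 'I_n -> K) (J' : {mpoly K[n]} -> Prop),
      [/\ is_ideal J', ~ J' 1, forall f, J f -> J' f
        & forall k : 'I_n, (k < m)%N -> J' ('X_k - (p k)%:MP)].
    elim=> [|m IHm] le_m; first by exists (fun=> 0), J.
    have [p [J' [idJ' J'1 JJ' J'X]]] := IHm (ltnW le_m).
    have [a [J'' [idJ'' J''1 J'J'' J''X]]] := step J' (Ordinal le_m) idJ' J'1 JJ'.
    exists (fun k => if k == Ordinal le_m then a else p k), J''; split=> //.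
      by move=> f /JJ'/J'J''.
    move=> k; case: eqP => [-> //|ne]; rewrite ltnS leq_eqVlt => /orP[/eqP km|/J'X/J'J'' //].
    by case: ne; apply: val_inj.
  move/(_ n (leqnn n)) => [p [J' [idJ' J'1 JJ' J'X]]].
  by exists p, J'; split=> // k; apply: J'X.
exists p => f /JJ' J'f; apply/eqP/contraT => fp; case: J'1.
(* Modulo J' every polynomial is congruent to its value at p, so an element of J' with a nonzero
   value would yield a unit in J'. *)
have J'fp : J' (f - (f.@[p])%:MP).
  elim/mpoly_ring_ind: f {J'f fp} => [c|k|f g IHf IHg|f g IHf IHg].
  - by rewrite mevalC subrr; apply: ideal0.
  - by rewrite mevalXU; apply: J'X.
  - rewrite mevalD mpolyCD opprD addrACA; exact: idealD.
  rewrite mevalM mpolyCM.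
  have -> : f * g - f.@[p]%:MP * g.@[p]%:MP
      = (f - f.@[p]%:MP) * g + f.@[p]%:MP * (g - g.@[p]%:MP) by ring.
  by apply: idealD => //; [apply: idealMr | apply: idealMl].
have := ideal_congr idJ' (ideal_sym idJ' J'fp) J'f => /(idealZ idJ' (f.@[p])^-1).
by rewrite -mul_mpolyC -mpolyCM mulVf // mpolyC1.
Qed.

(** The first mu + 1 powers of X_k are dependent modulo x, which gives a polynomial in X_k that
    splits over K; reducedness removes the multiplicities of its roots. *)
Lemma reduced_split_poly x k : reduced x ->
  exists s : seq K, uniq s /\ x (\prod_(a <- s) ('X_k - a%:MP)).
Proof.
move=> redx; have idx := hilb_is_ideal x; have [e qb] := hilb_has_basis x.
have [c c0 xc] : exists2 c : 'I_mu.+1 -> K, exists i, c i != 0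
    & x (\sum_i c i *: 'X_k ^+ i).
  apply: contrapT => noc; have := @quotient_free_size K n x idx mu e mu.+1
    (fun i => 'X_k ^+ i) qb.
  rewrite ltnn => absurd; suff: false by [].
  apply: absurd => c xc i; apply/eqP/contraT => ci.
  by case: noc; exists c => //; exists i.
pose q : {poly K} := \poly_(i < mu.+1) c (inord i).
have q0 : q != 0.
  have [i ci] := c0; apply: contraNneq ci => q0; have := coef_poly mu.+1 (fun i => c (inord i)) i.
  by rewrite -/q q0 coef0 ltn_ord inord_val => <-.
have [t qt] := closed_field_poly_normal q.
have lq : lead_coef q != 0 by rewrite lead_coef_eq0.
have xt : x (\prod_(a <- t) ('X_k - a%:MP)).
  pose ev (g : {poly K}) : {mpoly K[n]} := (map_poly (@mpolyC n K) g).['X_k].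
  have evq : ev q = \sum_i c i *: 'X_k ^+ i.
    rewrite /ev (@horner_coef_wide _ mu.+1); last first.
      by rewrite size_map_poly_id0 ?size_poly // mpolyC_eq0 lead_coef_eq0.
    apply: eq_bigr => i _; rewrite coef_map /= coef_poly ltn_ord inord_val.
    by rewrite mul_mpolyC.
  have := xc; rewrite -evq qt /ev map_polyZ /= hornerZ rmorph_prod /= horner_prod.
  move=> /(idealZ idx (lead_coef q)^-1); rewrite -mul_mpolyC mulrA -mpolyCM mulVf //.
  rewrite mul1r; congr (hilb_ideal x _); apply: eq_bigr => a _.
  by rewrite rmorphB /= map_polyX map_polyC !hornerE.
exists (undup t); split; first exact: undup_uniq.
apply: (redx _ (size t)); rewrite -prodrXl.
have undupE : \prod_(a <- t) ('X_k - a%:MP)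
    = \prod_(a <- undup t) ('X_k - a%:MP) ^+ count_mem a t :> {mpoly K[n]}.
  by rewrite -big_undup_iterop_count.
rewrite undupE in xt.
have -> : \prod_(a <- undup t) ('X_k - a%:MP) ^+ size t
    = \prod_(a <- undup t) ('X_k - a%:MP) ^+ (size t - count_mem a t)
      * \prod_(a <- undup t) ('X_k - a%:MP) ^+ count_mem a t :> {mpoly K[n]}.
  by rewrite -big_split /=; apply: eq_bigr => a _; rewrite -exprD subnK ?count_size.
exact: idealMl.
Qed.

(** The zeros of x lie in a finite grid of roots. Once x is known to consist of all polynomials
    vanishing at these zeros, their indicator functions form a basis of the quotient, and there are
    mu of them. *)
Lemma reduced_ideal_of_points x : reduced x -> exists u, ideal_of_points u x.
Proof.
move=> redx; have idx := hilb_is_ideal x.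
have /choice[s sP] := fun k => reduced_split_poly k redx.
pose V (p : {ffun 'I_n -> K}) := forall f, x f -> f.@[p] = 0.
have Vs p k : V p -> p k \in s k.
  move=> Vp; have [_ /Vp] := sP k; rewrite meval_prod => /eqP.
  rewrite prodf_seq_eq0 => /hasP[a ask]; rewrite mevalB mevalXU mevalC /=.
  by rewrite subr_eq0 => /eqP ->.
(* Up to a constant, the indicator function of p on the grid. For p in the grid, h_p g is congruent
   to g(p) h_p modulo x. *)
pose h (p : {ffun 'I_n -> K}) : {mpoly K[n]} := \prod_k \prod_(a <- s k | a != p k) ('X_k - a%:MP).
have hp (p : {ffun 'I_n -> K}) : (h p).@[p] != 0.
  rewrite meval_prod; apply/prodf_neq0 => k _; rewrite meval_prod.
  rewrite prodf_seq_neq0; apply/allP => a _; apply/implyP => ne.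
  by rewrite mevalB mevalXU mevalC subr_eq0 eq_sym.
have hX (p : {ffun 'I_n -> K}) k : p k \in s k -> x (h p * ('X_k - (p k)%:MP)).
  move=> pk; rewrite /h (bigD1 k) //= mulrAC; apply: idealMr => //.
  have [us xs] := sP k; rewrite (bigD1_seq (p k)) //= in xs.
  by rewrite mulrC.
have hsub (p : {ffun 'I_n -> K}) g : (forall k, p k \in s k) -> x (h p * (g - (g.@[p])%:MP)).
  move=> ps; elim/mpoly_ring_ind: g => [c|k|f g IHf IHg|f g IHf IHg].
  - by rewrite mevalC subrr mulr0; apply: ideal0.
  - by rewrite mevalXU; apply: hX.
  - rewrite mevalD mpolyCD opprD addrACA mulrDr; exact: idealD.
  rewrite mevalM mpolyCM.
  have -> : h p * (f * g - f.@[p]%:MP * g.@[p]%:MP)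
      = h p * (f - f.@[p]%:MP) * g + f.@[p]%:MP * (h p * (g - g.@[p]%:MP)) by ring.
  by apply: idealD => //; [apply: idealMr | apply: idealMl].
(* Otherwise the ideal (x : f) is proper and has a zero p, which is also a zero of x. Since f(p) =
   0, h_p f lies in x, so h_p lies in (x : f), although h_p(p) != 0. *)
have xV f : (forall p : {ffun 'I_n -> K}, V p -> f.@[p] = 0) -> x f.
  move=> fV; apply: contrapT => nxf; pose J g := x (g * f).
  have idJ : is_ideal J.
    split=> [|g g' Jg Jg'|g g' Jg']; rewrite /J.
    - by rewrite mul0r; apply: ideal0.
    - by rewrite mulrDl; apply: idealD.
    by rewrite -mulrA; apply: idealMl.
  have [||p0 pJ] := @proper_ideal_zero s J idJ.
  - by rewrite /J mul1r.
  - by move=> k; apply: idealMr => //; have [] := sP k.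
  pose p := [ffun k => p0 k].
  have pE (g : {mpoly K[n]}) : g.@[p] = g.@[p0] by apply: meval_eq => k; rewrite ffunE.
  have Vp : V p by move=> g xg; rewrite pE; apply: pJ; apply: idealMr.
  have : J (h p).
    have := hsub p f (fun k => Vs p k Vp).
    by rewrite fV // mpolyC0 subr0.
  by move/pJ/eqP; rewrite -pE (negPf (hp p)).
pose e (p : {ffun 'I_n -> K}) := ((h p).@[p])^-1 *: h p.
have eE (p p' : {ffun 'I_n -> K}) : V p' -> (e p).@[p'] = (p == p')%:R.
  move=> Vp'; rewrite mevalZ; case: eqP => [<-|/eqP ne]; first by rewrite mulVf.
  have [k nek] : exists k, p' k != p k.
    apply/existsP; rewrite -negb_forall; apply: contra ne => /forallP eqp.
    by apply/eqP/ffunP => k; apply/esym/eqP.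
  rewrite (_ : (h p).@[p'] = 0) ?mulr0 // meval_prod (bigD1 k) //=.
  rewrite meval_prod -big_filter (bigD1_seq (p' k)) /=.
  - by rewrite mevalB mevalXU mevalC subrr !mul0r.
  - by rewrite mem_filter nek Vs.
  by apply: filter_uniq; have [] := sP k.
have sumE (L : seq {ffun 'I_n -> K}) (c : 'I_(size L) -> K) (i : 'I_(size L)) : uniq L ->
    (forall p, p \in L -> V p) ->
    (\sum_i c i *: e (nth 0 L i)).@[nth 0 L i] = c i.
  move=> uL LV; have Vi : V (nth 0 L i) by apply/LV/mem_nth.
  rewrite meval_sum (bigD1 i) //= mevalZ eE // eqxx mulr1 big1 ?addr0 // => j ne.
  by rewrite mevalZ eE // nth_uniq // (inj_eq val_inj) (negPf ne) mulr0.
have freeL (L : seq {ffun 'I_n -> K}) : uniq L -> (forall p, p \in L -> V p) ->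
    forall c : 'I_(size L) -> K, x (\sum_i c i *: e (nth 0 L i)) -> forall i, c i = 0.
  move=> uL LV c xc i; rewrite -(sumE L c i) //.
  by have /LV := mem_nth 0 (ltn_ord i); apply.
have [e0 qb0] := hilb_has_basis x.
pose Q m := `[< exists L : seq {ffun 'I_n -> K}, [/\ uniq L, size L = m &
    forall p, p \in L -> V p] >].
have exQ : exists m, Q m by exists 0%N; apply/asboolP; exists [::].
have leQ m : Q m -> (m <= mu)%N.
  move=> /asboolP[L [uL <- LV]].
  exact: (quotient_free_size idx qb0 (freeL L uL LV)).
case: (ex_maxnP exQ leQ) => m /asboolP[L [uL sm LV]] maxm.
have all_L (p : {ffun 'I_n -> K}) : V p -> p \in L.
  move=> Vp; apply: contraT => pL; have := maxm m.+1; rewrite ltnn; apply.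
  apply/asboolP; exists (p :: L); rewrite /= pL uL sm; split=> // p'.
  by rewrite inE => /orP[/eqP->|/LV].
have qb : quotient_basis (fun i : 'I_(size L) => e (nth 0 L i)) x.
  apply: quotient_basisI => // [f|]; last exact: freeL.
  exists (fun i : 'I_(size L) => f.@[nth 0 L i]); apply: xV => p /all_L pL.
  rewrite -index_mem in pL; have := sumE L (fun i => f.@[nth 0 L i]) (Ordinal pL) uL LV.
  by rewrite mevalB /= nth_index -?index_mem // => ->; rewrite subrr.
have sL : size L = mu.
  apply/eqP; rewrite eqn_leq sm leQ -?sm; last by apply/asboolP; exists L.
  apply: (quotient_free_size idx qb (g := e0)) => c.
  exact: (quotient_basis_free idx (c := c) qb0).
pose u (t : 'I_r) := nth 0 L (enum_val t).1 (enum_val t).2.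
have uE j f : f.@[point_of u j] = f.@[nth 0 L j].
  by apply: meval_eq => k; rewrite /point_of /u enum_rankK.
exists u => f; split=> [xf j|fL].
  by rewrite uE; apply: (LV _ (mem_nth _ _)); rewrite ?sL.
apply: xV => p /all_L pL; have ip : (index p L < mu)%N by rewrite -sL index_mem.
by have := fL (Ordinal ip); rewrite uE nth_index.
Qed.

Lemma reducedE : (fun x => exists u, ideal_of_points u x) = (@reduced K n mu).
Proof.
apply/funext => x; apply/propext; split; last exact: reduced_ideal_of_points.
by case=> u; apply: ideal_of_points_reduced.
Qed.

(** * A chain in the principal component *)

Definition points_flag i x := exists2 u : 'I_r -> K,
  forall t : 'I_r, (i <= t)%N -> u t = t%:R & ideal_of_points u x.

(** For an ideal of points this says that some point has k-th coordinate c. In this form the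
    condition makes sense on the whole Hilbert scheme and is closed there: the determinant of M_k -
    c vanishes. *)
Definition zero_divisor k (c : K) x := exists2 f, ~ x f & x (('X_k - c%:MP) * f).

Lemma zclosed_zero_divisor k c : zclosed (zero_divisor k c).
Proof.
move=> B oB; pose A : 'M[{mpoly K[coordn]}]_mu := (@gen_mx K n mu k) - (c%:MP)%:M.
exists (fun p => p = \det A) => x v xv; have idx := hilb_is_ideal x.
have [qb vP] := xv; pose Av : 'M[K]_mu := \matrix_(i, j) v (cidx k i j) - c%:M.
have detA : (\det A).@[v] = \det Av.
  rewrite -det_map_mx; congr (\det _); apply/matrixP => i j.
  by rewrite /A /Av !mxE rmorphB rmorphMn /= mevalXU mevalC.
have mulA (a : 'I_mu -> K) : x (('X_k - c%:MP) * (\sum_j a j *: monomials K B j)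
    - \sum_i (Av *m \col_j a j) i 0 *: monomials K B i).
  have -> : \sum_i (Av *m \col_j a j) i 0 *: monomials K B i
      = \sum_j a j *: (\sum_i v (cidx k i j) *: monomials K B i - c *: monomials K B j).
    transitivity (\sum_i \sum_j (a j * v (cidx k i j)) *: monomials K B i
      - \sum_j (a j * c) *: monomials K B j).
      rewrite -sumrB; apply: eq_bigr => i _; rewrite mulmxBl mxE [X in _ + X]mxE.
      rewrite mul_scalar_mx !mxE scalerBl scaler_suml; congr (_ - _ *: _); last exact: mulrC.
      by apply: eq_bigr => j _; rewrite !mxE mulrC.
    rewrite exchange_big -sumrB /=; apply: eq_bigr => j _.
    rewrite scalerBr scalerA scaler_sumr; congr (_ - _).
    by apply: eq_bigr => i _; rewrite scalerA.
  rewrite mulr_sumr -sumrB; apply: ideal_sum => // j _.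
  rewrite -scalerAr -scalerBr mulrBl mul_mpolyC opprB subrKA.
  by apply: idealZ => //; rewrite /monomials -mpolyXD; apply: vP.
split=> [[f nxf xf] _ ->|/(_ _ erefl)].
  rewrite detA; apply/eqP; apply: contra_notT nxf; rewrite -unitfE -unitmxE => uA.
  have [a xa] := quotient_basis_coords f qb.
  have xka : x (('X_k - c%:MP) * \sum_j a 0 j *: monomials K B j).
    apply: ideal_congr xf => //; rewrite -mulrBr; apply: idealMl => //; exact: ideal_sym.
  have /(quotient_basis_free idx qb) Aa := ideal_congr idx (ideal_sym idx (mulA (a 0))) xka.
  have a0 : \col_j a 0 j = 0.
    rewrite -[LHS](mulKmx uA) (_ : Av *m _ = 0) ?mulmx0 //.
    by apply/matrixP => i j; rewrite !ord1 Aa mxE.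
  rewrite big1 ?subr0 // in xa => j _.
  by have /matrixP/(_ j 0) := a0; rewrite !mxE => ->; rewrite scale0r.
rewrite detA => detA0; have /rowV0Pn[a /sub_kermxP aA a0] : kermx Av^T != 0.
  by rewrite kermx_eq0 row_free_unit unitmx_tr unitmxE unitfE detA0 eqxx.
exists (\sum_j a 0 j *: monomials K B j).
  move=> /(quotient_basis_free idx qb) a00; case/eqP: a0; apply/rowP => j.
  by rewrite a00 mxE.
have := mulA (a 0); rewrite [X in _ - X]big1 ?subr0 // => i _.
suff -> : Av *m \col_j a 0 j = 0 by rewrite mxE scale0r.
have -> : \col_j a 0 j = a^T by apply/matrixP => i' j'; rewrite !mxE ord1.
by apply: trmx_inj; rewrite trmx_mul trmxK aA trmx0.
Qed.

Let natr_inj : injective (fun k : nat => k%:R : K).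
Proof.
move=> i j; wlog le_ij : i j / (i <= j)%N => [hw|/eqP].
  by case/orP: (leq_total i j) => /hw // h /esym /h.
rewrite eq_sym -subr_eq0 -natrB //.
move/pcharf0P: charK0 => ->; rewrite subn_eq0 => le_ji.
by apply/eqP; rewrite eqn_leq le_ij.
Qed.

Let sep_injective u : injective u -> sep u.
Proof.
move=> inju i j; apply: contra => /eqP/inju/enum_rank_inj [->] //.
Qed.

Lemma irreducible_points_flag i : irreducible (points_flag i).
Proof.
pose s (t : 'I_r) : {mpoly K[r]} := if (i <= t)%N then (t%:R)%:MP else 'X_t.
pose fam u x := ideal_of_points (fun t => (s t).@[u]) x.
have famR : rational_family fam.
  move=> B oB; have [D [F DF]] := ideal_of_points_family oB.
  pose st := [tuple s t | t < r].
  have stE (p : {mpoly K[r]}) u : (p \mPo st).@[u] = p.@[fun t => (s t).@[u]].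
    by rewrite comp_mpoly_meval; apply: meval_eq => q; rewrite tnth_mktuple.
  exists (D \mPo st), (fun q => F q \mPo st) => u x /DF[D1 F1].
  rewrite stE; split=> // v xv q; rewrite !stE; exact: F1.
pose delta := sep_poly \mPo [tuple s t | t < r].
have deltaE u : delta.@[u] = sep_poly.@[fun t => (s t).@[u]].
  by rewrite comp_mpoly_meval; apply: meval_eq => q; rewrite tnth_mktuple.
have delta0 : delta != 0.
  suff: delta.@[fun t => t%:R] != 0 by apply: contraNneq => ->; rewrite meval0.
  rewrite deltaE; apply/sep_polyP/sep_injective => t t'.
  suff E t1 : (s t1).@[fun t => t%:R] = t1%:R by rewrite !E => /natr_inj/val_inj.
  by rewrite /s; case: ifP => _; rewrite ?mevalC ?mevalXU.
have := irreducible_rational_image charK0 famR delta0.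
have -> : (fun x => exists u, fam u x) = points_flag i.
  apply/funext => x; apply/propext; split=> [[u ux]|[u ut ux]].
    by exists (fun t => (s t).@[u]) => // t le_it; rewrite /s le_it mevalC.
  exists u; rewrite /fam (_ : (fun t => (s t).@[u]) = u) //; apply/funext => t.
  by rewrite /s; case: ifP => [/ut ->|_]; rewrite ?mevalC ?mevalXU.
by apply=> u; rewrite deltaE => /sep_polyP/ideal_of_points_exists.
Qed.

Lemma points_flag_chain :
  irr_chain (principal_component (K := K) (n := n) (mu := mu))
    (fun i => zclosure (points_flag i)) r.
Proof.
have flagZ i x : points_flag i x -> principal_component x.
  by case=> u _ xu; apply: zclosure_sub; apply: ideal_of_points_reduced xu.
split=> i le_i; split; first exact: zclosed_zclosure.
- apply: irreducible_between (irreducible_points_flag i) _ _ => [x xi|x [] //].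
  by split; [apply: zclosure_sub | apply: flagZ xi].
- move=> x _; apply: zclosureS => {}x [u ut xu]; exists u => // j /ltnW; exact: ut.
pose t0 : 'I_r := Ordinal le_i.
(* Coordinate i receives the value r, which exceeds every index: the points stay distinct, and no
   coordinate has the value i any more. *)
pose u (t : 'I_r) : K := (if t == t0 then r else t)%:R.
have inju : injective u.
  move=> t t' /natr_inj; do 2![case: eqP => [->|_] //].
  - by move=> E; have := ltn_ord t'; rewrite -E ltnn.
  - by move=> E; have := ltn_ord t; rewrite E ltnn.
  by move=> /val_inj.
have [x xu] := ideal_of_points_exists (sep_injective inju).
have xi : points_flag i.+1 x.
  exists u => // t lt_it; rewrite /u; case: eqP => // tt0.
  by rewrite tt0 ltnn in lt_it.
exists x; split; [exact: flagZ xi | exact: zclosure_sub | ].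
case E : (enum_val t0) => [j k].
have t0E : enum_rank (j, k) = t0 by rewrite -E enum_valK.
have sub y : points_flag i y -> zero_divisor k i%:R y.
  case=> w wt yw; have [f fE] := points_interpolation j yw.
  exists f => [/yw/(_ j)/eqP|]; first by rewrite fE eqxx oner_eq0.
  apply/yw => j'; rewrite mevalM mevalB mevalXU mevalC fE.
  case: eqP => [->|_]; last by rewrite mulr0.
  by rewrite /point_of t0E wt // subrr mul0r.
move=> /(zclosure_min (zclosed_zero_divisor k i%:R) sub)[f nxf /xu xf].
apply: nxf; apply/xu => j'; have /eqP := xf j'.
rewrite mevalM mevalB mevalXU mevalC mulf_eq0 subr_eq0 => /orP[|/eqP //].
rewrite /point_of /u => /eqP/natr_inj; case: eqP => [_ E'|ne E'].
  by have := le_i; rewrite -E' ltnn.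
by case: ne; apply: val_inj.
Qed.

Lemma principal_has_dim :
  has_dim (principal_component (K := K) (n := n) (mu := mu)) (n * mu).
Proof.
have -> : (n * mu)%N = r by rewrite card_prod !card_ord mulnC.
split; first by exists (fun i => zclosure (points_flag i)); apply: points_flag_chain.
move=> e [F chF]; apply: (irr_chain_length mu_gt0 ideal_of_points_family _ chF) => x.
by rewrite reducedE.
Qed.

End Principal.

(** * Punctual ideals *)

Section Punctual.
Variables (K : closedFieldType) (n mu : nat).
Hypotheses (charK0 : [pchar K] =i pred0) (mu_gt0 : (0 < mu)%N).
Implicit Types (x y : hilb K n mu).
Local Notation coordn := #|{: Defs.coord n mu}|.

(** The fixed exponent mu turns support at one point into a condition that can be written as
    equations in each chart. *)
Definition punctual x := exists a : 'I_n -> K, forall k, x (('X_k - (a k)%:MP) ^+ mu).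

Lemma hilb_proper x : ~ x 1.
Proof.
move=> x1; have [e qb] := hilb_has_basis x; have idx := hilb_is_ideal x.
have := @quotient_basis_free _ _ _ idx _ _ (fun=> 1) qb _ (Ordinal mu_gt0).
move=> /(_ _)/eqP; rewrite oner_eq0 => H; suff: false by []; apply: H.
by apply: ideal_sum => // i _; apply: idealZ; rewrite // -[e i]mulr1; apply: idealMl.
Qed.

Lemma punctual_supported x : punctual x -> exists a, supported_at a x.
Proof.
case=> a xa; exists a => b; have idx := hilb_is_ideal x.
have xb p k : (forall f, x f -> f.@[p] = 0) -> p k = a k.
  move=> /(_ _ (xa k))/eqP; rewrite meval_exp expf_eq0 mevalB mevalXU mevalC.
  by rewrite subr_eq0 => /andP[_ /eqP].
split=> [bz k|ba]; first exact: xb.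
have [|p pz] := proper_ideal_zero (s := fun k => nseq mu (a k)) idx (@hilb_proper x).
  by move=> k; rewrite big_nseq -Monoid.iteropE; apply: xa.
move=> f xf; rewrite -[RHS](pz f xf); apply: meval_eq => k.
by rewrite ba (xb p k).
Qed.

(* The eigenvalues of a multiplication matrix are the values of the coordinate, so
the trace determines the support. *)
Lemma punctual_trace B x v k (a : K) e : chart_coord B x v ->
  x (('X_k - a%:MP) ^+ e) -> \sum_j v (cidx k j j) = a *+ mu.
Proof.
move=> [qb vP] xa; have idx := hilb_is_ideal x.
pose N : 'M[K]_mu := \matrix_(j, i) v (cidx k i j).
have [s sE] := closed_field_poly_normal (char_poly N).
rewrite (monicP (char_poly_monic N)) scale1r in sE.
have size_s : size s = mu.
  by have := size_char_poly N; rewrite sE size_prod_XsubC => -[].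
have s_a : forall b, b \in s -> b = a.
  move=> b bs; have : eigenvalue N b.
    by rewrite eigenvalue_root_char sE root_prod_XsubC.
  case/eigenvalueP => c cN c0; pose f := \sum_j c 0 j *: monomials K B j.
  have nxf : ~ x f.
    move=> /(quotient_basis_free idx qb) cz; case/eqP: c0; apply/rowP => j.
    by rewrite cz mxE.
  have xbf : x (('X_k - b%:MP) * f).
    have -> : ('X_k - b%:MP) * f = \sum_j c 0 j *:
        ('X_k * monomials K B j - \sum_i v (cidx k i j) *: monomials K B i).
      under [RHS]eq_bigr => j _ do rewrite scalerBr scaler_sumr.
      rewrite sumrB exchange_big /= mulrBl mulr_sumr; congr (_ - _).
        by apply: eq_bigr => j _; rewrite scalerAr.
      rewrite mulr_sumr; apply: eq_bigr => i _.
      rewrite -scalerAr mul_mpolyC scalerA.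
      have /rowP/(_ i) := cN; rewrite !mxE mulrC => <-; rewrite scaler_suml.
      by apply: eq_bigr => j _; rewrite mxE scalerA.
    apply: ideal_sum => // j _; apply: idealZ => //.
    by rewrite /monomials -mpolyXD; apply: vP.
  have xpow m : x (('X_k - a%:MP) ^+ m * f - ((b - a) ^+ m) *: f).
    elim: m => [|m IHm]; first by rewrite !expr0 mul1r scale1r subrr; apply: ideal0.
    have -> : ('X_k - a%:MP) ^+ m.+1 * f - (b - a) ^+ m.+1 *: f
       = ('X_k - a%:MP) * (('X_k - a%:MP) ^+ m * f - ((b - a) ^+ m) *: f)
         + ((b - a) ^+ m)%:MP * (('X_k - b%:MP) * f).
      rewrite -!mul_mpolyC exprS exprS mpolyCM mpolyCB; ring.
    by apply: idealD => //; apply: idealMl.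
  have xf : x ((b - a) ^+ e *: f).
    apply: ideal_congr (ideal_sym idx (xpow e)) _ => //; exact: idealMr.
  apply/eqP; rewrite -subr_eq0; apply/contraT => ba; case: nxf.
  have ba' : (b - a) ^+ e != 0 by rewrite expf_neq0.
  by have := idealZ idx ((b - a) ^+ e)^-1 xf; rewrite scalerA mulVf // scale1r.
have := char_poly_trace N mu_gt0; rewrite sE -{1}size_s.
rewrite coefPn_prod_XsubC ?size_s -?lt0n // => /eqP; rewrite eqr_opp => /eqP.
have -> : \tr N = \sum_j v (cidx k j j) by apply: eq_bigr => j _; rewrite mxE.
move=> <-; rewrite (eq_big_seq (fun=> a)) => [|b /s_a //].
by rewrite big_const_seq count_predT size_s iter_addr_0.
Qed.

(** The point a is eliminated: its coordinates are traces divided by mu, hence polynomial in the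
    chart coordinates. So are then the coordinates of (X_k - a_k)^mu in the basis B, which have to
    vanish. *)
Lemma zclosed_punctual : zclosed punctual.
Proof.
move=> B oB; have muK : mu%:R != 0 :> K.
  by move/pcharf0P: charK0 => ->; rewrite -lt0n.
have /choice[N NP] : forall kl : 'I_n * nat, exists N : 'I_mu -> {mpoly K[coordn]},
    forall x v, chart_coord B x v ->
      x ('X_(kl.1) ^+ kl.2 - \sum_i (N i).@[v] *: monomials K B i).
  by move=> kl; apply: chart_poly_coords.
pose A k : {mpoly K[coordn]} := mu%:R^-1 *: \sum_j 'X_(cidx k j j).
pose P k i := \sum_(l < mu.+1) (- A k) ^+ l * N (k, mu - l)%N i *+ 'C(mu, l).
exists (fun p => exists k i, p = P k i) => x v xv.
have idx := hilb_is_ideal x; have qb := chart_coord_basis xv.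
pose a k := (A k).@[v].
have aE k : a k = mu%:R^-1 * \sum_j v (cidx k j j).
  by rewrite /a mevalZ meval_sum; congr (_ * _); apply: eq_bigr => j _; rewrite mevalXU.
have Pcoord k : x (('X_k - (a k)%:MP) ^+ mu - \sum_i (P k i).@[v] *: monomials K B i).
  rewrite exprDn.
  have -> : \sum_i (P k i).@[v] *: monomials K B i = \sum_(l < mu.+1)
      ((- a k) ^+ l)%:MP * (\sum_i (N (k, mu - l)%N i).@[v] *: monomials K B i) *+ 'C(mu, l).
    transitivity (\sum_(l < mu.+1) \sum_i ((- a k) ^+ l * (N (k, mu - l)%N i).@[v]
        *+ 'C(mu, l)) *: monomials K B i).
      rewrite exchange_big /=; apply: eq_bigr => i _; rewrite meval_sum scaler_suml.
      by apply: eq_bigr => l _; rewrite mevalMn mevalM meval_exp mevalN.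
    apply: eq_bigr => l _; rewrite mulr_sumr -sumrMnl; apply: eq_bigr => i _.
    by rewrite mul_mpolyC scalerA scalerMnl.
  rewrite -sumrB; apply: ideal_sum => // l _; rewrite -mulrnBl -mulr_natl.
  apply: idealMl => //; rewrite mulrC -mpolyCN -(rmorphXn (@mpolyC n K)) -mulrBr.
  by apply: idealMl => //; apply: (NP (k, mu - l)%N).
split=> [[b xb] _ [k [i ->]]|P0].
  have ab : b k = a k by rewrite aE (punctual_trace xv (xb k)) -[b k *+ mu]mulr_natl mulKf.
  apply: (quotient_basis_free idx qb (c := fun i => (P k i).@[v])).
  by apply: ideal_congr (ideal_sym idx (Pcoord k)) _ => //; rewrite -ab.
exists a => k; have := Pcoord k; rewrite big1 ?subr0 // => i _.
by rewrite P0 ?scale0r //; exists k, i.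
Qed.

End Punctual.

(** * Normal forms of the mod-distinguished ideals *)

Section Combinatorics.
Variables (h : seq nat) (n : nat).
Local Notation s := (socdeg h).
Implicit Types (m t u b : 'X_{1..n}) (j k : 'I_n).

(** The monomials of (m / x_k^e_k) sigma_k. The subtraction is truncated; when x_k^e_k does not
    divide m, [adm_short] makes the degree exceed s, and the term is deleted. *)
Definition multm m (q : 'I_n * 'X_{1..n < s.+1}) : 'X_{1..n} :=
  ((m - U_(q.1) *+ key_exp h q.1) + q.2)%MM.

(** The direction of the recursion for tau: the degree grows, or it stays the same and the monomial
    decreases. Finitely many monomials have degree at most s, so [prec_rank] can serve as fuel. *)
Definition prec m m' := (mdeg m' < mdeg m)%N || (mdeg m' == mdeg m) && (m < m')%O.

Definition prec_rank m : nat := #|[set m' : 'X_{1..n < s.+1} | prec m' m]|.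

Lemma prec_trans m1 m2 m3 : prec m1 m2 -> prec m2 m3 -> prec m1 m3.
Proof.
rewrite /prec => /orP[lt12|/andP[/eqP e12 lt12]] /orP[lt23|/andP[/eqP e23 lt23]].
- by rewrite (ltn_trans lt23 lt12).
- by rewrite e23 lt12.
- by rewrite -e12 lt23.
by rewrite e23 e12 eqxx (lt_trans lt12 lt23) orbT.
Qed.

Lemma prec_irr m : ~~ prec m m.
Proof. by rewrite /prec ltnn ltxx andbF. Qed.

Lemma prec_rank_lt m m' : (mdeg m <= s)%N -> prec m m' -> (prec_rank m < prec_rank m')%N.
Proof.
move=> le_ms pmm'; apply: proper_card; apply/properP; split.
  by apply/subsetP => b; rewrite !inE => /prec_trans; apply.
have lt_ms : (mdeg m < s.+1)%N by [].
by exists (BMultinom lt_ms); rewrite !inE //= (negPf (prec_irr m)).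
Qed.

Lemma in_O_deg m : in_O h m -> (mdeg m <= s)%N.
Proof.
rewrite /in_O /socdeg; case: (ltnP (mdeg m) (size h)) => [lt_ms _|le_sm].
  by rewrite -ltnS (leq_trans lt_ms) // leqSpred.
by rewrite nth_default.
Qed.

Lemma is_lead_uniq m k k' : is_lead k m -> is_lead k' m -> k = k'.
Proof.
move=> /andP[k0 /forallP kP] /andP[k'0 /forallP k'P]; apply/eqP; apply/contraT => ne.
have : val k != val k' by [].
rewrite neq_ltn => /orP[lt_kk'|lt_k'k].
  by have := implyP (k'P k) lt_kk'; rewrite eqn0Ngt k0.
by have := implyP (kP k') lt_k'k; rewrite eqn0Ngt k'0.
Qed.

Lemma is_lead_exists m : m != 0%MM -> exists k, is_lead k m.
Proof.
move=> m0; have [k mk] : exists k : 'I_n, (0 < m k)%N.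
  apply: contrapT => nok; case/eqP: m0; apply/mnmP => k; rewrite mnm0E.
  by apply/eqP; rewrite eqn0Ngt; apply/negP => mk; apply: nok; exists k.
have [k' mk' min] := @arg_minnP _ k (fun k => 0 < m k)%N val mk.
exists k'; rewrite /is_lead mk'; apply/forallP => j; apply/implyP => lt_jk.
by rewrite eqn0Ngt; apply/negP => /min; rewrite leqNgt lt_jk.
Qed.

Lemma is_leadP k m : reflect ((0 < m k)%N /\ forall j, (j < k)%N -> m j = 0%N) (is_lead k m).
Proof.
apply: (iffP andP) => [[mk /forallP mP]|[mk mP]]; split=> //.
  by move=> j lt_jk; apply/eqP; apply: (implyP (mP j)).
by apply/forallP => j; apply/implyP => /mP ->.
Qed.

Lemma in_LM_notin_O m : in_LM h m -> ~~ in_O h m.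
Proof. by case/and3P=> /andP[]. Qed.

Lemma in_LM_add j m : ~~ in_O h m -> ~~ in_LM h (U_(j) + m)%MM.
Proof.
move=> nOm; apply/negP => /and3P[_ _ /forallP/(_ j)].
rewrite mnmDE mnm1E eqxx add1n /= addmC addmK; exact/negP.
Qed.

(** The combinatorial facts on which the construction rests; for each Hilbert function
they are checked by computation. *)
Record admissible mu (B : mu.-tuple 'X_{1..n}) := Admissible {
  adm_order : order_ideal B;
  adm_mem : forall m, (m \in B) = in_O h m;
  adm_mono : forall m m', mdeg m = mdeg m' -> (m' <= m)%O -> in_O h m -> in_O h m';
  adm_key : forall k, is_key h k -> in_LM h (key_mon h k) /\ is_lead k (key_mon h k);
  adm_short : forall m k u, ~~ in_O h m -> (mdeg m <= s)%N -> is_lead k m ->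
    (m k < key_exp h k)%N -> in_T h k u -> (s < mdeg (m - U_(k) *+ key_exp h k + u)%MM)%N;
  adm_cross : forall m k j t, ~~ in_O h m -> (mdeg m < s)%N -> is_lead k m -> (j < k)%N ->
    in_O h t -> (mdeg m <= mdeg t < s)%N ->
    [/\ forall i : 'I_n, (i <= j)%N -> t i = 0%N, ~~ in_O h (U_(j) + t)%MM
      & ~~ in_LM h (U_(j) + t)%MM];
  adm_lower : forall k u, is_key h k -> key_exp h k = 1%N -> in_T h k u ->
    forall i : 'I_n, (i <= k)%N -> u i = 0%N
}.

Section Recursion.
Variables (R : comNzRingType) (C : Cidx h n -> R) (th : Thidx h n -> R).

(** At most one index contributes; the sum supplies the value 0 for pairs that are not indices. *)
Definition Ccoef t m : R :=
  \sum_(p : Cidx h n | (bmnm (val p).2 == m) && (bmnm (val p).1 == t)) C p.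

(** The coefficient of [t] in the normal form of [m], for enough fuel [f]. *)
Fixpoint nf_rec f m t : R :=
  if f is f'.+1 then
    if in_O h m then (m == t)%:R
    else if (s < mdeg m)%N then 0
    else if in_LM h m && in_TM h t then Ccoef t m
    else - \sum_(q : Thidx h n | is_lead (val q).1 m && (mdeg (multm m (val q)) <= s)%N)
             th q * nf_rec f' (multm m (val q)) t
  else 0.

Definition nf_coef m t : R := nf_rec (prec_rank m).+1 m t.

End Recursion.

(** The reason for a recursion over arbitrary commutative rings: it is run with indeterminates as
    parameters and then evaluated, so coefficients of normal forms are polynomial in the
    parameters. *)
Lemma nf_rec_morph (R R' : comNzRingType) (g : {rmorphism R -> R'}) C th f m t :
  g (nf_rec C th f m t) = nf_rec (g \o C) (g \o th) f m t.
Proof.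
elim: f m t => [|f IHf] m t /=; first exact: rmorph0.
case: ifP => _; first exact: rmorph_nat.
case: ifP => _; first exact: rmorph0.
case: ifP => _; first by rewrite /Ccoef rmorph_sum.
rewrite rmorphN rmorph_sum; congr (- _); apply: eq_bigr => q _.
by rewrite rmorphM IHf.
Qed.

Lemma nf_coef_morph (R R' : comNzRingType) (g : {rmorphism R -> R'}) C th m t :
  g (nf_coef C th m t) = nf_coef (g \o C) (g \o th) m t.
Proof. exact: nf_rec_morph. Qed.

End Combinatorics.

Lemma linear_extension_linear (K : fieldType) n (V : lmodType K) (g : 'X_{1..n} -> V) :
  linear (fun f : {mpoly K[n]} => \sum_(m <- msupp f) f@_m *: g m).
Proof.
have wide (f : {mpoly K[n]}) (r : seq 'X_{1..n}) : uniq r -> {subset msupp f <= r} ->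
    \sum_(m <- msupp f) f@_m *: g m = \sum_(m <- r) f@_m *: g m.
  move=> ur fr; rewrite [RHS](bigID (mem (msupp f))) /= [X in _ + X]big1 => [|m /memN_msupp_eq0 ->].
    rewrite addr0 -[RHS]big_filter.
    have pfr : perm_eq (msupp f) (filter (mem (msupp f)) r).
      apply: uniq_perm; rewrite ?filter_uniq ?msupp_uniq // => m.
      by rewrite mem_filter /=; case: (boolP (m \in msupp f)) => // /fr ->.
    exact: (perm_big _ pfr).
  by rewrite scale0r.
move=> a f f'; pose r := undup (msupp f ++ msupp f' ++ msupp (a *: f + f')).
have ur : uniq r by apply: undup_uniq.
rewrite !(wide _ r) //; try by move=> m mf; rewrite mem_undup !mem_cat mf ?orbT.
rewrite scaler_sumr -big_split; apply: eq_bigr => m _ /=.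
by rewrite mcoeffD mcoeffZ scalerDl scalerA.
Qed.

Section NormalForm.
Variables (h : seq nat) (n mu : nat) (B : mu.-tuple 'X_{1..n}).
Hypothesis admB : admissible h B.
Local Notation s := (socdeg h).
Implicit Types (m t u b : 'X_{1..n}) (j k : 'I_n).

Lemma in_O_down m m' : in_O h m -> (m' <= m)%MM -> in_O h m'.
Proof.
have [oB memB _ _ _ _ _] := admB; rewrite -!memB => mB le_m'm.
by have [_] := oB; apply; first exact: mB.
Qed.

Lemma notin_O_add j m : ~~ in_O h m -> ~~ in_O h (U_(j) + m)%MM.
Proof. by apply: contra => /in_O_down; apply; apply: lem_addl. Qed.

(** Termination of the recursion. The degree of u is at least e_k. In case of equality, u times
    [key_hat h k] is in O and has the degree of the key monomial, which is not in O; so it is the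
    smaller one by [adm_mono], whence u < x_k^e_k. *)
Lemma multm_spec m k (q : Thidx h n) : ~~ in_O h m -> (mdeg m <= s)%N -> is_lead k m ->
  (val q).1 = k -> (mdeg (multm m (val q)) <= s)%N ->
  (key_exp h k <= m k)%N /\ prec (multm m (val q)) m.
Proof.
move=> nOm le_ms lead_k qk; case: q qk => [[k' u] /= /andP[key_k Tu]] /= qk.
rewrite {k'}qk /= in key_k Tu *; rewrite /multm /= => le_mult.
have [oB memB mono keyP short _ _] := admB.
have le_e : (key_exp h k <= m k)%N.
  rewrite leqNgt; apply/negP => lt_e.
  by have := short m k u nOm le_ms lead_k lt_e Tu; rewrite ltnNge le_mult.
split=> //.
have leU : (U_(k) *+ key_exp h k <= m)%MM.
  apply/mnm_lepP => i; rewrite mulmnE mnm1E; case: eqP => [<-|_]; by rewrite ?mul1n.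
have [LMchi lead_chi] := keyP k key_k.
have chiE : key_mon h k = (U_(k) *+ key_exp h k + key_hat h k)%MM.
  rewrite /key_hat addmC submK //; apply/mnm_lepP => i; rewrite mulmnE mnm1E.
  by case: eqP => [<-|_]; rewrite ?mul1n.
have /and3P[Ou nTM le_chi] := Tu.
have degu : (key_exp h k <= mdeg u)%N.
  by move: le_chi; rewrite {1}chiE !mdegD mdegMn mdeg1 mul1n leq_add2r.
rewrite -[X in prec _ X](submK leU) /prec !mdegD mdegMn mdeg1 mul1n ltn_add2l eqn_add2l.
case: ltngtP degu => //= equ _.
have lt_chi : ((u + key_hat h k)%MM < key_mon h k)%O.
  rewrite ltNge; apply/negP => le_t; have := in_LM_notin_O LMchi.
  rewrite (mono _ _ _ le_t) // chiE !mdegD mdegMn mdeg1 mul1n equ //.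
move: lt_chi; rewrite chiE ltmc_add2l => lt_u; by rewrite ltmc_add2r.
Qed.

Section Equations.
Variables (R : comNzRingType) (C : Cidx h n -> R) (th : Thidx h n -> R).
Local Notation L := (nf_coef C th).

Lemma nf_rec_fuel f f' m t : (mdeg m <= s)%N ->
  (prec_rank h m < f)%N -> (prec_rank h m < f')%N ->
  nf_rec C th f m t = nf_rec C th f' m t.
Proof.
elim: f f' m t => // f IHf [//|f'] m t le_ms lt_f lt_f' /=.
case: ifP => // nOm; case: ifP => // _; case: ifP => // _.
congr (- _); apply: eq_bigr => q /andP[lead_q le_mult]; congr (_ * _).
have [_ pm] := multm_spec (negbT nOm) le_ms lead_q erefl le_mult.
have lt_rank := prec_rank_lt le_mult pm.
by apply: IHf => //; apply: leq_trans lt_rank _.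
Qed.

Lemma nf_coefE m t : (mdeg m <= s)%N -> ~~ in_O h m -> ~~ (in_LM h m && in_TM h t) ->
  L m t = - \sum_(q : Thidx h n | is_lead (val q).1 m && (mdeg (multm m (val q)) <= s)%N)
             th q * L (multm m (val q)) t.
Proof.
move=> le_ms nOm nLT; rewrite {1}/nf_coef /= (negPf nOm) ltnNge le_ms /= (negPf nLT).
congr (- _); apply: eq_bigr => q /andP[lead_q le_mult]; congr (_ * _).
have [_ pm] := multm_spec nOm le_ms lead_q erefl le_mult.
by apply: nf_rec_fuel => //; apply: prec_rank_lt.
Qed.

Lemma nf_coefO m t : in_O h m -> L m t = (m == t)%:R.
Proof. by move=> Om; rewrite /nf_coef /= Om. Qed.

Lemma nf_coef_high m t : (s < mdeg m)%N -> L m t = 0.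
Proof.
move=> lt_sm; rewrite /nf_coef /= lt_sm; case: ifP => // /in_O_deg.
by rewrite leqNgt lt_sm.
Qed.

Lemma nf_coef_LM m t : in_LM h m -> in_TM h t -> L m t = Ccoef C t m.
Proof.
move=> LMm TMt; rewrite /nf_coef /= (negPf (in_LM_notin_O LMm)) LMm TMt.
by case/and3P: LMm => _ le_ms _; rewrite ltnNge le_ms.
Qed.

Lemma prec_ind (P : 'X_{1..n} -> Prop) :
  (forall m, (s < mdeg m)%N -> P m) ->
  (forall m, (mdeg m <= s)%N -> (forall m', prec m' m -> P m') -> P m) -> forall m, P m.
Proof.
move=> Phigh Pstep m; have [le_ms|/Phigh //] := leqP (mdeg m) s.
move: {2}(prec_rank h m).+1 (ltnSn (prec_rank h m)) => f.
elim: f m le_ms => // f IHf m le_ms lt_f; apply: Pstep => // m' pm'.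
have [le_m's|/Phigh //] := leqP (mdeg m') s.
by apply: IHf => //; apply: leq_trans (prec_rank_lt le_m's pm') _.
Qed.

Lemma nf_coef_supp m t : ~~ in_O h t -> L m t = 0.
Proof.
move=> nOt; elim/prec_ind: m => m; first exact: nf_coef_high.
move=> le_ms IHm; have [Om|nOm] := boolP (in_O h m).
  by rewrite nf_coefO //; case: eqP => // mt; rewrite -mt Om in nOt.
rewrite nf_coefE // ?big1 ?oppr0 //.
  move=> q /andP[lead_q le_mult]; rewrite IHm ?mulr0 //.
  by have [] := multm_spec nOm le_ms lead_q erefl le_mult.
by rewrite /in_TM (negPf nOt) /= andbF.
Qed.

Lemma nf_coef_deg m t : (mdeg t < mdeg m)%N -> L m t = 0.
Proof.
elim/prec_ind: m => m; first by move=> lt_sm _; apply: nf_coef_high.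
move=> le_ms IHm lt_tm; have [Om|nOm] := boolP (in_O h m).
  by rewrite nf_coefO //; case: eqP => // mt; rewrite mt ltnn in lt_tm.
rewrite nf_coefE // ?big1 ?oppr0 //.
  move=> q /andP[lead_q le_mult].
  have [_ pm] := multm_spec nOm le_ms lead_q erefl le_mult.
  rewrite IHm ?mulr0 //; apply: leq_trans lt_tm _.
  by case/orP: pm => [/ltnW //|/andP[/eqP -> _]].
apply/negP => /andP[_ /andP[_ /eqP degt]]; move: lt_tm.
by rewrite degt ltnNge le_ms.
Qed.
End Equations.
End NormalForm.

(** * The kernel of the normal form is an ideal *)

Section NormalFormIdeal.
Variables (h : seq nat) (n mu : nat) (B : mu.-tuple 'X_{1..n}).
Hypothesis admB : admissible h B.
Hypothesis mu_gt0 : (0 < mu)%N.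
Local Notation s := (socdeg h).
Implicit Types (m t u b : 'X_{1..n}) (j k : 'I_n).
Variables (K : fieldType) (C : Cidx h n -> K) (th : Thidx h n -> K).
Local Notation L := (nf_coef C th).

Definition nf_mono m : {mpoly K[n]} := \sum_i L m (tnth B i) *: monomials K B i.

Definition nf (f : {mpoly K[n]}) : {mpoly K[n]} := \sum_(m <- msupp f) f@_m *: nf_mono m.

Lemma in_OP t : reflect (exists i, t = tnth B i) (in_O h t).
Proof. by rewrite -(adm_mem admB); apply: tnthP. Qed.

Lemma tnth_in_O i : in_O h (tnth B i).
Proof. by apply/in_OP; exists i. Qed.

Lemma sum_nf_mono_supp (f : {mpoly K[n]}) : (forall t, t \in msupp f -> in_O h t) ->
  f = \sum_i f@_(tnth B i) *: monomials K B i.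
Proof.
move=> fO; have [[uB _] memB _ _ _ _ _] := admB.
rewrite {1}(mpoly_sum_seq uB (g := f)) => [|m /fO]; last by rewrite memB.
by rewrite big_tuple.
Qed.

Lemma monomials_coef (c : 'I_mu -> K) i :
  (\sum_j c j *: monomials K B j)@_(tnth B i) = c i.
Proof.
have [[uB _] _ _ _ _ _ _] := admB.
rewrite mcoeff_sum (bigD1 i) //= mcoeffZ mcoeffX eqxx mulr1 big1 ?addr0 // => j ne.
rewrite mcoeffZ mcoeffX; case: eqP => [eqB|_]; last by rewrite mulr0.
by case/eqP: ne; move/tuple_uniqP: uB; apply.
Qed.

Lemma monomials_coef_notin (c : 'I_mu -> K) t : ~~ in_O h t ->
  (\sum_j c j *: monomials K B j)@_t = 0.
Proof.
move=> nOt; rewrite mcoeff_sum big1 // => j _; rewrite mcoeffZ mcoeffX.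
by case: eqP => [jt|_]; [rewrite -jt tnth_in_O in nOt | rewrite mulr0].
Qed.

Lemma nf_mono_coef m t : (nf_mono m)@_t = L m t.
Proof.
have [/in_OP[i ->]|nOt] := boolP (in_O h t); first exact: (monomials_coef _ i).
by rewrite (nf_coef_supp admB _ _ _ nOt); apply: monomials_coef_notin.
Qed.

Lemma nf_supp f t : ~~ in_O h t -> (nf f)@_t = 0.
Proof.
move=> nOt; rewrite mcoeff_sum big1 // => m _.
by rewrite mcoeffZ nf_mono_coef (nf_coef_supp admB) ?mulr0.
Qed.

Lemma nf_linear : linear nf. Proof. exact: linear_extension_linear. Qed.

Lemma nf0 : nf 0 = 0. Proof. by rewrite /nf msupp0 big_nil. Qed.
Lemma nfD f g : nf (f + g) = nf f + nf g.
Proof. by have := nf_linear 1 f g; rewrite !scale1r. Qed.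
Lemma nfZ c f : nf (c *: f) = c *: nf f.
Proof. by have := nf_linear c f 0; rewrite nf0 !addr0. Qed.
Lemma nfB f g : nf (f - g) = nf f - nf g.
Proof. by rewrite nfD -scaleN1r nfZ scaleN1r. Qed.
Lemma nf_sum (T : Type) (r : seq T) (P : pred T) F :
  nf (\sum_(i <- r | P i) F i) = \sum_(i <- r | P i) nf (F i).
Proof. by apply: (big_morph nf); [exact: nfD | exact: nf0]. Qed.

Lemma nfX m : nf 'X_[m] = nf_mono m.
Proof. by rewrite /nf msuppX big_seq1 mcoeffX eqxx scale1r. Qed.

Lemma nf_monoO m : in_O h m -> nf_mono m = 'X_[m].
Proof.
by move=> Om; apply/mpolyP => t; rewrite nf_mono_coef nf_coefO // mcoeffX.
Qed.

Lemma nf_id f : (forall t, ~~ in_O h t -> f@_t = 0) -> nf f = f.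
Proof.
move=> fO; rewrite {2}[f]mpolyE /nf big_seq [RHS]big_seq.
apply: eq_bigr => m mf; rewrite nf_monoO //; apply: contraLR mf => /fO fm.
by rewrite mcoeff_msupp fm eqxx.
Qed.

Lemma nf_nf f : nf (nf f) = nf f.
Proof. by apply: nf_id => t; apply: nf_supp. Qed.

Lemma nf_nf_mono m : nf (nf_mono m) = nf_mono m.
Proof. by rewrite -nfX nf_nf. Qed.

Lemma nf_mul_sum u m : nf ('X_[u] * nf_mono m)
  = \sum_i L m (tnth B i) *: nf_mono (u + tnth B i)%MM.
Proof.
rewrite /nf_mono mulr_sumr nf_sum; apply: eq_bigr => i _.
by rewrite -scalerAr nfZ /monomials -mpolyXD nfX.
Qed.

Lemma nf_mono_high m : (s < mdeg m)%N -> nf_mono m = 0.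
Proof.
by move=> lt_sm; apply/mpolyP => t; rewrite nf_mono_coef nf_coef_high ?mcoeff0.
Qed.

(** [g] is the part prescribed by the parameters C. It is homogeneous of degree s, so its product
    with any variable has normal form 0 ([nf_TM]). *)
Lemma nf_mono_rec m : ~~ in_O h m -> (mdeg m <= s)%N ->
  exists2 g, nf_mono m = g - \sum_(q : Thidx h n | is_lead (val q).1 m
        && (mdeg (multm m (val q)) <= s)%N) th q *: nf_mono (multm m (val q))
    & forall t, g@_t != 0 -> in_LM h m && in_TM h t.
Proof.
move=> nOm le_ms; set S := \sum_(q | _) _.
have SE t : S@_t = \sum_(q : Thidx h n | is_lead (val q).1 m
        && (mdeg (multm m (val q)) <= s)%N) th q * L (multm m (val q)) t.
  by rewrite mcoeff_sum; apply: eq_bigr => q _; rewrite mcoeffZ nf_mono_coef.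
exists (nf_mono m + S) => [|t]; first by rewrite addrK.
rewrite mcoeffD nf_mono_coef SE; apply: contraNT => nLT.
by rewrite (nf_coefE admB) // addNr.
Qed.

Lemma nf_mono_nonLM m : ~~ in_O h m -> ~~ in_LM h m -> (mdeg m <= s)%N ->
  nf_mono m = - \sum_(q : Thidx h n | is_lead (val q).1 m
        && (mdeg (multm m (val q)) <= s)%N) th q *: nf_mono (multm m (val q)).
Proof.
move=> nOm nLM le_ms; have [g -> gT] := nf_mono_rec nOm le_ms.
rewrite (_ : g = 0) ?sub0r //; apply/mpolyP => t; rewrite mcoeff0.
by apply/eqP/contraT => /gT; rewrite (negPf nLM).
Qed.

Lemma nf_TM j g : (forall t, g@_t != 0 -> in_TM h t) -> nf ('X_j * g) = 0.
Proof.
move=> gT; rewrite {1}[g]mpolyE mulr_sumr nf_sum big_seq big1 // => t.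
rewrite mcoeff_msupp => /gT/andP[_ /eqP degt].
by rewrite -scalerAr nfZ -mpolyXD nfX nf_mono_high ?scaler0 // mdegD mdeg1 degt.
Qed.

Lemma nf_mulX_high j m : (s <= mdeg m)%N -> ~~ in_O h m ->
  nf_mono (U_(j) + m)%MM = nf ('X_j * nf_mono m).
Proof.
move=> le_sm nOm; rewrite nf_mono_high ?mdegD ?mdeg1 // nf_mul_sum big1 // => i _.
have [lt_im|le_mi] := ltnP (mdeg (tnth B i)) (mdeg m).
  by rewrite (nf_coef_deg admB) // scale0r.
by rewrite nf_mono_high ?scaler0 // mdegD mdeg1 ltnS (leq_trans le_sm).
Qed.

(** For j >= k the variable x_k still leads x_j m, so both recursions have the same terms up to the
    factor x_j. A term of degree exactly s is deleted on the left, and on the right its multiple by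
    x_j has normal form 0. *)
Lemma multm_addl m k j (q : Thidx h n) : ~~ in_O h m -> (mdeg m < s)%N ->
  is_lead k m -> (k <= j)%N -> (val q).1 = k ->
  (if (mdeg (multm (U_(j) + m)%MM (val q)) <= s)%N
     then nf_mono (multm (U_(j) + m)%MM (val q)) else 0)
  = if (mdeg (multm m (val q)) <= s)%N then nf_mono (U_(j) + multm m (val q))%MM else 0.
Proof.
move=> nOm lt_ms lead_k le_kj; case: q => [[k' u] /= /andP[key_k Tu]] /= kk.
rewrite {k'}kk /= in key_k Tu *; rewrite /multm /=.
have [/andP[/eqP jk lt_e]|cond] := boolP ((j == k) && (m k < key_exp h k)%N).
  have := adm_short admB nOm (ltnW lt_ms) lead_k lt_e Tu.
  move=> lt_s; rewrite leqNgt ifN; last first.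
    rewrite negbK (leq_trans lt_s) // !mdegD leq_add2r !mdegE; apply: leq_sum => i _.
    by rewrite !mnmBE mnmDE leq_sub2r // leq_addl.
  by rewrite [in RHS]leqNgt lt_s.
have -> : (U_(j) + m - U_(k) *+ key_exp h k + u = U_(j) + (m - U_(k) *+ key_exp h k + u))%MM.
  rewrite addmA; congr (_ + _)%MM; apply/mnmP => i.
  rewrite mnmDE !mnmBE mnmDE mulmnE !mnm1E.
  move: cond; rewrite negb_and -leqNgt; case: (j =P k) => [-> /= le_e|ne _].
    by case: (k =P i) => [<-|]; rewrite ?mul1n ?mul0n ?subn0 // addnBA.
  case: (k =P i) => [ki|]; rewrite ?mul1n ?mul0n ?subn0 //.
  by case: eqP => [ji|]; rewrite ?add0n //; case: ne; rewrite ji.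
rewrite mdegD mdeg1 add1n; set d := mdeg _.
case: (ltngtP d s) => // ds.
by rewrite nf_mono_high // mdegD mdeg1 -/d ds.
Qed.

(* Multiplication of [m] by its leading variable or a smaller one commutes with the
recursion; a larger variable [x_j] acts as [- sigma_j], up to terms that vanish. *)
Theorem nf_mono_mulX m j : nf_mono (U_(j) + m)%MM = nf ('X_j * nf_mono m).
Proof.
elim/(prec_ind (h := h)): m j => [m lt_sm|m le_ms IHm] j.
  apply: nf_mulX_high; first exact: ltnW.
  by apply/negP => /in_O_deg; rewrite leqNgt lt_sm.
have [Om|nOm] := boolP (in_O h m).
  by rewrite (nf_monoO Om) -mpolyXD nfX.
have [lt_ms|le_sm] := ltnP (mdeg m) s; last exact: nf_mulX_high.
have O0 : in_O h (0%MM : 'X_{1..n}).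
  have [[_ down] memB _ _ _ _ _] := admB; rewrite -memB.
  apply: (down (tnth B (Ordinal mu_gt0))); first exact: mem_tnth.
  by apply/mnm_lepP => k; rewrite mnm0E.
have [k lead_k] : exists k, is_lead k m.
  by apply: is_lead_exists; apply: contraNneq nOm => ->.
have [mk0 mlow] := is_leadP _ _ lead_k.
have nOm' i : ~~ in_O h (U_(i) + m)%MM by apply: (notin_O_add admB).
have nLMm' i : ~~ in_LM h (U_(i) + m)%MM by apply: in_LM_add.
have le_m's i : (mdeg (U_(i) + m)%MM <= s)%N by rewrite mdegD mdeg1.
have IH1 m1 i : (mdeg m < mdeg m1)%N -> nf_mono (U_(i) + m1)%MM = nf ('X_i * nf_mono m1).
  by move=> lt_m; apply: IHm; rewrite /prec lt_m.
have lower (i : 'I_n) : (k <= i)%N -> nf_mono (U_(i) + m)%MM = nf ('X_i * nf_mono m).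
  move=> le_ki; rewrite nf_mono_nonLM //.
  have [g -> gT] := nf_mono_rec nOm le_ms.
  rewrite mulrBr nfB nf_TM => [|t /gT/andP[] //]; rewrite sub0r; congr (- _).
  have lead_k' : is_lead k (U_(i) + m)%MM.
    apply/is_leadP; rewrite mnmDE addn_gt0 mk0 orbT; split=> // l lt_lk.
    rewrite mnmDE mnm1E mlow // addn0; case: eqP => // il.
    by move: lt_lk; rewrite -il ltnNge le_ki.
  rewrite mulr_sumr nf_sum.
  transitivity (\sum_(q : Thidx h n | is_lead (val q).1 m) th q *:
      if (mdeg (multm (U_(i) + m)%MM (val q)) <= s)%N
      then nf_mono (multm (U_(i) + m)%MM (val q)) else 0).
    rewrite big_mkcondr /=; apply: eq_big => q.
      apply/idP/idP => lead_q; first by rewrite (is_lead_uniq lead_q lead_k').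
      by rewrite (is_lead_uniq lead_q lead_k).
    by move=> _; case: ifP; rewrite ?scaler0.
  rewrite [RHS]big_mkcondr /=; apply: eq_bigr => q lead_q.
  have qk := is_lead_uniq lead_q lead_k.
  rewrite (multm_addl nOm lt_ms lead_k le_ki qk); case: ifP => le_q; last exact: scaler0.
  have [_ pq] := multm_spec admB nOm le_ms lead_k qk le_q.
  by rewrite -scalerAr nfZ IHm.
have [/lower //|] := leqP k j.
(* Second induction, for x_j larger than the leading variable of m: the claim for m is known for
   every variable smaller than x_j. *)
elim/ltn_ind: {j}(n - j)%N {-2}j (erefl (n - j)%N) => d IHd j dE lt_jk.
have IHj (i : 'I_n) : (j < i)%N -> nf_mono (U_(i) + m)%MM = nf ('X_i * nf_mono m).
  move=> lt_ji; have [/lower //|lt_ik] := leqP k i.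
  by apply: (IHd (n - i)%N) => //; rewrite -dE ltn_sub2l.
have lead_of t : (forall i : 'I_n, (i <= j)%N -> t i = 0%N) -> is_lead j (U_(j) + t)%MM.
  move=> tlow; apply/is_leadP; rewrite mnmDE mnm1E eqxx; split=> // i lt_ij.
  rewrite mnmDE mnm1E tlow ?(ltnW lt_ij) //; case: eqP => // ji.
  by rewrite -ji ltnn in lt_ij.
have mlowj (i : 'I_n) : (i <= j)%N -> m i = 0%N by move=> le_ij; apply: mlow; apply: leq_ltn_trans lt_jk.
have lead_j := lead_of m mlowj.
have cross t := adm_cross admB (t := t) nOm lt_ms lead_k lt_jk.
(* What [adm_cross] gives for the monomials that x_j multiplies, namely m and the monomials of NF(m)
   of degree below s. *)
pose good t := [/\ forall i : 'I_n, (i <= j)%N -> t i = 0%N, ~~ in_O h (U_(j) + t)%MM,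
  ~~ in_LM h (U_(j) + t)%MM & (mdeg t < s)%N].
have good_m : good m by split.
have goodB i : (mdeg m <= mdeg (tnth B i) < s)%N -> good (tnth B i).
  move=> /[dup] /andP[_ lt_s] /(cross _ (tnth_in_O i))[low nO nLM]; by split.
(* x_j occurs in x_j t only once, so a surviving term of the recursion forces e_j = 1. Otherwise
   both sides of the claim vanish. *)
have exp1 t (q : Thidx h n) : good t -> (val q).1 = j ->
    (mdeg (multm (U_(j) + t)%MM (val q)) <= s)%N -> key_exp h j = 1%N.
  move=> [tlow nO _ lt_ts] qj le_q.
  have le_ts : (mdeg (U_(j) + t)%MM <= s)%N by rewrite mdegD mdeg1.
  have [le_e _] := multm_spec admB nO le_ts (lead_of t tlow) qj le_q.
  have /andP[key_j _] := valP q; rewrite qj in key_j.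
  have [_ /andP[e0 _]] := adm_key admB key_j.
  by apply/eqP; rewrite eqn_leq e0 (leq_trans le_e) // mnmDE mnm1E eqxx tlow.
have small i F : (forall t, good t -> F t = 0) ->
    (forall t, (s <= mdeg t)%N -> F t = 0) -> L m (tnth B i) *: F (tnth B i) = 0 :> {mpoly K[n]}.
  move=> F0 Fs; have [lt_im|le_mi] := ltnP (mdeg (tnth B i)) (mdeg m).
    by rewrite (nf_coef_deg admB) // scale0r.
  have [lt_is|/Fs ->] := ltnP (mdeg (tnth B i)) s; last exact: scaler0.
  by rewrite F0 ?scaler0 //; apply: goodB; rewrite le_mi.
have high t : (s <= mdeg t)%N -> nf_mono (U_(j) + t)%MM = 0.
  by move=> le_st; rewrite nf_mono_high // mdegD mdeg1.
have rec_j t : good t -> nf_mono (U_(j) + t)%MM = - \sum_(q : Thidx h n |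
      ((val q).1 == j) && (mdeg (multm (U_(j) + t)%MM (val q)) <= s)%N)
    th q *: nf_mono (multm (U_(j) + t)%MM (val q)).
  move=> [tlow nO nLM lt_ts]; rewrite nf_mono_nonLM ?mdegD ?mdeg1 //; congr (- _).
  apply: eq_bigl => q; congr (_ && _); apply/idP/eqP => [lead_q|->].
    exact: is_lead_uniq lead_q (lead_of t tlow).
  exact: lead_of.
rewrite nf_mul_sum; have [e1|ne1] := eqVneq (key_exp h j) 1%N; last first.
  have zero t : good t -> nf_mono (U_(j) + t)%MM = 0.
    move=> gt; rewrite rec_j // big1 ?oppr0 // => q /andP[/eqP qj le_q].
    by rewrite (exp1 t q) ?eqxx in ne1.
  by rewrite zero // big1 // => i _; apply: (small i (fun t => nf_mono (U_(j) + t)%MM)).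
have key_deg (q : Thidx h n) : (val q).1 = j -> (0 < mdeg (val q).2)%N.
  case: q => [[k' u] /= /andP[key_j /and3P[_ _ le_chi]]] /= qj.
  rewrite {k'}qj in key_j le_chi.
  have [_ /andP[e0 _]] := adm_key admB key_j; rewrite lt0n; apply/eqP => u0.
  have : (mdeg (key_hat h j) < mdeg (key_mon h j))%N.
    rewrite /key_hat e1 mulm1n -{2}(submK (m := U_(j)) (m' := key_mon h j)).
      by rewrite mdegD mdeg1 addn1.
    by rewrite lep1mP -lt0n.
  by move: le_chi; rewrite mdegD u0 add0n leqNgt => /negPf ->.
have shift_j t : good t \/ (s <= mdeg t)%N -> nf_mono (U_(j) + t)%MM
    = - \sum_(q : Thidx h n | (val q).1 == j) th q *: nf_mono ((val q).2 + t)%MM.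
  have multE (q : Thidx h n) : (val q).1 = j ->
      multm (U_(j) + t)%MM (val q) = ((val q).2 + t)%MM.
    by move=> qj; rewrite /multm qj e1 mulm1n (addmC U_(j)%MM t) addmK addmC.
  case=> [gt|le_st].
    rewrite (rec_j t gt).
    apply: congr1.
    rewrite [RHS](bigID (fun q : Thidx h n =>
      (mdeg (multm (U_(j) + t)%MM (val q)) <= s)%N)) /= [X in _ = _ + X]big1.
      rewrite addr0; apply: eq_bigr => q /andP[/eqP qj _].
      by rewrite (multE q qj).
    move=> q /andP[/eqP qj]; rewrite -ltnNge (multE q qj) => lt_s.
    by rewrite (nf_mono_high lt_s) scaler0.
  rewrite (high t le_st) big1 ?oppr0 // => q /eqP /key_deg u0.
  have lt_s : (s < mdeg ((val q).2 + t)%MM)%N.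
    rewrite mdegD; apply: leq_ltn_trans le_st _.
    by rewrite -[X in (X < _)%N]add0n ltn_add2r.
  by rewrite (nf_mono_high lt_s) scaler0.
rewrite shift_j; last by left.
transitivity (\sum_i L m (tnth B i) *: - \sum_(q : Thidx h n | (val q).1 == j)
    th q *: nf_mono ((val q).2 + tnth B i)%MM); last first.
  apply: eq_bigr => i _; have [lt_im|le_mi] := ltnP (mdeg (tnth B i)) (mdeg m).
    by rewrite (nf_coef_deg admB) // !scale0r.
  rewrite shift_j //; have [lt_is|] := ltnP (mdeg (tnth B i)) s; last by right.
  by left; apply: goodB; rewrite le_mi.
under [RHS]eq_bigr => i _ do rewrite scalerN scaler_sumr.
rewrite sumrN exchange_big /=; congr (- _); apply: eq_bigr => q /eqP qj.
under [RHS]eq_bigr => i _ do rewrite scalerA mulrC -scalerA.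
rewrite -scaler_sumr -nf_mul_sum; congr (_ *: _).
(* It remains to prove NF(u m) = NF(u NF(m)) for u in T_j. By [adm_lower] only variables smaller
   than x_j occur in u. The variable applied directly to m is handled by the second induction, the
   others by the first one, because u' m has larger degree than m. *)
have ulow : forall i : 'I_n, (i <= j)%N -> bmnm (val q).2 i = 0%N.
  have /andP[key_j Tu] := valP q; rewrite qj in key_j Tu.
  exact: (adm_lower admB key_j e1 Tu).
move: (bmnm (val q).2) ulow => u.
elim: {u}(mdeg u) {-2}u (erefl (mdeg u)) => [|du IHu] u du_eq ulow.
  have /eqP -> : u == 0%MM by rewrite -mdeg_eq0 du_eq.
  by rewrite add0m mpolyX0 mul1r nf_nf_mono.
have [i ui] : exists i : 'I_n, (0 < u i)%N.
  have [|i /andP[]] := @is_lead_exists n u; last by exists i.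
  by rewrite -mdeg_eq0 du_eq.
have lt_ji : (j < i)%N by rewrite ltnNge; apply/negP => /ulow ui0; rewrite ui0 in ui.
have uE : u = (U_(i) + (u - U_(i)))%MM by rewrite addmC submK // lep1mP -lt0n.
set u' := (u - U_(i))%MM in uE.
have du' : mdeg u' = du by move: du_eq; rewrite uE mdegD mdeg1 => -[].
have u'low (l : 'I_n) : (l <= j)%N -> u' l = 0%N by move=> le_lj; rewrite mnmBE ulow.
have IH := IHu u' du' u'low.
have [u'0|u'n0] := eqVneq u' 0%MM.
  by rewrite uE u'0 addm0 IHj // .
have gt_u t : (mdeg m <= mdeg t)%N -> (mdeg m < mdeg (u' + t)%MM)%N.
  move=> le_t; rewrite mdegD; apply: leq_ltn_trans le_t _.
  by rewrite -[X in (X < _)%N]add0n ltn_add2r lt0n mdeg_eq0.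
rewrite uE -addmA (IH1 _ _ (gt_u m (leqnn _))) IH nf_mul_sum mulr_sumr nf_sum nf_mul_sum.
apply: eq_bigr => l _; rewrite -scalerAr nfZ.
have [lt_lm|le_ml] := ltnP (mdeg (tnth B l)) (mdeg m).
  by rewrite (nf_coef_deg admB) // !scale0r.
by rewrite -addmA (IH1 _ _ (gt_u _ le_ml)).
Qed.

Lemma nf_mulX j f : nf ('X_j * f) = nf ('X_j * nf f).
Proof.
rewrite [nf f]/nf {1}[f]mpolyE !mulr_sumr !nf_sum; apply: eq_bigr => m _.
by rewrite -!scalerAr !nfZ -mpolyXD nfX nf_mono_mulX.
Qed.

Definition nf_ideal f : Prop := nf f = 0.

Lemma nf_ideal_is_ideal : is_ideal nf_ideal.
Proof.
split=> [|f g|f g]; rewrite /nf_ideal; first exact: nf0.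
  by move=> f0 g0; rewrite nfD f0 g0 addr0.
move=> g0; elim/mpoly_mulX_ind: f => [c|f f' IHf IHf'|i f IHf].
- by rewrite mul_mpolyC nfZ g0 scaler0.
- by rewrite mulrDl nfD IHf IHf' addr0.
by rewrite -mulrA nf_mulX IHf mulr0 nf0.
Qed.

Lemma nf_idealB f : nf_ideal (f - nf f).
Proof. by rewrite /nf_ideal nfB nf_nf subrr. Qed.

Lemma nf_border m : in_border h m -> (mdeg m <= s.+1)%N.
Proof.
case/andP=> _ /existsP[k /andP[mk /in_O_deg]].
by rewrite -{2}(submK (m := U_(k)) (m' := m)) ?lep1mP -?lt0n // mdegD mdeg1 addn1 ltnS.
Qed.

(* Every monomial outside O is a multiple of a border monomial. *)
Lemma ideal_gen_nf (G : {mpoly K[n]} -> Prop) :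
  (forall g, G g <-> exists2 b, in_border h b & g = 'X_[b] - nf_mono b) ->
  forall f, ideal_gen G f <-> nf_ideal f.
Proof.
move=> GP f; split=> [|f0 J idJ GJ].
  apply; first exact: nf_ideal_is_ideal.
  by move=> g /GP[b _ ->]; rewrite -nfX; apply: nf_idealB.
have JB b : in_border h b -> J ('X_[b] - nf_mono b) by move=> bB; apply/GJ/GP; exists b.
have Jm m : J ('X_[m] - nf_mono m).
  move: {2}(mdeg m).+1 (ltnSn (mdeg m)) => d; elim: d m => // d IHd m lt_d.
  have [Om|nOm] := boolP (in_O h m); first by rewrite nf_monoO ?subrr //; apply: ideal0.
  have [/JB //|] := boolP (in_border h m).
  rewrite /in_border nOm /= => /existsPn nobd.
  have [k lead_k] : exists k, is_lead k m.
    apply: is_lead_exists; apply: contraNneq nOm => ->.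
    have [[_ down] memB _ _ _ _ _] := admB; rewrite -memB.
    apply: (down (tnth B (Ordinal mu_gt0))); first exact: mem_tnth.
    by apply/mnm_lepP => k; rewrite mnm0E.
  have [mk0 _] := is_leadP _ _ lead_k.
  have nO' : ~~ in_O h (m - U_(k))%MM by have := nobd k; rewrite mk0.
  have mE : m = (U_(k) + (m - U_(k)))%MM by rewrite addmC submK // lep1mP -lt0n.
  set m' := (m - U_(k))%MM in nO' mE.
  have Jm' : J ('X_[m'] - nf_mono m').
    by apply: IHd; move: lt_d; rewrite mE mdegD mdeg1.
  rewrite mE mpolyXD nf_mono_mulX.
  apply: (@ideal_trans _ _ _ idJ ('X_k * nf_mono m')).
    by rewrite -mulrBr; apply: idealMl.
  rewrite nf_mul_sum {1}/nf_mono mulr_sumr -sumrB; apply: ideal_sum => // i _.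
  rewrite -scalerAr.
  rewrite -scalerBr.
  apply: (idealZ idJ).
  rewrite /monomials.
  rewrite -mpolyXD.
  have [Ot|nOt] := boolP (in_O h (U_(k) + tnth B i)%MM).
    by rewrite nf_monoO ?subrr //; apply: ideal0.
  apply: JB; rewrite /in_border nOt; apply/existsP; exists k.
  by rewrite mnmDE mnm1E eqxx addmC addmK tnth_in_O.
suff : J (f - nf f) by rewrite f0 subr0.
rewrite {1}[f]mpolyE /nf -sumrB; apply: ideal_sum => // m _.
by rewrite -scalerBr; apply: idealZ.
Qed.

End NormalFormIdeal.

(** * Distinguished and mod-distinguished ideals as kernels of normal forms *)

Section ModDistinguished.
Variables (h : seq nat) (n mu : nat) (B : mu.-tuple 'X_{1..n}).
Hypothesis admB : admissible h B.
Hypothesis mu_gt0 : (0 < mu)%N.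
Local Notation s := (socdeg h).
Implicit Types (m t u b : 'X_{1..n}) (j k : 'I_n).
Variables (K : fieldType).
Implicit Types (C : Cidx h n -> K) (th : Thidx h n -> K).

Lemma Ypoly_coef C m t : (Ypoly C m)@_t = - Ccoef C t m.
Proof.
rewrite /Ypoly mcoeffN mcoeff_sum /Ccoef big_mkcondr /=; apply: congr1.
apply: eq_bigr => p _; rewrite mcoeffZ mcoeffX.
by case: ifP => _; rewrite ?mulr1 ?mulr0.
Qed.

Lemma Ccoef_out C t m : ~~ (in_LM h m && in_TM h t) -> Ccoef C t m = 0.
Proof.
move=> nLT; rewrite /Ccoef big1 // => p /andP[/eqP pm /eqP pt].
by case/negP: nLT; have := valP p; rewrite pm pt andbC.
Qed.

Lemma Ccoef_fun (F : 'X_{1..n} -> 'X_{1..n} -> K) t m : in_LM h m -> in_TM h t ->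
  Ccoef (fun p : Cidx h n => F (val p).1 (val p).2) t m = F t m.
Proof.
move=> LMm TMt.
have lt_t : (mdeg t < s.+1)%N by case/andP: TMt => _ /eqP ->.
have lt_m : (mdeg m < s.+1)%N by case/and3P: LMm.
pose q : 'X_{1..n < s.+1} * 'X_{1..n < s.+1} := (BMultinom lt_t, BMultinom lt_m).
have qP : in_TM h q.1 && in_LM h q.2 by rewrite /= TMt LMm.
pose p : Cidx h n := Sub q qP.
rewrite /Ccoef (bigD1 p) /=; last by rewrite !eqxx.
rewrite big1 ?addr0 // => p' /andP[/andP[/eqP p'm /eqP p't] ne].
case/eqP: ne; suff: sval p' = q by move=> E; apply: val_inj; rewrite SubK -E.
move: p'm p't; case: (sval p') => t' m' /= p'm p't.
have -> : t' = q.1 by apply: val_inj; exact: p't.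
by have -> : m' = q.2 by apply: val_inj; exact: p'm.
Qed.

(** With theta = 0 every term of the recursion vanishes, so the normal form of a border monomial b
    is -Y(b). *)
Lemma distinguished_nf C (x : hilb K n mu) :
  distinguished C x <-> forall f, x f <-> nf_ideal B C (fun=> 0) f.
Proof.
have GE f : ideal_gen (distgen C) f <-> nf_ideal B C (fun=> 0) f.
  apply: (ideal_gen_nf admB mu_gt0) => g.
  have bE b : in_border h b -> 'X_[b] - nf_mono B C (fun=> 0) b = 'X_[b] + Ypoly C b.
    move=> bB; apply: congr1; apply/mpolyP => t.
    rewrite mcoeffN Ypoly_coef; apply: congr1.
    rewrite (nf_mono_coef admB); case/andP: (bB) => nOb _.
    have [/andP[LMb TMt]|nLT] := boolP (in_LM h b && in_TM h t).
      by rewrite nf_coef_LM.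
    rewrite Ccoef_out //; have := nf_border bB; rewrite leq_eqVlt => /orP[/eqP degb|].
      by rewrite nf_coef_high // degb.
    rewrite ltnS => le_bs; rewrite (nf_coefE admB) // big1 ?oppr0 // => q _.
    by rewrite mul0r.
  split=> [[b bB ->]|[b bB ->]]; exists b => //; first by rewrite bE.
  by rewrite bE.
split=> xP f; first exact: iff_trans (xP f) (GE f).
exact: iff_trans (xP f) (iff_sym (GE f)).
Qed.

(** Two parametrizations of one locus. For m in LM the normal form is -(Y(m) + tau(m)), where tau(m)
    may have terms in TM as well. [nf_coef] takes the full coefficients at TM as its parameters, so
    that they can be read off from a normal form; the change from the C of the definition is
    triangular and fixes theta. *)
Lemma mod_distinguished_nf (x : hilb K n mu) :
  mod_distinguished h x <-> exists C th, forall f, x f <-> nf_ideal B C th f.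
Proof.
split=> [[C [th [tau [tauP xP]]]]|[C [th xP]]].
  pose rep m : {mpoly K[n]} := if in_O h m then 'X_[m]
    else if (mdeg m <= s)%N then - (Ypoly C m + tau m) else 0.
  pose c (p : Cidx h n) := (rep (val p).2)@_(val p).1.
  exists c, th.
  have repE m : rep m = nf_mono B c th m.
    elim/(prec_ind (h := h)): m => m.
      move=> lt_sm; rewrite (nf_mono_high admB) // /rep leqNgt lt_sm /=.
      by case: ifP => // /in_O_deg; rewrite leqNgt lt_sm.
    move=> le_ms IHm; rewrite /rep; case: ifP => [Om|/negbT nOm].
      by rewrite (nf_monoO admB).
    rewrite le_ms; apply/mpolyP => t; rewrite (nf_mono_coef admB).
    have [/andP[LMm TMt]|nLT] := boolP (in_LM h m && in_TM h t).
      rewrite nf_coef_LM // (Ccoef_fun (fun t m => (rep m)@_t)) //.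
      by rewrite /rep (negPf nOm) le_ms.
    rewrite (nf_coefE admB) // mcoeffN mcoeffD Ypoly_coef Ccoef_out // oppr0 add0r.
    apply: congr1; have Nm : in_N h m by rewrite /in_N nOm leqW.
    have [k lead_k] : exists k, is_lead k m.
      apply: is_lead_exists; apply: contraNneq nOm => ->.
      have [[_ down] memB _ _ _ _ _] := admB; rewrite -memB.
      apply: (down (tnth B (Ordinal mu_gt0))); first exact: mem_tnth.
      by apply/mnm_lepP => k; rewrite mnm0E.
    have [_ /(_ k le_ms lead_k) ->] := tauP m Nm.
    rewrite mcoeff_sum; apply: eq_big => [q|q /andP[/eqP qk le_q]].
      rewrite /multm; apply/andP/andP => [[/eqP qk le_q]|[lead_q le_q]].
        by rewrite qk.
      by have qk := is_lead_uniq lead_q lead_k; rewrite -qk eqxx.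
    rewrite mcoeffZ -(nf_mono_coef admB).
    have le_q' : (mdeg (multm m (val q)) <= s)%N by rewrite /multm qk.
    have [_ pq] := multm_spec admB nOm le_ms lead_k qk le_q'.
    rewrite -(IHm _ pq) /rep le_q' /multm qk //.
  have GE f : ideal_gen (modgen C tau) f <-> nf_ideal B c th f.
    apply: (ideal_gen_nf admB mu_gt0) => g.
    have bE b : in_border h b -> 'X_[b] + Ypoly C b + tau b = 'X_[b] - nf_mono B c th b.
      move=> bB; have /andP[nOb _] := bB; rewrite -addrA; apply: congr1.
      rewrite -repE /rep (negPf nOb).
      have le_b := nf_border bB; case: ifP => [_|/negbT]; first by rewrite opprK.
      rewrite -ltnNge => lt_sb; rewrite oppr0.
      have degb : mdeg b = s.+1 by apply/eqP; rewrite eqn_leq le_b.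
      have Nb : in_N h b by rewrite /in_N nOb le_b.
      have [/(_ degb) -> _] := tauP b Nb.
      rewrite addr0; apply/mpolyP => t; rewrite Ypoly_coef mcoeff0 Ccoef_out ?oppr0 //.
      by apply/negP => /andP[/and3P[_ + _] _]; rewrite leqNgt lt_sb.
    by split=> [[b bB ->]|[b bB ->]]; exists b => //; rewrite bE.
  by move=> f; apply: iff_trans (xP f) (GE f).
(* The TM coefficients of tau are added back to recover the C of the definition. *)
pose F t m := Ccoef C t m + \sum_(q : Thidx h n | is_lead (val q).1 m
   && (mdeg (multm m (val q)) <= s)%N) th q * nf_coef C th (multm m (val q)) t.
pose c (p : Cidx h n) := F (val p).1 (val p).2.
pose tau m : {mpoly K[n]} := if in_O h m then 0 else - nf_mono B C th m - Ypoly c m.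
have tau_b b : ~~ in_O h b -> 'X_[b] + Ypoly c b + tau b = 'X_[b] - nf_mono B C th b.
  by move=> nOb; rewrite /tau (negPf nOb); ring.
exists c, th, tau; split.
  move=> m /andP[nOm le_m]; split=> [degm|k le_ms lead_k mult repl].
    rewrite /tau (negPf nOm) (nf_mono_high admB) ?degm // oppr0 add0r.
    apply/mpolyP => t; rewrite mcoeffN Ypoly_coef mcoeff0 opprK Ccoef_out //.
    by apply/negP => /andP[/and3P[_ + _] _]; rewrite degm ltnn.
  have replE m' : repl m' = nf_mono B C th m'.
    rewrite /repl; case: ifP => [Om'|/negbT nOm']; first by rewrite (nf_monoO admB).
    by rewrite /tau (negPf nOm') [Ypoly c m' + _]addrC subrK opprK.
  rewrite /tau (negPf nOm); apply/mpolyP => t.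
  rewrite mcoeffB mcoeffN Ypoly_coef opprK (nf_mono_coef admB) mcoeff_sum.
  have sumE : \sum_(q : Thidx h n | ((val q).1 == k) && (mdeg (mult q) <= s)%N)
        (th q *: repl (mult q))@_t
      = \sum_(q : Thidx h n | is_lead (val q).1 m && (mdeg (multm m (val q)) <= s)%N)
        th q * nf_coef C th (multm m (val q)) t.
    apply: eq_big => [q|q /andP[/eqP qk _]].
      rewrite /mult /multm; apply/andP/andP => [[/eqP qk le_q]|[lead_q le_q]].
        by rewrite qk.
      by have qk := is_lead_uniq lead_q lead_k; rewrite -qk eqxx.
    by rewrite mcoeffZ replE (nf_mono_coef admB) /mult /multm qk.
  rewrite sumE; have [/andP[LMm TMt]|nLT] := boolP (in_LM h m && in_TM h t).
    by rewrite nf_coef_LM // (Ccoef_fun F) // /F addKr.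
  by rewrite Ccoef_out // addr0 (nf_coefE admB) // opprK.
have GE f : ideal_gen (modgen c tau) f <-> nf_ideal B C th f.
  apply: (ideal_gen_nf admB mu_gt0) => g.
  split=> [[b bB ->]|[b bB ->]]; exists b => //; have /andP[nOb _] := bB.
    exact: tau_b.
  by rewrite tau_b.
by move=> f; apply: iff_trans (xP f) (iff_sym (GE f)).
Qed.

End ModDistinguished.

(** * Polynomial families of polynomials *)

Section PolynomialFamilies.
Variables (K : fieldType) (n r : nat).
Implicit Types (G H : ('I_r -> K) -> {mpoly K[n]}) (c : ('I_r -> K) -> K).

Definition polyfun c := exists p : {mpoly K[r]}, forall u, c u = p.@[u].

Definition polyfam G := exists Gp : {mpoly {mpoly K[r]}[n]},
  forall u, G u = map_mpoly (meval u) Gp.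

Lemma polyfun_coef G t : polyfam G -> polyfun (fun u => (G u)@_t).
Proof. by case=> Gp GE; exists Gp@_t => u; rewrite GE mcoeff_map_mpoly. Qed.

Lemma polyfun_coord i : polyfun (fun u => u i).
Proof. by exists 'X_i => u; rewrite mevalXU. Qed.

Lemma polyfun_opp c : polyfun c -> polyfun (fun u => - c u).
Proof. by case=> p cp; exists (- p) => u; rewrite mevalN cp. Qed.

Lemma polyfamX m : polyfam (fun=> 'X_[m]).
Proof. by exists 'X_[m] => u; rewrite map_mpolyX. Qed.

Lemma polyfamC c : polyfun c -> polyfam (fun u => (c u)%:MP).
Proof. by case=> p cp; exists p%:MP => u; rewrite map_mpolyC cp. Qed.

Lemma polyfamD G H : polyfam G -> polyfam H -> polyfam (fun u => G u + H u).
Proof. by case=> Gp GE [Hp HE]; exists (Gp + Hp) => u; rewrite rmorphD GE HE. Qed.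

Lemma polyfamM G H : polyfam G -> polyfam H -> polyfam (fun u => G u * H u).
Proof. by case=> Gp GE [Hp HE]; exists (Gp * Hp) => u; rewrite rmorphM GE HE. Qed.

Lemma polyfamZ c G : polyfun c -> polyfam G -> polyfam (fun u => c u *: G u).
Proof.
move=> cp Gp; have := polyfamM (polyfamC cp) Gp; case=> P PE; exists P => u.
by rewrite -PE mul_mpolyC.
Qed.

Lemma polyfamExp G k : polyfam G -> polyfam (fun u => G u ^+ k).
Proof. by case=> Gp GE; exists (Gp ^+ k) => u; rewrite rmorphXn GE. Qed.

Lemma polyfam_ext G H : (forall u, G u = H u) -> polyfam H -> polyfam G.
Proof. by move=> GH [P PE]; exists P => u; rewrite GH. Qed.

Lemma polyfam_sum (I : Type) (s : seq I) (F : I -> ('I_r -> K) -> {mpoly K[n]}) :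
  (forall i, polyfam (F i)) -> polyfam (fun u => \sum_(i <- s) F i u).
Proof.
move=> Fp; elim: s => [|i s IHs].
  by exists 0 => u; rewrite big_nil raddf0.
apply: (polyfam_ext (H := fun u => F i u + \sum_(i <- s) F i u)).
  by move=> u; rewrite big_cons.
exact: polyfamD.
Qed.

Lemma polyfam_prod (I : Type) (s : seq I) (F : I -> ('I_r -> K) -> {mpoly K[n]}) :
  (forall i, polyfam (F i)) -> polyfam (fun u => \prod_(i <- s) F i u).
Proof.
move=> Fp; elim: s => [|i s IHs].
  by exists 1 => u; rewrite big_nil rmorph1.
apply: (polyfam_ext (H := fun u => F i u * \prod_(i <- s) F i u)).
  by move=> u; rewrite big_cons.
exact: polyfamM.
Qed.

Lemma linear_sum (V W : lmodType K) (T : V -> W) : linear T ->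
  forall (I : Type) (s : seq I) (c : I -> K) (F : I -> V),
  T (\sum_(i <- s) c i *: F i) = \sum_(i <- s) c i *: T (F i).
Proof.
move=> linT I s c F; elim: s => [|i s IHs].
  have := linT (-1) 0 0; rewrite scaler0 addr0 !big_nil.
  by rewrite scaleN1r addNr.
by rewrite !big_cons linT IHs.
Qed.

(** The members of a polynomial family have their supports in one finite set, so it suffices to know
    the images of single monomials. *)
Lemma polyfam_linear (T : ('I_r -> K) -> {mpoly K[n]} -> {mpoly K[n]}) G :
  (forall u, linear (T u)) -> (forall m, polyfam (fun u => T u 'X_[m])) ->
  polyfam G -> polyfam (fun u => T u (G u)).
Proof.
move=> linT TX [Gp GE].
apply: (polyfam_ext (H := fun u => \sum_(m <- msupp Gp) (Gp@_m).@[u] *: T u 'X_[m])).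
  move=> u; rewrite -(linear_sum (linT u)); congr (T u _).
  rewrite GE {1}[Gp]mpolyE raddf_sum; apply: eq_bigr => m _.
  by rewrite /= map_mpolyZ map_mpolyX.
refine (@polyfam_sum _ (msupp Gp) (fun m u => (Gp@_m).@[u] *: T u 'X_[m]) _) => m.
by apply: polyfamZ => //; exists Gp@_m.
Qed.

End PolynomialFamilies.

(** * Translations *)

Section Shift.
Variables (K : fieldType) (n : nat).

Definition shift (a : 'I_n -> K) (f : {mpoly K[n]}) : {mpoly K[n]} :=
  f \mPo [tuple 'X_i + (a i)%:MP | i < n].

Lemma shiftX a i : shift a 'X_i = 'X_i + (a i)%:MP.
Proof. by rewrite /shift comp_mpolyXU -tnth_nth tnth_mktuple. Qed.

Lemma shift_linear a : linear (shift a).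
Proof. by move=> c f g; rewrite /shift comp_mpolyD comp_mpolyZ. Qed.

Lemma shiftD a f g : shift a (f + g) = shift a f + shift a g.
Proof. exact: comp_mpolyD. Qed.

Lemma shiftB a f g : shift a (f - g) = shift a f - shift a g.
Proof. exact: comp_mpolyB. Qed.

Lemma shiftM a f g : shift a (f * g) = shift a f * shift a g.
Proof. exact: rmorphM. Qed.

Lemma shiftK a : cancel (shift a) (shift (fun i => - a i)).
Proof.
move=> f; elim/mpoly_ring_ind: f => [c|i|f g IHf IHg|f g IHf IHg].
- by rewrite /shift !comp_mpolyC.
- rewrite shiftX /shift comp_mpolyD comp_mpolyC comp_mpolyXU -tnth_nth tnth_mktuple.
  by rewrite mpolyCN subrK.
- by rewrite !shiftD IHf IHg.
by rewrite !shiftM IHf IHg.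
Qed.

Lemma shiftNK a : cancel (shift (fun i => - a i)) (shift a).
Proof.
move=> f; rewrite -{2}(shiftK (fun i => - a i) f); congr (shift _ _).
by apply/funext => i; rewrite opprK.
Qed.

(** A translation sends a monomial to a combination of its divisors and hence preserves the span of
    O. For this reason all translates stay in the chart of O. *)
Lemma shift_mono_supp a m t : (shift a 'X_[m])@_t != 0 -> (t <= m)%MM.
Proof.
elim: {m}(mdeg m) {-2}m (erefl (mdeg m)) t => [|d IHd] m dm t.
  have /eqP -> : m == 0%MM by rewrite -mdeg_eq0 dm.
  rewrite mpolyX0 /shift comp_mpoly1 mcoeff1.
  by have [->|ne] := eqVneq t 0%MM; rewrite ?lepm_refl ?eqxx.
have [i mi] : exists i : 'I_n, (0 < m i)%N.
  have [|i /andP[]] := @is_lead_exists n m; last by exists i.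
  by rewrite -mdeg_eq0 dm.
have mE : m = (U_(i) + (m - U_(i)))%MM by rewrite addmC submK // lep1mP -lt0n.
set m' := (m - U_(i))%MM in mE.
have dm' : mdeg m' = d by move: dm; rewrite mE mdegD mdeg1 => -[].
rewrite mE mpolyXD shiftM shiftX mulrDl mcoeffD mul_mpolyC mcoeffZ => nz.
have [t0|] := eqVneq (shift a 'X_[m'])@_t 0; last first.
  by move/(IHd m' dm') => le_t; apply: lepm_trans le_t _; apply: lem_addl.
move: nz; rewrite t0 mulr0 addr0 mulrC -mcoeff_msupp (perm_mem (msuppMX _ _)).
case/mapP => k; rewrite mcoeff_msupp => /(IHd m' dm') le_k ->.
by apply/mnm_lepP => j; rewrite !mnmDE leq_add2l; apply/mnm_lepP.
Qed.

Lemma polyfam_shift r (a : ('I_r -> K) -> 'I_n -> K) G :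
  (forall i, polyfun (fun u => a u i)) -> polyfam G ->
  polyfam (fun u => shift (a u) (G u)).
Proof.
move=> ap; apply: (@polyfam_linear K n r (fun u => shift (a u))) => [u|m].
  exact: shift_linear.
apply: (polyfam_ext (H := fun u => \prod_(i < n) ('X_i + (a u i)%:MP) ^+ m i)).
  by move=> u; rewrite /shift comp_mpolyX; apply: eq_bigr => i _; rewrite tnth_mktuple.
refine (@polyfam_prod K n r _ (index_enum _) (fun i u => ('X_i + (a u i)%:MP) ^+ m i) _) => i.
apply: polyfamExp; apply: polyfamD; first exact: polyfamX.
exact: polyfamC.
Qed.

End Shift.

(** * The parametrization of U and its polynomial left inverse *)

Section Parametrization.
Variables (h : seq nat) (n mu : nat) (B : mu.-tuple 'X_{1..n}).
Hypothesis admB : admissible h B.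
Hypothesis mu_gt0 : (0 < mu)%N.
Local Notation s := (socdeg h).
Implicit Types (m t b : 'X_{1..n}) (j k : 'I_n).
Variables (K : closedFieldType).
Hypothesis charK0 : [pchar K] =i pred0.
Hypothesis lt_s_mu : (s < mu)%N.
Local Notation coordn := #|{: Defs.coord n mu}|.

Definition params : finType := (Cidx h n + Thidx h n + 'I_n)%type.
Local Notation d := #|params|.

Definition param_C (u : 'I_d -> K) (p : Cidx h n) := u (enum_rank (inl (inl p) : params)).
Definition param_th (u : 'I_d -> K) (q : Thidx h n) := u (enum_rank (inl (inr q) : params)).
Definition param_a (u : 'I_d -> K) (i : 'I_n) := u (enum_rank (inr i : params)).

Local Notation nfu u := (nf B (param_C u) (param_th u)).

Lemma nf_coef_poly m t : polyfun (fun u => nf_coef (param_C u) (param_th u) m t).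
Proof.
exists (nf_coef (R := {mpoly K[d]}) (fun p => 'X_(enum_rank (inl (inl p) : params)))
  (fun q => 'X_(enum_rank (inl (inr q) : params))) m t) => u.
rewrite (nf_coef_morph (meval u)).
have -> : (meval u \o fun p : Cidx h n => 'X_(enum_rank (inl (inl p) : params))) = param_C u.
  by apply/funext => p; rewrite /= mevalXU.
suff -> : (meval u \o fun q : Thidx h n => 'X_(enum_rank (inl (inr q) : params))) = param_th u.
  by [].
by apply/funext => q; rewrite /= mevalXU.
Qed.

Lemma polyfam_nf G : polyfam G -> polyfam (fun u => nfu u (G u)).
Proof.
apply: (@polyfam_linear K n d (fun u => nfu u)) => [u|m]; first exact: nf_linear.
apply: (polyfam_ext (H := fun u => \sum_i
    nf_coef (param_C u) (param_th u) m (tnth B i) *: monomials K B i)).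
  by move=> u; rewrite nfX.
refine (@polyfam_sum K n d _ (index_enum _)
  (fun i u => nf_coef (param_C u) (param_th u) m (tnth B i) *: monomials K B i) _).
by move=> i; apply: polyfamZ; [apply: nf_coef_poly | apply: polyfamX].
Qed.

(** The normal form modulo the translated ideal, as the conjugate of [nf] by the translation. *)
Definition translate_nf (u : 'I_d -> K) f :=
  shift (fun i => - param_a u i) (nfu u (shift (param_a u) f)).

Definition translate_ideal (u : 'I_d -> K) f := nf_ideal B (param_C u) (param_th u) (shift (param_a u) f).

Lemma translate_ideal_is_ideal u : is_ideal (translate_ideal u).
Proof.
have idI := nf_ideal_is_ideal admB mu_gt0 (param_C u) (param_th u).
split=> [|f g If Ig|f g Ig]; rewrite /translate_ideal.
- by rewrite /shift comp_mpoly0; apply: (ideal0 idI).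
- by rewrite shiftD; exact: (idealD idI If Ig).
by rewrite shiftM; exact: (idealMl idI _ Ig).
Qed.

Lemma shift_suppO (a : 'I_n -> K) (f : {mpoly K[n]}) : (forall t, ~~ in_O h t -> f@_t = 0) ->
  forall t, ~~ in_O h t -> (shift a f)@_t = 0.
Proof.
move=> fO t nOt; rewrite {1}[f]mpolyE (linear_sum (shift_linear a)) mcoeff_sum.
rewrite big_seq big1 // => m; rewrite mcoeff_msupp => fm.
have Om : in_O h m by apply: contraNT fm => /fO ->.
rewrite mcoeffZ; apply/eqP; rewrite mulf_eq0 (negPf fm) /=.
by apply: contraNT nOt => /shift_mono_supp; apply: (in_O_down admB).
Qed.

Lemma suppO_sum (f : {mpoly K[n]}) : (forall t, ~~ in_O h t -> f@_t = 0) ->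
  f = \sum_i f@_(tnth B i) *: monomials K B i.
Proof.
move=> fO; apply: (sum_nf_mono_supp admB) => t; rewrite mcoeff_msupp.
by apply: contraNT => /fO ->.
Qed.

Lemma translate_nf_ideal u f : translate_ideal u (f - translate_nf u f).
Proof.
rewrite /translate_ideal /translate_nf shiftB shiftNK.
exact: nf_idealB.
Qed.

Lemma translate_nf_suppO u f t : ~~ in_O h t -> (translate_nf u f)@_t = 0.
Proof. by apply: shift_suppO => t'; apply: (nf_supp admB). Qed.

Lemma translate_quotient_basis u : quotient_basis (monomials K B) (translate_ideal u).
Proof.
have idI := translate_ideal_is_ideal u.
apply: quotient_basisI => // [f|c].
  exists (fun i => (translate_nf u f)@_(tnth B i)).
  by rewrite -suppO_sum; [apply: translate_nf_ideal | move=> t; apply: translate_nf_suppO].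
rewrite /translate_ideal /nf_ideal => Ic i.
have cO t : ~~ in_O h t -> (\sum_i c i *: monomials K B i)@_t = 0.
  exact: (monomials_coef_notin admB).
rewrite (nf_id admB) in Ic; last exact: shift_suppO.
have := congr1 (shift (fun i => - param_a u i)) Ic.
rewrite shiftK /shift comp_mpoly0 => /(congr1 (mcoeff (tnth B i))).
by rewrite (monomials_coef admB) mcoeff0.
Qed.

Definition translate_point u : hilb K n mu :=
  Hilb (translate_ideal_is_ideal u) 
    (ex_intro (fun e => quotient_basis e _) _ (translate_quotient_basis u)).

Lemma phi_exists : exists phi : 'I_coordn -> {mpoly K[d]},
  forall u, chart_coord B (translate_point u) (fun q => (phi q).@[u]).
Proof.
have /choice[phi0 phi0E] : forall kij : ('I_n * 'I_mu * 'I_mu)%type, exists p : {mpoly K[d]},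
    forall u, mcoeff (tnth B kij.1.2) (translate_nf u 'X_[(U_(kij.1.1) + tnth B kij.2)%MM]) = p.@[u].
  case=> [[k i] j]; apply: polyfun_coef; apply: polyfam_shift.
    by move=> i'; apply: polyfun_opp; apply: polyfun_coord.
  apply: polyfam_nf; apply: polyfam_shift; last exact: polyfamX.
  by move=> i'; apply: polyfun_coord.
have [phi phiE] := cidx_choice (fun (k : 'I_n) (i j : 'I_mu) => phi0 (k, i, j)).
exists phi => u; split; first exact: translate_quotient_basis.
move=> k j; have := translate_nf_ideal u 'X_[(U_(k) + tnth B j)%MM].
rewrite {1}[translate_nf _ _]suppO_sum; last by move=> t; apply: translate_nf_suppO.
congr (translate_ideal u (_ - _)); apply: eq_bigr => i _.
by rewrite phiE -(phi0E (k, i, j)).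
Qed.

(** Monomials of degree s + 1 have normal form 0. *)
Lemma translate_pow u k : translate_ideal u (('X_k - (param_a u k)%:MP) ^+ s.+1).
Proof.
rewrite /translate_ideal /nf_ideal /shift rmorphXn /= -/(shift _ _) shiftB shiftX.
rewrite [shift _ _%:MP]comp_mpolyC addrK mpolyXn nfX nf_mono_high //.
by rewrite mdegMn mdeg1 mul1n.
Qed.

Lemma punctual_translate_point u : punctual (translate_point u).
Proof.
exists (param_a u) => k; have := exprD ('X_k - (param_a u k)%:MP) (mu - s.+1) s.+1.
by rewrite subnK // => ->; apply: (idealMl (translate_ideal_is_ideal u)); apply: translate_pow.
Qed.

(** The normal form modulo the translated ideal can be recovered from the chart coordinates alone,
    polynomially; the left inverse has to work without knowing u. *)
Lemma polyfam_coords :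
  exists T : ('I_coordn -> K) -> {mpoly K[n]} -> {mpoly K[n]},
  [/\ forall v, linear (T v), forall m, polyfam (fun v => T v 'X_[m]) &
    forall u v, chart_coord B (translate_point u) v -> forall f, T v f = translate_nf u f].
Proof.
have oB := adm_order admB.
have /choice[N NP] : forall m, exists N : 'I_mu -> {mpoly K[coordn]}, forall x v,
    chart_coord B x v -> x ('X_[m] - \sum_i (N i).@[v] *: monomials K B i).
  by move=> m; apply: chart_poly_coords.
pose T (v : 'I_coordn -> K) (f : {mpoly K[n]}) :=
  \sum_(m <- msupp f) f@_m *: \sum_i (N m i).@[v] *: monomials K B i.
have linT v : linear (T v) by apply: linear_extension_linear.
have TX v m : T v 'X_[m] = \sum_i (N m i).@[v] *: monomials K B i.
  by rewrite /T msuppX big_seq1 mcoeffX eqxx scale1r.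
exists T; split=> // [m|u v xv f].
  apply: (polyfam_ext (TX^~ m)).
  refine (@polyfam_sum K n coordn _ (index_enum _)
    (fun i v => (N m i).@[v] *: monomials K B i) _) => i.
  by apply: polyfamZ; [exists (N m i) | apply: polyfamX].
have nfX' m : translate_nf u 'X_[m] = \sum_i (N m i).@[v] *: monomials K B i.
  rewrite [LHS]suppO_sum; last by move=> t; apply: translate_nf_suppO.
  apply: eq_bigr => i _; congr (_ *: _).
  have := translate_nf_ideal u 'X_[m].
  rewrite {1}[translate_nf _ _]suppO_sum; last by move=> t; apply: translate_nf_suppO.
  move=> nfI; exact: (quotient_basis_inj (translate_ideal_is_ideal u)
    (translate_quotient_basis u) nfI (NP m _ _ xv) i).
have linN : linear (translate_nf u).
  by move=> c f' g; rewrite /translate_nf shift_linear nf_linear shift_linear.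
rewrite {2}[f]mpolyE (linear_sum linN); apply: eq_bigr => m _.
by rewrite nfX'.
Qed.

(** Applied to the key monomial, the recursion stops after one step: its terms are the elements of O
    \ TM divisible by [key_hat], distinct for distinct u, so each theta is visible up to sign. *)
Lemma nf_coef_theta C (th : Thidx h n -> K) (q : Thidx h n) :
  nf_coef C th (key_mon h (val q).1) ((val q).2 + key_hat h (val q).1)%MM = - th q.
Proof.
have /andP[keyk Tq] := valP q; have [LMk leadk] := adm_key admB keyk.
set k := (val q).1 in keyk Tq LMk leadk *.
have nO := in_LM_notin_O LMk; have /and3P[_ les _] := LMk.
have multk (q' : Thidx h n) : (val q').1 = k ->
    multm (key_mon h k) (val q') = ((val q').2 + key_hat h k)%MM.
  by move=> q'k; rewrite /multm q'k /key_hat addmC.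
rewrite (nf_coefE admB) //; last first.
  by rewrite negb_and; have /and3P[_ -> _] := Tq; rewrite orbT.
apply: congr1; rewrite (bigD1 q) /=; last first.
  rewrite leadk multk //; have /and3P[Oq _ _] := Tq; exact: in_O_deg Oq.
rewrite multk // nf_coefO; last by have /and3P[] := Tq.
rewrite eqxx mulr1 big1 ?addr0 // => q' /andP[/andP[lead' _] ne].
have q'k := is_lead_uniq lead' leadk.
have /andP[_] := valP q'; rewrite q'k => /and3P[Oq' _ _].
rewrite multk // nf_coefO // [_ == _](_ : _ = false) ?mulr0 //.
apply: contraNF ne => /eqP/addIm e; apply/eqP/val_inj.
by rewrite [val q']surjective_pairing [RHS]surjective_pairing q'k (val_inj e).
Qed.

Lemma psi_exists : exists psi : 'I_d -> {mpoly K[coordn]},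
  forall u v, chart_coord B (translate_point u) v -> forall i, (psi i).@[v] = u i.
Proof.
have muK : mu%:R != 0 :> K by move/pcharf0P: charK0 => ->; rewrite -lt0n.
pose tr (v : 'I_coordn -> K) k := mu%:R^-1 * \sum_j v (cidx k j j).
have trp k : polyfun (fun v => tr v k).
  exists ((mu%:R^-1)%:MP * \sum_j 'X_(cidx k j j)) => v.
  rewrite mevalM mevalC meval_sum; congr (_ * _); apply: eq_bigr => j _.
  by rewrite mevalXU.
have trE u v : chart_coord B (translate_point u) v -> tr v = param_a u.
  move=> xv; apply/funext => k; rewrite /tr (punctual_trace mu_gt0 xv (translate_pow u k)).
  by rewrite -[param_a u k *+ mu]mulr_natl mulKf.
have [T [linT TX TE]] := polyfam_coords.
(* Once a is known from the traces, conjugating back to the origin gives the normal form of the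
   untranslated ideal, whose coefficients contain C and theta. *)
pose Psi b (v : 'I_coordn -> K) := shift (tr v) (T v (shift (fun i => - tr v i) 'X_[b])).
have Psip b t : polyfun (fun v => (Psi b v)@_t).
  apply: polyfun_coef; apply: polyfam_shift => //; apply: (polyfam_linear linT TX).
  by apply: polyfam_shift => [i|]; [apply: polyfun_opp | apply: polyfamX].
have PsiE u v b t : chart_coord B (translate_point u) v ->
    (Psi b v)@_t = nf_coef (param_C u) (param_th u) b t.
  move=> xv; rewrite /Psi (trE _ _ xv) (TE _ _ xv) /translate_nf !shiftNK nfX.
  exact: (nf_mono_coef admB).
suff: forall i : 'I_d, exists p : {mpoly K[coordn]}, forall u v,
    chart_coord B (translate_point u) v -> p.@[v] = u i.
  by move=> /choice[psi psiP]; exists psi => u v xv i; apply: psiP.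
move=> i; rewrite -(enum_valK i); case: (enum_val i) => [[p|q]|k].
- have [P PE] := Psip (val p).2 (val p).1; exists P => u v xv.
  rewrite -PE (PsiE _ _ _ _ xv); have /andP[TMp LMp] := valP p.
  rewrite nf_coef_LM // /Ccoef (bigD1 p) ?eqxx //= big1 ?addr0 // => p'.
  case/andP=> /andP[/eqP/val_inj e2 /eqP/val_inj e1] /eqP[]; apply: val_inj.
  by rewrite [val p']surjective_pairing [RHS]surjective_pairing e1 e2.
- have [P PE] := Psip (key_mon h (val q).1) ((val q).2 + key_hat h (val q).1)%MM.
  exists (- P) => u v xv; rewrite mevalN -PE (PsiE _ _ _ _ xv) nf_coef_theta.
  by rewrite opprK.
have [P PE] := trp k; exists P => u v xv.
by rewrite -PE /= (trE _ _ xv).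
Qed.

End Parametrization.

(** * The closure of U is an elementary component, given one rigid distinguished ideal *)

Section ModDistinguishedLocus.
Variables (h : seq nat) (n mu : nat) (B : mu.-tuple 'X_{1..n}).
Hypotheses (admB : admissible h B) (mu_gt0 : (0 < mu)%N) (lt_s_mu : (socdeg h < mu)%N).
Variables (K : closedFieldType).
Hypothesis charK0 : [pchar K] =i pred0.
Local Notation coordn := #|{: Defs.coord n mu}|.
Local Notation d := #|params h n|.
Local Notation U := (translates (mod_distinguished (K := K) h (n := n) (mu := mu))).
Local Notation tpoint := (translate_point admB mu_gt0).

Definition pack (R : Type) (C : Cidx h n -> R) (th : Thidx h n -> R) (a : 'I_n -> R)
  (j : 'I_d) : R :=
  match enum_val j with inl (inl p) => C p | inl (inr q) => th q | inr k => a k end.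

Lemma param_C_pack (C : _ -> K) th a : param_C (pack C th a) = C.
Proof. by apply/funext => p; rewrite /param_C /pack enum_rankK. Qed.
Lemma param_th_pack (C : _ -> K) th a : param_th (pack C th a) = th.
Proof. by apply/funext => p; rewrite /param_th /pack enum_rankK. Qed.
Lemma param_a_pack (C : _ -> K) th a : param_a (pack C th a) = a.
Proof. by apply/funext => p; rewrite /param_a /pack enum_rankK. Qed.

Lemma chart_coord_ext (x y : hilb K n mu) v : (forall f, x f <-> y f) ->
  chart_coord B x v -> chart_coord B y v.
Proof.
move=> xy; rewrite /chart_coord; suff -> : hilb_ideal x = hilb_ideal y by [].
by apply/funext => f; apply/propext.
Qed.

Lemma shift0 (f : {mpoly K[n]}) : shift (fun=> 0) f = f.
Proof.
rewrite /shift [RHS]mpolyE comp_mpolyE; apply: eq_bigr => m _.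
congr (_ *: _); rewrite [RHS]mpolyXE_id.
by apply: eq_bigr => i _; rewrite tnth_mktuple mpolyC0 addr0.
Qed.

Lemma translates_mod_distinguished (y : hilb K n mu) :
  U y <-> exists u, forall f, y f <-> tpoint u f.
Proof.
split=> [[a [x [/(mod_distinguished_nf admB mu_gt0)[C [th xP]] yx]]]|[u yu]].
  exists (pack C th a) => f; rewrite yx xP /= /translate_ideal.
  by rewrite param_C_pack param_th_pack param_a_pack.
pose x := tpoint (pack (param_C u) (param_th u) (fun=> 0)).
exists (param_a u), x; split=> [|f].
  apply/(mod_distinguished_nf admB mu_gt0); exists (param_C u), (param_th u) => f.
  rewrite /= /translate_ideal param_C_pack param_th_pack param_a_pack.
  by rewrite shift0.
rewrite yu /= /translate_ideal param_C_pack param_th_pack param_a_pack.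
by rewrite shift0.
Qed.

Variables (C0 : Cidx h n -> K) (D : 'I_d -> 'I_coordn).
Local Notation u_of C := (pack C (fun=> 0) (fun=> 0)).
Hypothesis rigid : forall v w, chart_coord B (tpoint (u_of C0)) v ->
  chart_tangent B v w -> (forall j, w 0 (D j) = 0) -> w = 0.

Theorem mod_distinguished_component :
  [/\ elementary_component (zclosure U), has_dim (zclosure U) d &
    sufficiently_general (fun C : Cidx h n -> K =>
        exists I : hilb K n mu,
          [/\ distinguished C I,
              exists2 e, tangent_dim I e & has_dim U e,
              zclosure U I &
              smooth_point I])].
Proof.
have oB := adm_order admB.
have [phi phiP] := phi_exists admB mu_gt0 K.
have [psi psiP] := psi_exists admB mu_gt0 charK0.
have phi_chart u : exists x, chart_coord B x (fun q => (phi q).@[u]) by exists (tpoint u).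
have phiK u i : (psi i).@[fun q => (phi q).@[u]] = u i by apply: psiP.
have UE : U = chart_image B phi.
  apply/funext => y; apply/propext; split.
    case/translates_mod_distinguished => u yu; exists u.
    by apply: chart_coord_ext (phiP u) => f; rewrite yu.
  case=> u yu; apply/translates_mod_distinguished; exists u.
  exact: (chart_coord_ideal mu_gt0 oB yu (phiP u)).
rewrite UE.
(* The gradients at v of the chart equations, together with the coordinate functionals [D j]. By
   [rigid] no nonzero vector is orthogonal to all of them at [C0], so some of them form an
   invertible square matrix. *)
pose Q (v : 'I_coordn -> K) (r : 'rV[K]_coordn) :=
  (exists2 p, chart_eq B p & forall q, r 0 q = (p^`M(q)).@[v]) \/ (exists j, r = delta_mx 0 (D j)).
pose v_of C := fun q => (phi q).@[u_of C].
have [|A Aunit AQ] := @unitmx_of_rows K coordn (Q (v_of C0)).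
  move=> w Qw; apply: (@rigid (v_of C0)) => [|p Bp|j]; first exact: phiP.
    have /Qw/matrixP/(_ 0 0) : Q (v_of C0) (\row_q (p^`M(q)).@[v_of C0]).
      by left; exists p => // q; rewrite mxE.
    by rewrite !mxE => e; rewrite -[RHS]e; apply: eq_bigr => q _; rewrite !mxE.
  have /Qw/matrixP/(_ 0 0) : Q (v_of C0) (delta_mx 0 (D j)) by right; exists j.
  by rewrite -rowE !mxE.
pose sC (j : 'I_d) : {mpoly K[#|{: Cidx h n}|]} :=
  pack (fun p => 'X_(enum_rank p)) (fun=> 0) (fun=> 0) j.
pose vp q := phi q \mPo [tuple sC j | j < d].
have vpE (C : Cidx h n -> K) q : (vp q).@[fun i => C (enum_val i)] = v_of C q.
  rewrite /vp comp_mpoly_meval; apply: meval_eq => j; rewrite tnth_mktuple /sC /pack.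
  by case: (enum_val j) => [[p|?]|?]; rewrite ?meval0 // mevalXU enum_rankK.
(* The same equations at other values of C give rows whose entries are polynomial in C; their
   determinant is the polynomial that defines general position. *)
have /choice[Ap ApP] : forall i, exists r : 'I_coordn -> {mpoly K[#|{: Cidx h n}|]},
    (forall q, (r q).@[fun i => C0 (enum_val i)] = A i q) /\
    forall C, Q (v_of C) (\row_q (r q).@[fun i => C (enum_val i)]).
  move=> i; have [[p Bp pE]|[j Ej]] := AQ i.
    have E C q : (p^`M(q) \mPo [tuple vp q | q < coordn]).@[fun i => C (enum_val i)]
        = (p^`M(q)).@[v_of C].
      by rewrite comp_mpoly_meval; apply: meval_eq => q'; rewrite tnth_mktuple vpE.
    exists (fun q => p^`M(q) \mPo [tuple vp q | q < coordn]); split=> [q|C].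
      by rewrite E -pE mxE.
    by left; exists p => // q; rewrite mxE E.
  exists (fun q => ((delta_mx 0 (D j) : 'rV[K]_coordn) 0 q)%:MP); split=> [q|C].
    by rewrite mevalC -Ej mxE.
  by right; exists j; apply/rowP => q; rewrite mxE mevalC.
pose M := \matrix_(i, q) Ap i q.
have detM c : (\det M).@[c] = \det (map_mx (meval c) M) by rewrite -det_map_mx.
have generic C : (\det M).@[fun i => C (enum_val i)] != 0 ->
    forall w, chart_tangent B (v_of C) w -> (forall j, w 0 (D j) = 0) -> w = 0.
  rewrite detM -unitfE -/(unitmx _) => Mu w tw wD.
  suff e : map_mx (meval (fun i => C (enum_val i))) M *m w^T = 0.
    by rewrite -[w]trmxK -(mulKmx Mu w^T) e mulmx0 trmx0.
  apply/colP => i; rewrite !mxE; have [_ /(_ C)[[p Bp pE]|[j Ej]]] := ApP i.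
    rewrite -[RHS](tw p Bp); apply: eq_bigr => q _; rewrite -pE !mxE; congr (_ * _).
  rewrite -[RHS](wD j) (bigD1 (D j)) //= big1 ?addr0 => [|q ne].
    by have /rowP/(_ (D j)) := Ej; rewrite !mxE !eqxx /= => ->; rewrite mul1r.
  by have /rowP/(_ q) := Ej; rewrite !mxE (negPf ne) andbF => ->; rewrite mul0r.
have detM0 : (\det M).@[fun i => C0 (enum_val i)] != 0.
  rewrite detM (_ : map_mx _ M = A) -?unitfE //.
  by apply/matrixP => i q; rewrite !mxE; have [->] := ApP i.
have x0u0 C : chart_coord B (tpoint (u_of C)) (v_of C) by exact: phiP.
have dimU Z : (forall x, chart_image B phi x -> Z x) ->
  (forall x, Z x -> zclosure (chart_image B phi) x) -> has_dim Z d.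
  exact: (chart_image_has_dim charK0 mu_gt0 oB phi_chart phiK).
split.
- split; first exact: (smooth_irr_component charK0 mu_gt0 oB phi_chart phiK (x0u0 C0) (generic C0 detM0)).
  move=> x Ux; apply: (punctual_supported mu_gt0).
  (* All points of U are punctual, and the condition is closed, so it passes to the closure. *)
  apply: Ux; first exact: (zclosed_punctual charK0 mu_gt0).
  rewrite -UE => y /translates_mod_distinguished[u yu].
  have [a aP] := punctual_translate_point admB mu_gt0 lt_s_mu u.
  by exists a => k; apply/yu.
- by apply: dimU => // x; apply: zclosure_sub.
exists (\det M); first by apply: contraNneq detM0 => ->; rewrite meval0.
move=> C /generic goodC; exists (tpoint (u_of C)); split.
- apply/(distinguished_nf admB mu_gt0) => f; rewrite /= /translate_ideal.
  rewrite param_C_pack param_th_pack param_a_pack.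
  by rewrite shift0.
- exists d; first exact: (smooth_tangent_dim charK0 oB phi_chart phiK (x0u0 C) goodC).
  by apply: dimU => // x; apply: zclosure_sub.
- by apply: zclosure_sub; exists (u_of C).
exact: (smooth_point_chart_image charK0 mu_gt0 oB phi_chart phiK (x0u0 C) goodC).
Qed.

End ModDistinguishedLocus.

Local Close Scope ring_scope.

(** * Computations with lists of exponents *)

(** Generated in increasing lexicographic order, so that an initial segment is a layer of O. *)
Fixpoint monos (n e : nat) : seq (seq nat) :=
  if n is n'.+1 then flatten [seq [seq a :: l | l <- monos n' (e - a)] | a <- iota 0 e.+1]
  else if e is 0 then [:: [::]] else [::].

Definition up k (l : seq nat) := incr_nth l k.
Definition dn k (l : seq nat) := set_nth 0 l k (nth 0 l k).-1.

(** A set of lists of exponents: the path of [a :: l] consists of [a] edges [s] and one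
edge [z], followed by the path of [l]. *)
Inductive trie := Tip | Node (b : bool) (z s : trie).

Definition node_mark t := if t is Node b _ _ then b else false.
Definition node_zero t := if t is Node _ z _ then z else Tip.
Definition node_succ t := if t is Node _ _ s then s else Tip.

Fixpoint descend a t := if a is a'.+1 then descend a' (node_succ t) else node_zero t.
Fixpoint lookup (l : seq nat) t :=
  if l is a :: l' then lookup l' (descend a t) else node_mark t.

Fixpoint insert (l : seq nat) : trie -> trie :=
  if l is a :: l' then
    (fix go a t := if a is a'.+1 then Node (node_mark t) (node_zero t) (go a' (node_succ t))
                   else Node (node_mark t) (insert l' (node_zero t)) (node_succ t)) a
  else fun t => Node true (node_zero t) (node_succ t).

Definition trie_of (s : seq (seq nat)) := foldr insert Tip s.

Section Mirror.
Variables (h : seq nat) (n : nat).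
Local Notation s := (socdeg h).

Definition Olayer e := take (nth 0 h e) (monos n e).
Definition Olist := flatten [seq Olayer e | e <- iota 0 (size h)].
Definition TMlist := Olayer s.
Definition Otrie := trie_of Olist.

Definition nonOlist (t : trie) :=
  [seq l <- flatten [seq monos n e | e <- iota 1 s] | ~~ lookup l t].
Definition LMlist (t : trie) (no : seq (seq nat)) :=
  [seq l <- no | all (fun k => (nth 0 l k == 0) || lookup (dn k l) t) (iota 0 n)].

Definition leadl := find (fun a => 0 < a)%N.
(** [LM] is listed by degree and then lexicographically, so the first entry with leading variable
    x_k is the key monomial. *)
Definition chil (LM : seq (seq nat)) k := head [::] [seq b <- LM | leadl b == k].
Definition hatl LM k := set_nth 0 (chil LM k) k 0.
Definition dvdl (l l' : seq nat) := all2 leq l l'.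
(** The products by [hatl LM k] of the elements of T_k, when x_k is a key variable. *)
Definition Tlist (O LM : seq (seq nat)) k :=
  [seq t <- O | [&& sumn t != s, (sumn (chil LM k) <= sumn t)%N & dvdl (hatl LM k) t]].
Definition keyl (LM : seq (seq nat)) k := has (fun b => leadl b == k) LM.

(** The last three conjuncts give [adm_short], [adm_cross] and [adm_lower]. For [adm_cross] only the
    least degree e of the monomials outside O whose leading variable comes after x_j matters; if
    there is none, e = s and nothing is required. *)
Definition adm_check :=
  let O := Olist in let t := Otrie in let no := nonOlist t in let LM := LMlist t no in
  [&& size O == sumn h, uniq O,
      all (fun l => all (fun k => (nth 0 l k == 0) || lookup (dn k l) t) (iota 0 n)) O,
      all (fun l => keyl LM (leadl l)) no,
      all (fun l => let k := leadl l in
             if nth 0 (chil LM k) k <= nth 0 l k then true else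
             all (fun t => s < sumn l - nth 0 l k + (sumn t - sumn (hatl LM k))) (Tlist O LM k)) no,
      all (fun j => let e := foldr minn s [seq sumn l | l <- no & j < leadl l] in
             all (fun x => if (sumn x < e) || (s <= sumn x) then true else
                   [&& all (fun a => a == 0) (take j.+1 x), ~~ lookup (up j x) t &
                     up j x \notin LM]) O) (iota 0 n) &
      all (fun k => (nth 0 (chil LM k) k != 1%N) || ~~ keyl LM k ||
          all (fun t => all (fun a => a == 0) (take k.+1 t)) (Tlist O LM k)) (iota 0 n)].

Definition nparams :=
  let O := Olist in let t := Otrie in let no := nonOlist t in let LM := LMlist t no in
  size TMlist * size LM + sumn [seq size (Tlist O LM k) | k <- iota 0 n & keyl LM k] + n.

(** The tangent equations at the distinguished ideal with c_(t,b) = 1 for (b, t) in [c0]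
and c_(t,b) = 0 otherwise.  The list [m ++ i] stands for the unknown which is the
first-order change of the coefficient of [i] in the normal form of the border monomial
[m].  The coefficient of [i] in x_k NF(x_l t) changes by the sum of the unknowns listed
by [direct], which come from the multiplication by x_k, and by [shifted], which come from
NF(x_l t); here [pre_list k i] consists of the [p] in O such that NF(x_k p) involves
[i]. *)
Section Rigidity.
Variables (c0 : seq (seq nat * seq nat)) (O : seq (seq nat)) (inO : trie).

Definition nf_list m := if lookup m inO then [:: m] else [seq p.2 | p <- c0 & p.1 == m].
Definition pre_list k i := (if 0 < nth 0 i k then [:: dn k i] else [::]) ++
  [seq dn k p.1 | p <- c0 & (p.2 == i) && (0 < nth 0 p.1 k)].
Definition direct k l t := [seq m <- [seq up k p | p <- nf_list (up l t)] | ~~ lookup m inO].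
Definition shifted l t (ps : seq (seq nat)) :=
  let m := up l t in if lookup m inO then [::] else [seq m ++ p | p <- ps].

(** Both sides of the equation are sums of unknowns with coefficient 1. If exactly one occurrence is
    not yet marked, that unknown vanishes. *)
Definition mark_step t k l (ir : seq nat * seq (seq nat) * seq (seq nat)) dk dl st :=
  let: (i, pk, pl) := ir in
  let occ := ([seq m ++ i | m <- dk] ++ shifted l t pk) ++ ([seq m ++ i | m <- dl] ++ shifted k t pl) in
  if [seq x <- occ | ~~ lookup x st] is [:: x] then insert x st else st.

Definition solve_step (pres : seq (seq (seq (seq nat)))) st (tkl : nat * nat * nat) :=
  let: (t, k, l) := tkl in
  let t := nth [::] O t in
  let dk := direct k l t in let dl := direct l k t in
  foldl (fun st ir => mark_step t k l ir dk dl st) st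
    (zip (zip O (nth [::] pres k)) (nth [::] pres l)).

Definition solve st sched :=
  let pres := [seq [seq pre_list k i | i <- O] | k <- iota 0 n] in
  foldl (solve_step pres) st sched.

Definition solved st :=
  all (fun k => all (fun t => let b := up k t in lookup b inO ||
     all (fun i => lookup (b ++ i) st) O) O) (iota 0 n).
End Rigidity.

(** The unknowns that correspond to the parameters C, theta and a. *)
Definition rigid_marks (O LM TM : seq (seq nat)) (tr : seq nat) :=
  [seq b ++ t | b <- LM, t <- TM] ++
  flatten [seq [seq chil LM k ++ t | t <- Tlist O LM k] | k <- iota 0 n & keyl LM k] ++
  [seq up k (nth [::] O (nth 0 tr k)) ++ nth [::] O (nth 0 tr k) | k <- iota 0 n].

Definition rigid_check (c0i : seq (nat * nat)) (tr : seq nat) sched :=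
  let O := Olist in let t := Otrie in let LM := LMlist t (nonOlist t) in let TM := TMlist in
  let c0 := [seq (nth [::] LM p.1, nth [::] TM p.2) | p <- c0i] in
  [&& uniq c0, all (fun p => (p.1 \in LM) && (p.2 \in TM)) c0,
      all (fun j => j < size O) tr, all (fun x => x.1.1 < size O) sched &
      solved O t (solve c0 O t (trie_of (rigid_marks O LM TM tr)) sched)].
End Mirror.

(** A triple (t, k, l), where [t] is the index of a monomial in O, is encoded in three
hexadecimal digits: 6 bits for [t] and 3 bits for each of [k] and [l].  The triples are
read from the right, and the leading digit 1 only marks the end. *)
Fixpoint bits (p : BinNums.positive) : seq bool :=
  match p with
  | BinNums.xH => [::]
  | BinNums.xO q => false :: bits q
  | BinNums.xI q => true :: bits q
  end.
Definition bnat (b0 b1 b2 : bool) : nat := b0 + b1.*2 + b2.*2.*2.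
Fixpoint triples (bs : seq bool) : seq (nat * nat * nat) :=
  if bs is [:: l0, l1, l2, k0, k1, k2, t0, t1, t2, t3, t4, t5 & bs'] then
    (bnat t0 t1 t2 + 8 * bnat t3 t4 t5, bnat k0 k1 k2, bnat l0 l1 l2) :: triples bs'
  else [::].
Definition schedule (ps : seq BinNums.positive) := flatten [seq triples (bits p) | p <- ps].

(** * Agreement of the list computations with the definitions *)

Section ListMonomials.
Variable n : nat.
Implicit Types (l : seq nat) (m : 'X_{1..n}) (k : 'I_n).

Definition mon l : 'X_{1..n} := [multinom nth 0 l i | i < n].

Lemma monE l k : mon l k = nth 0 l k. Proof. exact: mnmE. Qed.

Lemma size_mnm m : size m = n. Proof. exact: size_tuple. Qed.

Lemma mon_val m : mon m = m.
Proof. by apply/mnmP => k; rewrite monE -(mnm_nth 0). Qed.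

Lemma val_mon l : size l = n -> mon l = l :> seq nat.
Proof.
move=> sl; apply: (@eq_from_nth _ 0); first by rewrite size_mnm.
by move=> i; rewrite size_mnm => lt_in; have := monE l (Ordinal lt_in); rewrite (mnm_nth 0) => ->.
Qed.

Lemma mon_inj l l' : size l = n -> size l' = n -> mon l = mon l' -> l = l'.
Proof. by move=> sl sl' e; rewrite -(val_mon sl) -(val_mon sl') e. Qed.

Lemma mdeg_sumn m : mdeg m = sumn m.
Proof. by rewrite /mdeg sumnE. Qed.

Lemma mdeg_mon l : size l = n -> mdeg (mon l) = sumn l.
Proof. by move=> sl; rewrite mdeg_sumn val_mon. Qed.

Lemma mon_lt l l' : size l = n -> size l' = n -> sumn l = sumn l' ->
  (mon l < mon l')%O = ((l : seqlexi nat) < (l' : seqlexi nat))%O.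
Proof.
move=> sl sl' e.
have -> : (mon l < mon l')%O = ((mdeg (mon l) :: mon l : seqlexi nat) < (mdeg (mon l') :: mon l' : seqlexi nat))%O.
  by [].
by rewrite ltxi_cons !mdeg_mon // !val_mon // e lexx.
Qed.

Lemma size_up k l : size l = n -> size (up k l) = n.
Proof. by move=> sl; rewrite /up size_incr_nth sl ltn_ord. Qed.

Lemma mon_up k l : size l = n -> mon (up k l) = (U_(k) + mon l)%MM.
Proof. by move=> sl; apply/mnmP => i; rewrite mnmDE mnm1E !monE nth_incr_nth. Qed.

Lemma size_dn k l : size l = n -> size (dn k l) = n.
Proof. by move=> sl; rewrite /dn size_set_nth sl; apply/maxn_idPr. Qed.

Lemma mon_dn k l : mon (dn k l) = (mon l - U_(k))%MM.
Proof.
apply/mnmP => i; rewrite mnmBE mnm1E !monE nth_set_nth /= eq_sym -val_eqE.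
by case: eqP => [->|_]; rewrite ?subn1 ?subn0.
Qed.

Lemma mem_monos e l : (l \in monos n e) = (size l == n) && (sumn l == e).
Proof.
elim: n e l => [|n' IHn] e l.
  by case: l => [|a l]; case: e => [|e].
apply/flattenP/andP => [[_ /mapP[a +] ->] /mapP[l']|[]].
  rewrite mem_iota IHn => lt_a /andP[/eqP <- /eqP el'] -> /=; split=> //.
  by rewrite el'; lia.
case: l => [//|a l]; rewrite [size _]/= [sumn _]/= => /eqP[sl] /eqP <-.
exists [seq a :: l0 | l0 <- monos n' (sumn l)].
  by apply/mapP; exists a; rewrite ?mem_iota ?addKn //; lia.
by apply/mapP; exists l; rewrite // IHn sl !eqxx.
Qed.

Lemma pairwise_flatten (T : Type) (I : eqType) (r : T -> T -> bool) (q : rel I)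
    (F : I -> seq T) (s : seq I) :
  (forall i, pairwise r (F i)) ->
  (forall i j, q i j -> allrel r (F i) (F j)) -> pairwise q s ->
  pairwise r (flatten [seq F i | i <- s]).
Proof.
move=> rF qF; elim: s => //= i s IHs /andP[qi /IHs rs].
rewrite pairwise_cat rF rs !andbT.
elim: s qi {IHs rs} => /= [_|j s IHs /andP[qij /IHs rs]]; first by rewrite allrel0r.
by rewrite allrel_catr qF.
Qed.

End ListMonomials.

Lemma monos_sorted n e :
  pairwise (fun l l' : seq nat => ((l : seqlexi nat) < (l' : seqlexi nat))%O) (monos n e).
Proof.
elim: n e => [|n IHn] e; first by case: e.
apply: (@pairwise_flatten _ _ _ ltn) => [a|a b lt_ab|].
- rewrite pairwise_map; apply: sub_pairwise (IHn _) => l l' /=.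
  by rewrite ltxi_cons lexx.
- apply/allrelP => _ _ /mapP[l _ ->] /mapP[l' _ ->].
  rewrite ltxi_cons; apply/andP; split; first exact: ltnW.
  by apply/implyP => le_ba; have := leq_trans lt_ab le_ba; rewrite ltnn.
by rewrite -sorted_pairwise; [apply: iota_ltn_sorted | apply: ltn_trans].
Qed.

(** In a strictly sorted list the position of x counts the elements below x. This links [in_O],
    defined by counting, to initial segments of [monos]. *)
Lemma take_index_filter (T : eqType) (r : rel T) s x : irreflexive r -> transitive r ->
  pairwise r s -> x \in s -> take (index x s) s = [seq y <- s | r y x].
Proof.
move=> irr tr; elim: s => //= y s IHs /andP[ry rs]; rewrite inE eq_sym.
have [<-|ne] /= := eqVneq y x; last by move=> xs; rewrite IHs // (allP ry _ xs).
rewrite irr => _; apply/esym/eqP; rewrite -size_eq0 size_filter -leqn0 leqNgt -has_count.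
apply/hasPn => z zs; apply/negP => rzx.
by have := irr y; rewrite (tr z y y (allP ry z zs) rzx).
Qed.

Section Tries.
Implicit Types (l : seq nat) (t : trie).

Lemma lookup_Tip l : lookup l Tip = false.
Proof. by elim: l => //= a l IHl; elim: a => //=. Qed.

Lemma lookup_insert l l' t : lookup l (insert l' t) = (l == l') || lookup l t.
Proof.
elim: l' l t => [|a' l' IHl'] [|a l] t; first by [].
- by case: t => [|b z s]; elim: a => //= a; rewrite ?lookup_Tip.
- by case: a' => [|a'] /=; case: t.
rewrite eqseq_cons; elim: a' a t => [|a' IHa'] [|a] t /=.
- by rewrite IHl'.
- by [].
- by [].
exact: (IHa' a (node_succ t)).
Qed.

Lemma lookup_trie_of s l : lookup l (trie_of s) = (l \in s).
Proof. by elim: s => [|x s IHs] /=; rewrite ?lookup_Tip // lookup_insert IHs inE. Qed.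

End Tries.

Section CardinalOfLists.
Variable n : nat.

Lemma card_mon_list B (A : pred 'X_{1..n < B}) (s : seq (seq nat)) :
  uniq s -> (forall l, l \in s -> size l = n /\ (sumn l < B)%N) ->
  (forall x, A x = ((bmnm x : seq nat) \in s)) -> #|A| = size s.
Proof.
move=> us sn As; pose f (x : 'X_{1..n < B}) : seq nat := bmnm x.
have f_inj : injective f by move=> x y fxy; apply/val_inj/val_inj/val_inj.
rewrite cardE -(size_map f); apply/perm_size/uniq_perm => // [|l].
  by rewrite map_inj_uniq // enum_uniq.
apply/mapP/idP => [[x +] ->|ls]; first by rewrite mem_enum unfold_in As.
have [sl lt_l] := sn l ls; have lt_ml : (mdeg (mon n l) < B)%N by rewrite mdeg_mon.
exists (BMultinom lt_ml); last by rewrite /f /= val_mon.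
by rewrite mem_enum unfold_in As /= val_mon.
Qed.

End CardinalOfLists.

Section MirrorCorrectness.
Variables (h : seq nat) (n : nat).
Local Notation s := (socdeg h).
Implicit Types (l : seq nat) (m t u b : 'X_{1..n}) (k : 'I_n).
Local Notation O := (Olist h n).
Local Notation tO := (Otrie h n).
Local Notation NO := (nonOlist h n tO).
Local Notation LM := (LMlist n tO NO).

Lemma monos_uniq e : uniq (monos n e).
Proof.
rewrite uniq_pairwise; apply: sub_pairwise (monos_sorted n e) => l l' /= lt_ll'.
by apply: contraTneq lt_ll' => ->; rewrite ltxx.
Qed.

Lemma in_O_mon l : size l = n -> in_O h (mon n l) = (l \in Olayer h n (sumn l)).
Proof.
move=> sl; have lL : l \in monos n (sumn l) by rewrite mem_monos sl !eqxx.
rewrite /in_O /Olayer in_take //; move: (mdeg_mon sl); move: (mdeg (mon n l)) => e ->.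
congr (_ < _)%N.
have ti := @take_index_filter (seq nat : eqType)
  (fun x y : seq nat => ((x : seqlexi nat) < (y : seqlexi nat))%O)
  _ l (fun x => ltxx _) (fun y x z => @lt_trans _ _ _ _ _) (monos_sorted n (sumn l)) lL.
rewrite cardsE (@card_mon_list _ _ _ (take (index l (monos n (sumn l))) (monos n (sumn l)))).
- by rewrite size_take index_mem lL.
- exact/take_uniq/monos_uniq.
- by move=> x /mem_take; rewrite mem_monos => /andP[/eqP -> /eqP ->].
move=> x; rewrite ti mem_filter mem_monos size_mnm eqxx /= -mdeg_sumn.
case: eqP => dx; rewrite /= ?andbF // andbT -[in LHS](mon_val x) mon_lt ?size_mnm //.
by rewrite -mdeg_sumn.
Qed.

Lemma Olist_size l : l \in O -> size l = n.
Proof.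
by case/flattenP=> _ /mapP[e _ ->] /mem_take; rewrite mem_monos => /andP[/eqP].
Qed.

Lemma in_Olist l : size l = n -> (l \in O) = in_O h (mon n l).
Proof.
move=> sl; rewrite in_O_mon //; apply/flattenP/idP => [[_ /mapP[e _ ->] le]|ll].
  have := mem_take le; rewrite mem_monos => /andP[_ /eqP el].
  by rewrite el.
exists (Olayer h n (sumn l)) => //; apply/map_f; rewrite mem_iota leq0n add0n /=.
by rewrite ltnNge; apply: contraL ll => sz; rewrite /Olayer nth_default // take0.
Qed.

Lemma lookup_Otrie l : size l = n -> lookup l tO = in_O h (mon n l).
Proof. by move=> sl; rewrite lookup_trie_of in_Olist. Qed.

Lemma is_lead_leadl k m : is_lead k m = (leadl m == k).
Proof.
apply/is_leadP/eqP => [[mk m0]|lk].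
  apply/eqP; rewrite eqn_leq; apply/andP; split.
    rewrite leqNgt; apply/negP => /(before_find 0); rewrite -(mnm_nth 0).
    by rewrite mk.
  rewrite leqNgt; apply/negP => lt_l.
  have sl : (leadl m < size m)%N by rewrite size_mnm (ltn_trans lt_l).
  have := nth_find 0 (etrans (has_find _ _) sl).
  by rewrite -/(leadl m) -[leadl m]/(val (Ordinal (ltn_trans lt_l (ltn_ord k)))) -(mnm_nth 0) m0.
have sl : (leadl m < size m)%N by rewrite size_mnm lk.
split=> [|j lt_jk].
  by have := nth_find 0 (etrans (has_find _ _) sl); rewrite -/(leadl m) lk -(mnm_nth 0).
rewrite -lk in lt_jk; have := before_find 0 lt_jk; rewrite -(mnm_nth 0).
by case: (m j).
Qed.

Hypothesis h0 : (0 < nth 0 h 0)%N.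

Lemma in_O0 : in_O h (0%MM : 'X_{1..n}).
Proof.
rewrite /in_O mdeg0 [X in (X < _)%N](_ : _ = 0) //; apply/eqP; rewrite cards_eq0.
apply/eqP/setP => m; rewrite !inE mdeg_eq0; apply/negP => /andP[/eqP ->].
by rewrite ltxx.
Qed.

Lemma in_nonOlist l : size l = n -> (l \in NO) = ~~ in_O h (mon n l) && (sumn l <= s)%N.
Proof.
move=> sl; rewrite mem_filter lookup_Otrie //; have [//|nO /=] := boolP (in_O _ _).
apply/flattenP/idP => [[_ /mapP[e + ->]]|le_s].
  by rewrite mem_iota mem_monos => /andP[_ lt_e] /andP[_ /eqP ->]; rewrite -ltnS -add1n.
exists (monos n (sumn l)); last by rewrite mem_monos sl !eqxx.
apply/map_f; rewrite mem_iota add1n ltnS le_s andbT lt0n; apply: contraNneq nO.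
move=> l0; have /eqP -> : mon n l == 0%MM by rewrite -mdeg_eq0 mdeg_mon // l0.
exact: in_O0.
Qed.

Lemma nonOlist_size l : l \in NO -> size l = n.
Proof.
rewrite mem_filter => /andP[_ /flattenP[_ /mapP[e _ ->]]].
by rewrite mem_monos => /andP[/eqP].
Qed.

Lemma all_iota (P : nat -> bool) : all P (iota 0 n) = [forall k : 'I_n, P k].
Proof.
apply/allP/forallP => [aP k|fP k]; first by apply: aP; rewrite mem_iota /=.
by rewrite mem_iota => lt_kn; apply: (fP (Ordinal lt_kn)).
Qed.

Lemma LMlist_size l : l \in LM -> size l = n.
Proof. by rewrite mem_filter => /andP[_ /nonOlist_size]. Qed.

Lemma in_LMlist l : size l = n -> (l \in LM) = in_LM h (mon n l).
Proof.
move=> sl; rewrite mem_filter in_nonOlist // all_iota /in_LM /in_border mdeg_mon //.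
have -> : [forall k : 'I_n, (nth 0 l k == 0) || lookup (dn k l) tO]
  = [forall k : 'I_n, (0 < mon n l k)%N ==> in_O h (mon n l - U_(k))%MM].
  by apply: eq_forallb => k; rewrite lookup_Otrie ?size_dn // mon_dn monE implybE -eqn0Ngt.
have [Ol|nO] := boolP (in_O _ _); first by rewrite andbF.
case: (sumn l <= s)%N; rewrite ?andbF //= !andbT.
apply/forallP/andP => [dO|[_ /forallP //]]; split; last exact/forallP.
have [k /andP[lk _]] : exists k, is_lead k (mon n l).
  by apply: is_lead_exists; apply: contraNneq nO => ->; apply: in_O0.
by apply/existsP; exists k; rewrite lk; apply: (implyP (dO k)).
Qed.

End MirrorCorrectness.

(** * Soundness of the combinatorial check *)

Section AdmissibilityCheck.
Variables (h : seq nat) (n : nat).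
Local Notation s := (socdeg h).
Implicit Types (l : seq nat) (m t u b : 'X_{1..n}) (k : 'I_n).
Local Notation O := (Olist h n).
Local Notation tO := (Otrie h n).
Local Notation NO := (nonOlist h n tO).
Local Notation LM := (LMlist n tO NO).
Hypothesis h0 : (0 < nth 0 h 0)%N.

(** Makes the head of a sublist its minimum, on which [chil] relies. *)
Lemma LMlist_sorted : pairwise (fun l l' => mon n l < mon n l')%O LM.
Proof.
apply/pairwise_filter/pairwise_filter.
apply: (@pairwise_flatten _ _ _ ltn) => [e|e e' lt_ee'|].
- have := monos_sorted n e.
  have /(sub_in_pairwise (P := fun l => l \in monos n e)) :
      {in monos n e &, subrel (fun l l' : seq nat => ((l : seqlexi nat) < (l' : seqlexi nat))%O)
        (fun l l' => mon n l < mon n l')%O}.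
    move=> l l'; rewrite !mem_monos => /andP[/eqP sl /eqP dl] /andP[/eqP sl' /eqP dl'].
    by rewrite mon_lt // dl dl'.
  by apply; apply/allP.
- apply/allrelP => l l'; rewrite !mem_monos => /andP[/eqP sl /eqP dl] /andP[/eqP sl' /eqP dl'].
  by apply: lt_mdeg_ltmc; rewrite !mdeg_mon // dl dl'.
by rewrite -sorted_pairwise; [apply: iota_ltn_sorted | apply: ltn_trans].
Qed.

Lemma chilP k : keyl LM k -> [/\ chil LM k \in LM, leadl (chil LM k) = k &
  forall l, l \in LM -> leadl l = k -> (mon n (chil LM k) <= mon n l)%O].
Proof.
rewrite /keyl has_filter /chil => ne.
have mem (c : seq nat) : (c \in [seq c <- LM | leadl c == k]) = (leadl c == k) && (c \in LM).
  exact: mem_filter.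
have := pairwise_filter (fun c => leadl c == k) LMlist_sorted.
move: ne mem; case: [seq c <- LM | leadl c == k] => //= c cs _ mem /andP[c_min _].
have := mem c; rewrite mem_head => /esym/andP[/eqP lc cLM]; split=> // l lLM ll.
have := mem l; rewrite lLM ll eqxx inE; case: eqP => [-> _|_ /= /(allP c_min)/ltW //].
exact: lexx.
Qed.

Lemma key_mon_chil k : keyl LM k -> key_mon h k = mon n (chil LM k).
Proof.
move=> /chilP[cLM ck cmin]; have sc := LMlist_size cLM.
have LMc : in_LM h (mon n (chil LM k)) by rewrite -in_LMlist.
have lt_c : (mdeg (mon n (chil LM k)) < s.+1)%N by have /and3P[] := LMc.
have minP (b' : 'X_{1..n < s.+1}) : in_LM h b' -> is_lead k b' -> (mon n (chil LM k) <= b')%O.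
  move=> LMb kb; rewrite -(mon_val b'); apply: cmin.
    by rewrite in_LMlist ?size_mnm ?mon_val.
  by apply/eqP; rewrite -is_lead_leadl.
rewrite /key_mon; case: pickP => [b /and3P[LMb kb /forallP b_min]|/(_ (BMultinom lt_c))/negP[]].
  apply/eqP; rewrite eq_le minP // andbT.
  have := b_min (BMultinom lt_c); rewrite /= LMc is_lead_leadl val_mon // ck eqxx.
  exact.
rewrite /= LMc is_lead_leadl val_mon // ck eqxx /=.
by apply/forallP => b'; apply/implyP => /andP[]; apply: minP.
Qed.

Hypothesis chk : adm_check h n.

Lemma NO_keyl l : l \in NO -> keyl LM (leadl l).
Proof. by have /and5P[_ _ _ /allP keyP _] := chk; apply: keyP. Qed.

(** Key variables are defined by all monomials outside O of degree at most s, [keyl] only by LM;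
    [adm_check] supplies the implication from the former to the latter. *)
Lemma is_keyE k : is_key h k = keyl LM k.
Proof.
apply/existsP/idP => [[m /andP[/andP[nO le_m]]]|].
  rewrite is_lead_leadl => /eqP <-; apply: NO_keyl.
  by rewrite in_nonOlist ?size_mnm // mon_val nO -mdeg_sumn -ltnS bmdeg.
move=> /chilP[cLM ck _]; have sc := LMlist_size cLM.
move: cLM; rewrite in_LMlist // => LMc; have nO := in_LM_notin_O LMc.
have lt_c : (mdeg (mon n (chil LM k)) < s.+1)%N by have /and3P[] := LMc.
exists (BMultinom lt_c); rewrite /in_N nO is_lead_leadl /= val_mon // ck eqxx andbT.
by rewrite ltnW.
Qed.

Lemma lead_key k m : ~~ in_O h m -> (mdeg m <= s)%N -> is_lead k m -> keyl LM k.
Proof.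
move=> nO le_m; rewrite is_lead_leadl => /eqP <-; apply: NO_keyl.
by rewrite in_nonOlist ?size_mnm // mon_val nO -mdeg_sumn.
Qed.

Lemma key_expE k : keyl LM k -> key_exp h k = nth 0 (chil LM k) k.
Proof. by move=> kk; rewrite /key_exp key_mon_chil // monE. Qed.

Lemma size_hatl k : keyl LM k -> size (hatl LM k) = n.
Proof.
by move=> /chilP[/LMlist_size sc _ _]; rewrite /hatl size_set_nth sc; apply/maxn_idPr.
Qed.

Lemma key_hatE k : keyl LM k -> key_hat h k = mon n (hatl LM k).
Proof.
move=> kk; rewrite /key_hat key_mon_chil // key_expE //; apply/mnmP => i.
rewrite mnmBE mulmnE mnm1E !monE nth_set_nth /= eq_sym -val_eqE.
by case: eqP => [->|_]; rewrite ?mul1n ?subnn ?mul0n ?subn0.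
Qed.

Lemma dvdl_mon l l' : size l = n -> size l' = n -> dvdl l l' = (mon n l <= mon n l')%MM.
Proof.
move=> sl sl'; rewrite /dvdl all2E sl sl' eqxx /=.
apply/(all_nthP (0, 0))/forallP => [aP k|fP i].
  have := aP k; rewrite size_zip sl sl' minnn ltn_ord nth_zip ?sl //= => /(_ isT).
  by rewrite !monE.
rewrite size_zip sl sl' minnn => lt_in; rewrite nth_zip ?sl //=.
by have := fP (Ordinal lt_in); rewrite !monE.
Qed.

Lemma mem_Tlist k t : keyl LM k ->
  ((t : seq nat) \in Tlist h O LM k) =
    [&& in_O h t, mdeg t != s, (mdeg (key_mon h k) <= mdeg t)%N & (key_hat h k <= t)%MM].
Proof.
move=> kk; have [cLM _ _] := chilP kk.
rewrite mem_filter in_Olist ?size_mnm // mon_val -mdeg_sumn key_mon_chil // key_hatE //.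
rewrite mdeg_mon ?(LMlist_size cLM) // dvdl_mon ?size_mnm ?size_hatl // mon_val.
by rewrite andbC.
Qed.

Lemma in_Tlist k u : keyl LM k ->
  in_T h k u = (((u + key_hat h k)%MM : seq nat) \in Tlist h O LM k).
Proof.
move=> kk; rewrite mem_Tlist // /in_T /in_TM; case: in_O => //=.
by rewrite lem_addl andbT.
Qed.

Lemma Tlist_size k l : l \in Tlist h O LM k -> size l = n.
Proof. by rewrite mem_filter => /andP[_ /Olist_size]. Qed.

Lemma size_Olist : size O = sumn h.
Proof. by have /and3P[/eqP] := chk. Qed.

Lemma size_Omon : size [seq mon n l | l <- O] == sumn h.
Proof. by rewrite size_map size_Olist. Qed.

Definition Obasis : (sumn h).-tuple 'X_{1..n} := Tuple size_Omon.

Lemma mem_Obasis m : (m \in Obasis) = in_O h m.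
Proof.
rewrite memtE /=; apply/mapP/idP => [[l lO ->]|Om].
  by rewrite -in_Olist ?(Olist_size lO).
by exists (m : seq nat); rewrite ?mon_val // in_Olist ?size_mnm // mon_val.
Qed.

Lemma Obasis_order : order_ideal Obasis.
Proof.
have /and3P[_ uO /andP[/allP dO _]] := chk.
split; first by rewrite map_inj_in_uniq // => l l' /Olist_size sl /Olist_size sl'; apply: mon_inj.
have step m k : in_O h m -> (0 < m k)%N -> in_O h (m - U_(k))%MM.
  move=> Om mk; have mO : (m : seq nat) \in O by rewrite in_Olist ?size_mnm // mon_val.
  have := dO _ mO; rewrite all_iota => /forallP/(_ k); rewrite -(mnm_nth 0) eqn0Ngt mk /=.
  by rewrite lookup_Otrie ?size_dn ?size_mnm // mon_dn mon_val.
move=> m m'; rewrite !mem_Obasis => Om le_m'm.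
elim: {m}(mdeg m) {-2}m (leqnn (mdeg m)) Om le_m'm => [|d IHd] m.
  rewrite leqn0 mdeg_eq0 => /eqP -> O0 /mnm_lepP le0; suff -> : m' = 0%MM by [].
  by apply/mnmP => k; have := le0 k; rewrite mnm0E; case: (m' k).
move=> le_d Om le_m'; have [->|ne] := eqVneq m' m; first by [].
have [k lt_k] : exists k, (m' k < m k)%N.
  apply/existsP; apply: contraNT ne; rewrite negb_exists => /forallP ge.
  apply/eqP/mnmP => k; apply/eqP; rewrite eqn_leq (mnm_lepP le_m') /=.
  by rewrite leqNgt.
have mk : (0 < m k)%N by apply: leq_ltn_trans lt_k.
have mE : m = (U_(k) + (m - U_(k)))%MM by rewrite addmC submK // lep1mP -lt0n.
apply: (IHd (m - U_(k))%MM); last 2 first.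
- exact: step.
- apply/mnm_lepP => i; rewrite mnmBE mnm1E; case: eqP => [<-|_]; last by rewrite subn0 (mnm_lepP le_m').
  by rewrite subn1 -ltnS prednK.
by move: le_d; rewrite mE mdegD mdeg1 add1n addmC addmK ltnS.
Qed.

Lemma Obasis_admissible : admissible h Obasis.
Proof.
have /and5P[_ _ _ _ /and3P[/allP shortP]] := chk.
rewrite !all_iota => /forallP crossP /forallP lowerP.
have in_NO m : ~~ in_O h m -> (mdeg m <= s)%N -> (m : seq nat) \in NO.
  by move=> nO le_m; rewrite in_nonOlist ?size_mnm // mon_val nO -mdeg_sumn.
have leadlE k m : is_lead k m -> leadl m = k by rewrite is_lead_leadl => /eqP.
split.
- exact: Obasis_order.
- exact: mem_Obasis.
- move=> m m' dm le_m'm; rewrite /in_O -dm; apply: leq_ltn_trans.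
  apply/subset_leq_card/subsetP => x; rewrite !inE => /andP[-> /= lt_x].
  exact: lt_le_trans lt_x le_m'm.
- move=> k; rewrite is_keyE => kk; have [cLM ck _] := chilP kk; have sc := LMlist_size cLM.
  by rewrite key_mon_chil // -in_LMlist // is_lead_leadl val_mon // ck.
- move=> m k u nO le_m lead_m lt_mk Tu; have kk := lead_key nO le_m lead_m.
  have := shortP _ (in_NO m nO le_m); cbv zeta; rewrite (leadlE _ _ lead_m) -key_expE // -(mnm_nth 0 m).
  rewrite leqNgt lt_mk /= => /allP/(_ (u + key_hat h k)%MM); rewrite -in_Tlist // => /(_ Tu).
  rewrite -!mdeg_sumn -(mdeg_mon (size_hatl kk)) -key_hatE // mdegD addnK => lt_s.
  apply: leq_trans lt_s _; rewrite mdegD leq_add2r leq_subLR -[m k]mul1n -(mdeg1 k) -mdegMn -mdegD.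
  rewrite !mdegE; apply: leq_sum => i _; rewrite mnmDE mnmBE !mulmnE mnm1E.
  by case: eqP => [->|_]; rewrite ?mul1n ?mul0n ?subn0 ?leq_addr.
- move=> m k j t nO lt_m lead_m lt_jk Ot /andP[le_mt lt_t].
  have /allP/(_ (t : seq nat)) := crossP j; rewrite in_Olist ?size_mnm // mon_val => /(_ Ot).
  (* m is among the monomials over which the minimum e is taken, so e <= deg m <= deg t and the
     check applies to t. *)
  rewrite -mdeg_sumn [s <= _]leqNgt lt_t orbF ifF; last first.
    apply/negbTE; rewrite -leqNgt; apply: leq_trans le_mt.
    have : (m : seq nat) \in [seq l <- NO | (j < leadl l)%N].
      by rewrite mem_filter (leadlE _ _ lead_m) lt_jk in_NO // ltnW.
    move: [seq l <- NO | _] => r; elim: r => //= l r IHr; rewrite inE => /orP[/eqP <-|/IHr].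
      by rewrite -mdeg_sumn geq_minl.
    by apply: leq_trans; apply: geq_minr.
  rewrite lookup_Otrie ?size_up ?size_mnm // in_LMlist ?size_up ?size_mnm // mon_up ?size_mnm // mon_val.
  case/and3P=> /allP t0 -> ->; split=> // i le_ij; apply/eqP/t0.
  rewrite (mnm_nth 0) -(nth_take (n0 := j.+1)) ?ltnS // mem_nth // size_take size_mnm.
  by case: ifP => //; rewrite ltnS.
move=> k u; rewrite is_keyE => kk; rewrite key_expE // => e1; rewrite in_Tlist // => Tu i le_ik.
have := lowerP k; rewrite e1 eqxx kk /= => /allP/(_ _ Tu)/allP t0.
have : (u + key_hat h k)%MM i == 0.
  apply: t0; rewrite (mnm_nth 0) -(nth_take (n0 := k.+1)) ?ltnS // mem_nth // size_take size_mnm.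
  by case: ifP => //; rewrite ltnS.
by rewrite mnmDE addn_eq0 => /andP[/eqP].
Qed.

End AdmissibilityCheck.

(** * The number of parameters *)

Section ParameterCount.
Variables (h : seq nat) (n : nat).
Local Notation s := (socdeg h).
Implicit Types (l : seq nat) (m t u b : 'X_{1..n}) (k : 'I_n).
Local Notation O := (Olist h n).
Local Notation tO := (Otrie h n).
Local Notation NO := (nonOlist h n tO).
Local Notation LM := (LMlist n tO NO).
Hypothesis h0 : (0 < nth 0 h 0)%N.
Hypothesis chk : adm_check h n.

Lemma uniq_NO : uniq NO.
Proof.
apply: filter_uniq; rewrite uniq_pairwise; apply: (@pairwise_flatten _ _ _ ltn) => [e|e e' lt_ee'|].
- by rewrite -uniq_pairwise monos_uniq.
- apply/allrelP => l l'; rewrite !mem_monos => /andP[_ /eqP dl] /andP[_ /eqP dl'] /=.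
  by apply: contraTneq lt_ee' => e''; rewrite -dl -dl' e'' /= ltnn.
by rewrite -sorted_pairwise; [apply: iota_ltn_sorted | apply: ltn_trans].
Qed.

Lemma TMlistE m : ((m : seq nat) \in TMlist h n) = in_TM h m.
Proof.
rewrite /in_TM -[X in in_O h X]mon_val in_O_mon ?size_mnm // /TMlist.
apply/idP/andP => [mO|[mO /eqP <-]]; last by rewrite mdeg_sumn.
have := mem_take mO; rewrite mem_monos -mdeg_sumn => /andP[_ ms].
by rewrite (eqP ms) eqxx.
Qed.

Lemma card_TM : #|[pred x : 'X_{1..n < s.+1} | in_TM h x]| = size (TMlist h n).
Proof.
apply: card_mon_list; first exact/take_uniq/monos_uniq.
  by move=> l /mem_take; rewrite mem_monos => /andP[/eqP -> /eqP ->].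
by move=> x; rewrite TMlistE.
Qed.

Lemma card_LM : #|[pred x : 'X_{1..n < s.+1} | in_LM h x]| = size LM.
Proof.
apply: card_mon_list; first exact/filter_uniq/uniq_NO.
  move=> l lLM; have sl := LMlist_size lLM; split=> //.
  by move: lLM; rewrite in_LMlist // => /and3P[_]; rewrite mdeg_mon.
by move=> x; rewrite in_LMlist ?size_mnm // mon_val.
Qed.

Lemma card_Cidx : #|{: Cidx h n}| = size (TMlist h n) * size LM.
Proof.
rewrite card_sig -card_TM -card_LM -cardX; apply: eq_card => p.
by rewrite !inE.
Qed.

(** Multiplication by [key_hat h k] identifies T_k with [Tlist]. *)
Lemma card_T k : is_key h k ->
  #|[pred u : 'X_{1..n < s.+1} | in_T h k u]| = size (Tlist h O LM k).
Proof.
rewrite (is_keyE h0 chk) => kk.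
pose sub (t : seq nat) : seq nat := (mon n t - key_hat h k)%MM.
have subK l : l \in Tlist h O LM k -> (mon n l - key_hat h k + key_hat h k)%MM = mon n l.
  move=> lT; have sl := Tlist_size lT; rewrite submK //.
  by move: lT; rewrite -{1}(val_mon sl) (mem_Tlist h0) // => /and4P[].
rewrite -(size_map sub); apply: card_mon_list.
- rewrite map_inj_in_uniq; first by have /and3P[_ uO _] := chk; apply: filter_uniq.
  move=> t t' tT t'T e; apply: (mon_inj (Tlist_size tT) (Tlist_size t'T)).
  by rewrite -(subK t tT) -(subK t' t'T); congr (_ + _)%MM; do 2!apply: val_inj.
- move=> _ /mapP[t tT ->]; rewrite size_mnm -mdeg_sumn; split=> //.
  have st := Tlist_size tT; have : in_O h (mon n t).
    by move: tT; rewrite -{1}(val_mon st) (mem_Tlist h0) // => /and4P[].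
  move/in_O_deg => le_s; rewrite ltnS; apply: leq_trans le_s.
  by rewrite -[X in _ <= mdeg X](subK t tT) mdegD leq_addr.
move=> u; rewrite inE (in_Tlist h0 _ kk); apply/idP/mapP => [uT|[t tT uE]].
  by exists ((u + key_hat h k)%MM : seq nat) => //; rewrite /sub mon_val addmK.
have -> : bmnm u = (mon n t - key_hat h k)%MM by do 2!apply: val_inj.
by rewrite subK // val_mon // (Tlist_size tT).
Qed.

Lemma card_Thidx : #|{: Thidx h n}|
  = sumn [seq size (Tlist h O LM j) | j <- iota 0 n & keyl LM j].
Proof.
rewrite sumnE big_map big_filter.
have -> : iota 0 n = index_iota 0 n by rewrite /index_iota subn0.
rewrite big_mkord card_sig -sum1_card.
rewrite (eq_bigl (fun q : 'I_n * 'X_{1..n < s.+1} => is_key h q.1 && in_T h q.1 q.2)) //.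
rewrite -(pair_big_dep (fun k => is_key h k) (fun k (v : 'X_{1..n < s.+1}) => in_T h k v) (fun _ _ => 1)) /=.
apply: eq_big => [k|k kk]; first by rewrite (is_keyE h0 chk).
by rewrite sum1_card -card_T.
Qed.

Lemma card_params : #|params h n| = nparams h n.
Proof. by rewrite /params !card_sum card_Cidx card_Thidx card_ord. Qed.

End ParameterCount.

Local Open Scope ring_scope.

(** * Tangent vectors as functions on pairs of monomials *)

Section TangentEquations.
Variables (K : fieldType) (n mu : nat) (B : mu.-tuple 'X_{1..n}).
Local Notation coordn := #|{: Defs.coord n mu}|.
Variables (v : 'I_coordn -> K) (w : 'rV[K]_coordn).
Hypotheses (oB : order_ideal B) (tw : chart_tangent B v w).
Hypothesis v_basis : forall k (j : 'I_mu), (U_(k) + tnth B j)%MM \in B ->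
  forall i, v (cidx k i j) = (tnth B i == (U_(k) + tnth B j)%MM)%:R.

Let der (p : {mpoly K[coordn]}) := \sum_q (p^`M(q)).@[v] * w 0 q.

Lemma derB p q : der (p - q) = der p - der q.
Proof.
rewrite /der -sumrB; apply: eq_bigr => i _.
by rewrite mderivB mevalB mulrBl.
Qed.

Lemma derD p q : der (p + q) = der p + der q.
Proof.
rewrite /der -big_split; apply: eq_bigr => i _ /=.
by rewrite mderivD mevalD mulrDl.
Qed.

Lemma derC c : der c%:MP = 0.
Proof. by rewrite /der big1 // => i _; rewrite mderivC meval0 mul0r. Qed.

Lemma der_sum (I : Type) (r : seq I) (F : I -> {mpoly K[coordn]}) :
  der (\sum_(i <- r) F i) = \sum_(i <- r) der (F i).
Proof. by apply: (big_morph der derD); rewrite -mpolyC0 derC. Qed.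

Lemma derM p q : der (p * q) = der p * q.@[v] + p.@[v] * der q.
Proof.
rewrite /der mulr_suml mulr_sumr -big_split; apply: eq_bigr => i _ /=.
by rewrite mderivM mevalD !mevalM mulrDl mulrAC mulrA.
Qed.

Lemma derX q : der 'X_q = w 0 q.
Proof.
rewrite /der (bigD1 q) //= mderivXU eqxx meval1 mul1r big1 ?addr0 // => i ne.
by rewrite mderivXU (negPf ne) meval0 mul0r.
Qed.

Lemma tangent_basis k i j : (U_(k) + tnth B j)%MM \in B -> w 0 (cidx k i j) = 0.
Proof.
move=> /tnthP[i0 Bi0]; have := tw (@chart_basis K n mu B k i0 j i (esym Bi0)).
by rewrite -/(der _) derB mxE derX -mpolyC_nat derC subr0.
Qed.

Lemma tangent_comm k l i j :
  \sum_p (w 0 (cidx k i p) * v (cidx l p j) + v (cidx k i p) * w 0 (cidx l p j)) =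
  \sum_p (w 0 (cidx l i p) * v (cidx k p j) + v (cidx l i p) * w 0 (cidx k p j)).
Proof.
have der_mul k' l' : der ((@gen_mx K n mu k' *m @gen_mx K n mu l') i j) =
    \sum_p (w 0 (cidx k' i p) * v (cidx l' p j) + v (cidx k' i p) * w 0 (cidx l' p j)).
  rewrite mxE der_sum; apply: eq_bigr => p _.
  by rewrite derM !mxE !derX !mevalXU.
apply/eqP; rewrite -!der_mul -subr_eq0 -derB; apply/eqP.
by have := tw (@chart_comm K n mu B k l i j); rewrite mxE [X in _ + X]mxE.
Qed.

(** For k != l put t = B_j / x_l; then B_j = x_l t and B_j' = x_k t. The columns of these products
    are fixed unit vectors, so the commutation equation at t reduces to the equality of the two
    entries. *)
Lemma tangent_border k l i j j' : (U_(k) + tnth B j = U_(l) + tnth B j')%MM ->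
  w 0 (cidx k i j) = w 0 (cidx l i j').
Proof.
move=> ebb; have [ekl|ne] := eqVneq k l.
  by move: ebb; rewrite ekl => /addmI/(tuple_uniqP _ oB.1) ->.
have lj : (0 < tnth B j l)%N.
  have /mnmP/(_ l) := ebb; rewrite !mnmDE !mnm1E eqxx (negPf ne) add0n => ->.
  by rewrite addn_gt0.
have jE : tnth B j = (U_(l) + (tnth B j - U_(l)))%MM by rewrite addmC submK // lep1mP -lt0n.
have tB : (tnth B j - U_(l))%MM \in B.
  by apply: (oB.2 (tnth B j)); [apply: mem_tnth | rewrite {2}jE lem_addl].
have /tnthP[t tE] := tB; rewrite tE in jE.
have j'E : tnth B j' = (U_(k) + tnth B t)%MM.
  by apply/(@addmI _ U_(l)%MM); rewrite -ebb jE !addmA [(U_(k) + _)%MM]addmC.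
have in_j : (U_(l) + tnth B t)%MM \in B by rewrite -jE mem_tnth.
have in_j' : (U_(k) + tnth B t)%MM \in B by rewrite -j'E mem_tnth.
have one k' l' j0 : (U_(l') + tnth B t)%MM \in B -> tnth B j0 = (U_(l') + tnth B t)%MM ->
    \sum_p (w 0 (cidx k' i p) * v (cidx l' p t) + v (cidx k' i p) * w 0 (cidx l' p t))
    = w 0 (cidx k' i j0).
  move=> inB j0E; rewrite (bigD1 j0) //= big1 ?addr0 => [|p ne'].
    by rewrite v_basis // j0E eqxx mulr1 (tangent_basis _ inB) mulr0 addr0.
  rewrite v_basis // (tangent_basis _ inB) mulr0 addr0 -j0E [_ == _](_ : _ = false) ?mulr0 //.
  by apply: contraNF ne' => /eqP/(tuple_uniqP _ oB.1) ->.
by rewrite -(one k l j in_j jE) -(one l k j' in_j' j'E) tangent_comm.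
Qed.

(** By [tangent_border] an entry depends only on the product monomial, so the unknowns can be
    indexed by monomials and not by matrix positions. *)
Lemma tangent_border_fun : exists W : 'X_{1..n} -> 'X_{1..n} -> K,
  (forall k i j, w 0 (cidx k i j) = W (U_(k) + tnth B j)%MM (tnth B i)) /\
  (forall b u, b \in B -> W b u = 0).
Proof.
pose P b u (q : Defs.coord n mu) := ((U_(q.1.1) + tnth B q.2)%MM == b) && (tnth B q.1.2 == u).
exists (fun b u => if b \in B then 0 else
  if [pick q | P b u q] is Some q then w 0 (cidx q.1.1 q.1.2 q.2) else 0).
split=> [k i j|b u ->] //; case: ifP => [/tangent_basis -> //|nB].
case: pickP => [[[k' i'] j'] /andP[/= /eqP eb /eqP/(tuple_uniqP _ oB.1) ->]|/(_ (k, i, j))].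
  exact/esym/tangent_border.
by rewrite /P /= !eqxx.
Qed.

End TangentEquations.

(** * Soundness of the propagation *)

Lemma sum_mem_seq (R : pzRingType) (T : eqType) (r s : seq T) (f : T -> R) :
  uniq r -> uniq s -> {subset s <= r} ->
  \sum_(x <- r) f x * (x \in s)%:R = \sum_(x <- s) f x.
Proof.
move=> ur us sr; under eq_bigr => x _ do rewrite mulr_natr mulrb.
rewrite -big_mkcond -big_filter; apply: perm_big; apply: uniq_perm => // [|x].
  exact: filter_uniq.
by rewrite mem_filter; case: (boolP (x \in s)) => // /sr ->.
Qed.

(** After the vanishing terms are dropped, one side is empty and the other consists of x alone. *)
Lemma sum_one_unknown (R : zmodType) (T : eqType) (s1 s2 : seq T) (f : T -> R) (P : pred T) x :
  \sum_(y <- s1) f y = \sum_(y <- s2) f y -> (forall y, P y -> f y = 0) ->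
  [seq y <- s1 ++ s2 | ~~ P y] = [:: x] -> f x = 0.
Proof.
move=> e12 P0; have restrict s : \sum_(y <- s) f y = \sum_(y <- [seq y <- s | ~~ P y]) f y.
  rewrite big_filter [RHS]big_mkcond; apply: eq_bigr => y _.
  by case: ifP => // /negbFE/P0.
rewrite filter_cat; move: e12; rewrite (restrict s1) (restrict s2).
case: [seq y <- s1 | ~~ P y] => [|y [|z r1]]; case: [seq y <- s2 | ~~ P y] => [|y' r2] //=.
- by rewrite big_nil big_cons => e [yx r20]; move: e; rewrite yx r20 big_nil addr0.
- by rewrite big_nil big_cons big_nil addr0 => e [<-].
Qed.

Section ListEquations.
Variables (h : seq nat) (n : nat).
Local Notation s := (socdeg h).
Local Notation O := (Olist h n).
Local Notation tO := (Otrie h n).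
Local Notation LM := (LMlist n tO (nonOlist h n tO)).
Hypotheses (h0 : (0 < nth 0 h 0)%N) (chk : adm_check h n).
Local Notation B := (Obasis chk).
Local Notation mu := (sumn h).
Local Notation coordn := #|{: Defs.coord n mu}|.
Variable c0 : seq (seq nat * seq nat).
Hypotheses (uniq_c0 : uniq c0)
  (c0P : forall p, p \in c0 -> (p.1 \in LM) && (p.2 \in TMlist h n)).
Local Notation nfl := (nf_list c0 tO).
Local Notation pre := (pre_list c0).
Implicit Types (l t i p b : seq nat).

Lemma uniq_O : uniq O.
Proof. by have /and3P[_ uO _] := chk. Qed.

Lemma TM_sub_O t : t \in TMlist h n -> t \in O.
Proof.
move=> tTM; have := mem_take tTM; rewrite mem_monos => /andP[/eqP st _].
rewrite in_Olist //; suff /andP[] : in_TM h (mon n t) by [].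
by rewrite -TMlistE // val_mon.
Qed.

Lemma O_down (k : 'I_n) t : t \in O -> (0 < nth 0 t k)%N -> dn k t \in O.
Proof.
move=> tO tk; have /and4P[_ _ /allP/(_ t tO)] := chk.
by rewrite all_iota => /forallP/(_ k); rewrite eqn0Ngt tk /= lookup_trie_of.
Qed.

Lemma LM_down (k : 'I_n) b : b \in LM -> (0 < nth 0 b k)%N -> dn k b \in O.
Proof.
rewrite mem_filter => /andP[+ _]; rewrite all_iota => /forallP/(_ k) + bk.
by rewrite eqn0Ngt bk /= lookup_trie_of.
Qed.

Lemma up_dn (k : 'I_n) b : size b = n -> (0 < nth 0 b k)%N -> up k (dn k b) = b.
Proof.
move=> sb bk; apply: (@mon_inj n); rewrite ?size_up ?size_dn //.
by rewrite mon_up ?size_dn // mon_dn addmC submK // lep1mP monE -lt0n.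
Qed.

Lemma dn_up (k : 'I_n) b : size b = n -> dn k (up k b) = b.
Proof.
move=> sb; apply: (@mon_inj n); rewrite ?size_dn ?size_up //.
by rewrite mon_dn mon_up // addmC addmK.
Qed.

Lemma nth_up (k : 'I_n) b : (0 < nth 0 (up k b) k)%N.
Proof. by rewrite nth_incr_nth eqxx. Qed.

Lemma LM_notin b : b \in LM -> b \notin O.
Proof.
by rewrite mem_filter mem_filter lookup_trie_of => /and3P[].
Qed.

Lemma nf_list_uniq m : uniq (nfl m).
Proof.
rewrite /nf_list; case: ifP => // _; rewrite map_inj_in_uniq ?filter_uniq //.
by case=> [b t] [b' t']; rewrite !mem_filter /= => /andP[/eqP -> _] /andP[/eqP -> _] ->.
Qed.

Lemma mem_nf_list m i : size m = n ->
  (i \in nfl m) = if m \in O then i == m else (m, i) \in c0.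
Proof.
move=> sm; rewrite /nf_list lookup_trie_of; case: ifP => _; first by rewrite inE.
apply/mapP/idP => [[[b t]]|mi]; last by exists (m, i); rewrite // mem_filter eqxx.
by rewrite mem_filter /= => /andP[/eqP -> bt] ->.
Qed.

Lemma nf_list_sub m : {subset nfl m <= O}.
Proof.
move=> i; rewrite /nf_list lookup_trie_of; case: ifP => [mO|_]; first by rewrite inE => /eqP ->.
by case/mapP=> p; rewrite mem_filter => /andP[_ /c0P/andP[_ /TM_sub_O]] + -> => //.
Qed.

Lemma mem_pre_list (k : 'I_n) i p : i \in O -> p \in O ->
  (p \in pre k i) = (i \in nfl (up k p)).
Proof.
move=> iO pO; have si := Olist_size iO; have sp := Olist_size pO.
rewrite mem_nf_list ?size_up // mem_cat.
have -> : (p \in if (0 < nth 0 i k)%N then [:: dn k i] else [::]) = (i == up k p).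
  case: ifP => [ik|]; last by case: eqP => // -> /negP[]; apply: nth_up.
  by rewrite inE; apply/eqP/eqP => [->|->]; rewrite ?up_dn ?dn_up.
have -> : (p \in [seq dn k q.1 | q <- c0 & (q.2 == i) && (0 < nth 0 q.1 k)%N]) = ((up k p, i) \in c0).
  apply/mapP/idP => [[[b t]]|bi]; last first.
    by exists (up k p, i); rewrite ?dn_up // mem_filter eqxx nth_up.
  rewrite mem_filter /= => /andP[/andP[/eqP -> bk] bt] ->.
  by have /andP[/LMlist_size sb _] := c0P bt; rewrite up_dn.
case: ifP => [upO|upO]; last by case: eqP => // e; rewrite -e iO in upO.
case: (boolP ((_, _) \in c0)) => [/c0P/andP[/LM_notin]|_]; last by rewrite orbF.
by rewrite upO.
Qed.

Lemma pre_list_sub (k : 'I_n) i : i \in O -> {subset pre k i <= O}.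
Proof.
move=> iO p; rewrite mem_cat => /orP[|/mapP[q]].
  by case: ifP => // ik; rewrite inE => /eqP ->; apply: O_down.
by rewrite mem_filter => /andP[/andP[_ qk] /c0P/andP[qLM _]] ->; apply: LM_down.
Qed.

Lemma pre_list_uniq (k : 'I_n) i : i \in O -> uniq (pre k i).
Proof.
move=> iO; have si := Olist_size iO; rewrite cat_uniq; apply/and3P; split.
- by case: ifP.
- apply/hasPn => _ /mapP[q + ->]; rewrite mem_filter => /andP[/andP[_ qk] /c0P/andP[qLM _]].
  case: ifP => // ik; rewrite inE; apply: contraNN (LM_notin qLM) => /eqP e.
  by rewrite -(up_dn (LMlist_size qLM) qk) e up_dn.
rewrite map_inj_in_uniq ?filter_uniq // => q q'; rewrite !mem_filter.
case/andP=> /andP[/eqP q2 qk] /c0P/andP[/LMlist_size sq _].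
case/andP=> /andP[/eqP q'2 q'k] /c0P/andP[/LMlist_size sq' _] e.
rewrite [q]surjective_pairing [q']surjective_pairing q2 q'2; congr (_, _).
by rewrite -(up_dn sq qk) e up_dn.
Qed.

Variables (K : fieldType) (v : 'I_coordn -> K) (w : 'rV[K]_coordn).
Hypotheses (tw : chart_tangent B v w)
  (vE : forall (k : 'I_n) (i p : 'I_mu), v (cidx k i p) = ((tnth B i : seq nat) \in nfl (up k (tnth B p)))%:R).
Variable W : 'X_{1..n} -> 'X_{1..n} -> K.
Hypotheses (WE : forall (k : 'I_n) (i j : 'I_mu), w 0 (cidx k i j) = W (U_(k) + tnth B j)%MM (tnth B i))
  (W0 : forall b u : 'X_{1..n}, b \in B -> W b u = 0).

(** The tries store an unknown as the single list b ++ i; as b has length n, the pair can be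
    recovered. *)
Definition list_coord (x : seq nat) : K := W (mon n (take n x)) (mon n (drop n x)).
Local Notation Wk := list_coord.

Lemma list_coord_cat b i : size b = n -> Wk (b ++ i) = W (mon n b) (mon n i).
Proof. by move=> sb; rewrite /list_coord take_size_cat // drop_size_cat. Qed.

Lemma list_coord_O b i : b \in O -> Wk (b ++ i) = 0.
Proof.
move=> bO; rewrite list_coord_cat ?(Olist_size bO) // W0 // mem_Obasis.
by rewrite -in_Olist ?(Olist_size bO).
Qed.

Lemma sum_Obasis (F : 'X_{1..n} -> K) : \sum_p F (tnth B p) = \sum_(l <- O) F (mon n l).
Proof. by rewrite -(big_tuple _ _ B xpredT F) /= big_map. Qed.

Definition half_terms (k l : nat) (t i : seq nat) :=
  [seq m ++ i | m <- direct c0 tO k l t] ++ shifted tO l t (pre k i).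

(** The product rule for an entry of M_k M_l: the variation of M_k gives [direct], that of M_l gives
    [shifted]. Unknowns at monomials of O vanish and are left out of the lists. *)
Lemma half_termsE (k l : 'I_n) (i t : 'I_mu) :
  \sum_p (w 0 (cidx k i p) * v (cidx l p t) + v (cidx k i p) * w 0 (cidx l p t)) =
  \sum_(x <- half_terms k l (tnth B t) (tnth B i)) Wk x.
Proof.
set ti : seq nat := tnth B t; set ii : seq nat := tnth B i.
have BO j : (tnth B j : seq nat) \in O.
  by rewrite in_Olist ?size_mnm // mon_val -(mem_Obasis chk) mem_tnth.
have [tO iO] : ti \in O /\ ii \in O by split; apply: BO.
have st : size ti = n := size_mnm _.
rewrite big_split big_cat big_map; congr (_ + _).
  pose F (m : 'X_{1..n}) := Wk (up k m ++ ii) * ((m : seq nat) \in nfl (up l ti))%:R.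
  transitivity (\sum_p F (tnth B p)).
    apply: eq_bigr => p _; rewrite WE vE /F list_coord_cat ?size_up ?size_mnm //.
    by rewrite mon_up ?size_mnm // !mon_val.
  rewrite sum_Obasis big_seq (eq_bigr (fun p => Wk (up k p ++ ii) * (p \in nfl (up l ti))%:R)); last first.
    by move=> p pO; rewrite /F val_mon // (Olist_size pO).
  rewrite -big_seq sum_mem_seq ?uniq_O ?nf_list_uniq //; last exact: nf_list_sub.
  rewrite /direct big_filter big_map [RHS]big_mkcond; apply: eq_bigr => p _.
  by rewrite lookup_trie_of; case: ifP => // /negbFE/list_coord_O.
pose F (m : 'X_{1..n}) := Wk (up l ti ++ m) * ((m : seq nat) \in pre k ii)%:R.
transitivity (\sum_p F (tnth B p)).
  apply: eq_bigr => p _; rewrite WE vE /F list_coord_cat ?size_up //.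
  by rewrite mon_up // !mon_val -mem_pre_list // mulrC.
rewrite sum_Obasis big_seq (eq_bigr (fun p => Wk (up l ti ++ p) * (p \in pre k ii)%:R)); last first.
  by move=> p pO; rewrite /F val_mon // (Olist_size pO).
rewrite -big_seq sum_mem_seq ?uniq_O ?pre_list_uniq //; last exact: pre_list_sub.
rewrite /shifted lookup_trie_of; case: ifP => [upO|_]; last by rewrite big_map.
by rewrite big_nil big1 // => p _; apply: list_coord_O.
Qed.

Lemma half_terms_sym (k l : 'I_n) t i : t \in O -> i \in O ->
  \sum_(x <- half_terms k l t i) Wk x = \sum_(x <- half_terms l k t i) Wk x.
Proof.
have OB l' : l' \in O -> exists j, (tnth B j : seq nat) = l'.
  move=> lO; have : mon n l' \in B by rewrite mem_Obasis // -in_Olist ?(Olist_size lO).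
  by case/tnthP=> j e; exists j; rewrite -e val_mon ?(Olist_size lO).
move=> /OB[t' <-] /OB[i' <-]; rewrite -!half_termsE.
exact: (tangent_comm tw).
Qed.

Definition sound (st : trie) := forall x, lookup x st -> Wk x = 0.

Lemma mark_step_sound (k l : 'I_n) (t i : seq nat) st : t \in O -> i \in O -> sound st ->
  sound (mark_step tO t k l (i, pre k i, pre l i) (direct c0 tO k l t) (direct c0 tO l k t) st).
Proof.
move=> tO iO sst; rewrite /mark_step -/(half_terms k l t i) -/(half_terms l k t i).
case E: [seq _ <- _ | _] => [|x [|y r]] // z; rewrite lookup_insert => /orP[/eqP ->|/sst //].
exact: (sum_one_unknown (half_terms_sym k l tO iO) sst E).
Qed.

Lemma solve_sound st sched : all (fun x => x.1.1 < size O)%N sched -> sound st ->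
  sound (solve n c0 O tO st sched).
Proof.
rewrite /solve; elim: sched st => //= -[[t k] l] sched IHs st /andP[/= lt_t okS] sst.
apply: IHs => //; rewrite /solve_step.
have tO : nth [::] O t \in O by apply: mem_nth.
move: (nth [::] O t) tO => {lt_t}t tO.
have zips0 (T S : Type) (r : seq T) : zip r ([::] : seq S) = [::] by case: r.
(* A variable index out of range selects the default empty list, so that such a step of the schedule
   changes nothing. *)
have [lt_k|ge_k] := ltnP k n; last first.
  by rewrite [X in zip (zip _ X)]nth_default ?size_map ?size_iota // zips0; case: (nth _ _ _).
have [lt_l|ge_l] := ltnP l n; last first.
  by rewrite [X in zip _ X]nth_default ?size_map ?size_iota // zips0.
rewrite !(nth_map 0) ?size_iota // !nth_iota // !add0n.
rewrite -[k]/(val (Ordinal lt_k)) -[l]/(val (Ordinal lt_l)).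
move: (Ordinal lt_k) (Ordinal lt_l) => {lt_k}k' {lt_l}l'.
have : {subset O <= O} by [].
move: {1 3 4 5}O => r; elim: r st sst => //= i r IHr st sst sub.
apply: IHr => [|j jr]; last by apply: sub; rewrite inE jr orbT.
by apply: mark_step_sound => //; apply: sub; rewrite mem_head.
Qed.

Lemma solved_zero st : sound st -> solved n O tO st -> w = 0.
Proof.
move=> sst; rewrite /solved all_iota => /forallP okst.
apply/rowP => q; rewrite mxE; have [k [i [j ->]]] := cidxP q; rewrite WE.
have BO (l : 'I_mu) : (tnth B l : seq nat) \in O.
  by rewrite in_Olist ?size_mnm // mon_val -(mem_Obasis chk) mem_tnth.
have sj : size (up k (tnth B j)) = n by rewrite size_up ?size_mnm.
have <- : Wk (up k (tnth B j) ++ tnth B i) = W (U_(k) + tnth B j)%MM (tnth B i).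
  by rewrite list_coord_cat // mon_up ?size_mnm // !mon_val.
have /allP/(_ _ (BO j))/orP[|/allP/(_ _ (BO i))/sst //] := okst k.
by rewrite lookup_trie_of => /list_coord_O.
Qed.

End ListEquations.

(** * Rigidity of the distinguished ideal of a certificate *)

Section RigidPoint.
Variables (h : seq nat) (n : nat).
Local Notation s := (socdeg h).
Local Notation O := (Olist h n).
Local Notation tO := (Otrie h n).
Local Notation LM := (LMlist n tO (nonOlist h n tO)).
Local Notation TM := (TMlist h n).
Hypotheses (h0 : (0 < nth 0 h 0)%N) (chk : adm_check h n).
Local Notation B := (Obasis chk).
Local Notation mu := (sumn h).
Local Notation coordn := #|{: Defs.coord n mu}|.
Local Notation admB := (Obasis_admissible h0 chk).
Hypothesis mu_gt0 : (0 < mu)%N.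
Variable (K : closedFieldType) (c0 : seq (seq nat * seq nat)) (tr : seq nat).
Hypotheses (uniq_c0 : uniq c0) (c0P : all (fun p => (p.1 \in LM) && (p.2 \in TM)) c0)
  (trP : all (fun j => j < size O)%N tr).

Definition rigid_C (p : Cidx h n) : K :=
  (((bmnm (val p).2 : seq nat), (bmnm (val p).1 : seq nat)) \in c0)%:R.

Local Notation L := (nf_coef rigid_C (fun=> 0)).

Lemma rigid_nf_coef (m t : 'X_{1..n}) : in_O h t ->
  L m t = ((t : seq nat) \in nf_list c0 tO m)%:R.
Proof.
move=> Ot; have c0P' p : p \in c0 -> (p.1 \in LM) && (p.2 \in TM) by move/(allP c0P).
rewrite mem_nf_list ?size_mnm // in_Olist ?size_mnm // mon_val.
have [Om|nOm] := boolP (in_O h m).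
  rewrite nf_coefO //; suff -> : ((t : seq nat) == m) = (m == t) by [].
  by rewrite -!val_eqE /= eq_sym.
have [/andP[LMm TMt]|nLT] := boolP (in_LM h m && in_TM h t).
  rewrite nf_coef_LM //.
  by rewrite (Ccoef_fun (fun t m : 'X_{1..n} => (((m : seq nat), (t : seq nat)) \in c0)%:R : K)).
rewrite [_ \in c0](_ : _ = false); last first.
  apply: contraNF nLT => /c0P'/andP[/=]; rewrite in_LMlist ?size_mnm // mon_val => ->.
  by rewrite TMlistE.
have [lt_sm|le_ms] := ltnP s (mdeg m); first by rewrite nf_coef_high.
by rewrite (nf_coefE admB) // big1 ?oppr0 // => q _; rewrite mul0r.
Qed.

Local Notation x0 := (translate_point admB mu_gt0 (pack rigid_C (fun=> 0) (fun=> 0))).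

Lemma rigid_coords_nf v (k : 'I_n) (i p : 'I_mu) : chart_coord B x0 v ->
  v (cidx k i p) = L (U_(k) + tnth B p)%MM (tnth B i).
Proof.
move=> [qb vP]; set m := (U_(k) + tnth B p)%MM.
have Ix : x0 ('X_[m] - \sum_i L m (tnth B i) *: 'X_[tnth B i]).
  rewrite /= /translate_ideal param_C_pack param_th_pack param_a_pack shift0.
  by have := nf_idealB admB rigid_C (fun=> 0) 'X_[m]; rewrite nfX.
exact: (quotient_basis_inj (hilb_is_ideal x0) qb (vP k p) Ix i).
Qed.

Lemma rigid_coords v : chart_coord B x0 v ->
  forall (k : 'I_n) (i p : 'I_mu),
  v (cidx k i p) = ((tnth B i : seq nat) \in nf_list c0 tO (up k (tnth B p)))%:R.
Proof.
move=> xv k i p; have Oi : in_O h (tnth B i) by rewrite -(mem_Obasis chk) mem_tnth.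
rewrite (rigid_coords_nf _ _ _ xv) rigid_nf_coef //; suff -> : up k (tnth B p) = (U_(k) + tnth B p)%MM by [].
rewrite -[LHS](@val_mon n) ?size_up ?size_mnm //.
by rewrite mon_up ?size_mnm // mon_val.
Qed.

(** The unknowns [(b, u)] that correspond to the parameters, as in [rigid_marks]. *)
Definition param_key (x : params h n) : 'X_{1..n} * 'X_{1..n} :=
  match x with
  | inl (inl p) => (bmnm (val p).2, bmnm (val p).1)
  | inl (inr q) => (key_mon h (val q).1, (bmnm (val q).2 + key_hat h (val q).1)%MM)
  | inr k => let t := mon n (nth [::] O (nth 0%N tr k)) in ((U_(k) + t)%MM, t)
  end.

Lemma nth_tr_O k : nth [::] O (nth 0%N tr k) \in O.
Proof.
apply: mem_nth; have [lt_k|ge_k] := ltnP k (size tr).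
  exact: (all_nthP 0%N trP).
(* Past the end of [tr] the index defaults to 0, which is valid because O is not empty. *)
by rewrite nth_default // (size_Olist chk).
Qed.

Lemma param_coord (x : params h n) : exists q : Defs.coord n mu,
  ((U_(q.1.1) + tnth B q.2)%MM, tnth B q.1.2) = param_key x.
Proof.
have pos b u : in_LM h b -> in_O h u -> exists q : Defs.coord n mu,
    ((U_(q.1.1) + tnth B q.2)%MM, tnth B q.1.2) = (b, u).
  move=> LMb Ou; have /and3P[/andP[_ /existsP[k /andP[bk Ok]]] _ _] := LMb.
  have /tnthP[j jE] : (b - U_(k))%MM \in B by rewrite mem_Obasis.
  have /tnthP[i iE] : u \in B by rewrite mem_Obasis.
  by exists (k, i, j); rewrite /= -jE -iE addmC submK // lep1mP -lt0n.
case: x => [[p|q]|k] /=.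
- by have /andP[/andP[Op _] LMp] := valP p; apply: pos.
- have /andP[/(adm_key admB)[LMq _] /and3P[Oq _ _]] := valP q; exact: pos.
have tk := nth_tr_O k; have /tnthP[j jE] : mon n (nth [::] O (nth 0%N tr k)) \in B.
  by rewrite mem_Obasis -in_Olist // (Olist_size tk).
by exists (k, j, j); rewrite /= jE.
Qed.

(** The unknown (b, u) may sit at several entries of the matrices; one of them is chosen for each
    parameter. *)
Definition rigid_D_exists : exists D : 'I_#|params h n| -> 'I_coordn,
  forall x W (w : 'rV[K]_coordn),
  (forall (k : 'I_n) (i j : 'I_mu), w 0 (cidx k i j) = W (U_(k) + tnth B j)%MM (tnth B i)) ->
  w 0 (D (enum_rank x)) = W (param_key x).1 (param_key x).2.
Proof.
have /choice[D DE] := param_coord.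
exists (fun i => enum_rank (D (enum_val i))) => x W w WE; rewrite enum_rankK -DE /= -WE.
by case: (D x) => [[? ?] ?].
Qed.

Lemma rigid_marksP (W : 'X_{1..n} -> 'X_{1..n} -> K) :
  (forall x : params h n, W (param_key x).1 (param_key x).2 = 0) ->
  forall y, y \in rigid_marks h n O LM TM tr -> list_coord (n := n) W y = 0.
Proof.
move=> Wx y; rewrite !mem_cat => /or3P[].
- case/allpairsP => [[b t] [/= bLM tTM ->]]; have sb := LMlist_size bLM.
  have := mem_take tTM; rewrite mem_monos => /andP[/eqP st _].
  have LMb : in_LM h (mon n b) by rewrite -in_LMlist.
  have TMt : in_TM h (mon n t) by rewrite -TMlistE val_mon.
  rewrite list_coord_cat //.
  have lt_b : (mdeg (mon n b) < s.+1)%N by have /and3P[] := LMb.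
  have lt_t : (mdeg (mon n t) < s.+1)%N by have /andP[_ /eqP ->] := TMt.
  have pP : in_TM h (BMultinom lt_t) && in_LM h (BMultinom lt_b) by rewrite /= TMt.
  exact: (Wx (inl (inl (Sub (BMultinom lt_t, BMultinom lt_b) pP)))).
- case/flattenP => r /mapP[k]; rewrite mem_filter mem_iota => /andP[kk /= lt_k] -> {r}/mapP[t tT ->].
  have [k' kE] : exists k' : 'I_n, k = k' by exists (Ordinal lt_k).
  move: kk tT; rewrite {k lt_k}kE; move: k' => k kk tT.
  have st := Tlist_size tT; have [cLM _ _] := chilP kk.
  rewrite list_coord_cat ?(LMlist_size cLM) // -key_mon_chil //.
  have tT' : in_T h k (mon n t - key_hat h k)%MM.
    rewrite (in_Tlist h0) // submK ?val_mon //.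
    by move: tT; rewrite -{1}(val_mon st) (mem_Tlist h0) // => /and4P[].
  have hat_t : (key_hat h k <= mon n t)%MM.
    by move: tT; rewrite -{1}(val_mon st) (mem_Tlist h0) // => /and4P[].
  have lt_u : (mdeg (mon n t - key_hat h k)%MM < s.+1)%N.
    have /and3P[/in_O_deg le_s _ _] := tT'; rewrite ltnS; apply: leq_trans le_s.
    by rewrite mdegD leq_addr.
  have qP : is_key h k && in_T h k (BMultinom lt_u) by rewrite (is_keyE h0 chk) kk.
  have := Wx (inl (inr (Sub (k, BMultinom lt_u) qP))); rewrite /= submK //.
case/mapP => k; rewrite mem_iota => /= lt_k ->.
have [k' ->] : exists k' : 'I_n, k = k' by exists (Ordinal lt_k).
move: {k lt_k}k' => k.
have tk := nth_tr_O k; have st := Olist_size tk.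
rewrite list_coord_cat ?size_up // mon_up //; exact: (Wx (inr k)).
Qed.

Lemma rigid_point sched : all (fun x => x.1.1 < size O)%N sched ->
  solved n O tO (solve n c0 O tO (trie_of (rigid_marks h n O LM TM tr)) sched) ->
  exists D : 'I_#|params h n| -> 'I_coordn, forall v w, chart_coord B x0 v ->
  chart_tangent B v w -> (forall j, w 0 (D j) = 0) -> w = 0.
Proof.
move=> okS okst; have [D DE] := rigid_D_exists; exists D => v w xv tw wD.
have oB := adm_order admB; have vE := rigid_coords xv.
have c0P' p : p \in c0 -> (p.1 \in LM) && (p.2 \in TM) by move/(allP c0P).
have v_basis (k : 'I_n) (j : 'I_mu) : (U_(k) + tnth B j)%MM \in B ->
    forall i, v (cidx k i j) = (tnth B i == (U_(k) + tnth B j)%MM)%:R.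
  by rewrite mem_Obasis => Okj i; rewrite (rigid_coords_nf _ _ _ xv) nf_coefO // eq_sym.
have [W [WE W0]] := tangent_border_fun oB tw v_basis.
(* The propagation starts from the unknowns of the parameters, which vanish by [wD], and ends with
   all unknowns marked. *)
apply: (solved_zero WE W0 _ okst); apply: (solve_sound uniq_c0 c0P' tw vE WE W0 okS).
move=> y; rewrite lookup_trie_of; apply: rigid_marksP => x.
by rewrite -(DE x W w WE) wD.
Qed.

End RigidPoint.

(* Certificates for the sixteen Hilbert functions *)
Local Close Scope ring_scope.

(** The coefficients c_(t,b) equal to 1, as pairs of the indices of [b] in LM and of [t] in
TM; for each variable x_k, the index of a monomial [t] of O for which the coefficient of
[t] in NF(x_k t) detects the translation along x_k; and the order in which the
commutation equations of x_k and x_l at [t] are used. *)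
Definition certificate : Type := seq (nat * nat) * seq nat * seq BinNums.positive.

(** One boolean gathers all that depends on the Hilbert function, and K does not occur in it. A
    certificate is only a witness: the propagation along its schedule is carried out here. *)
Definition certified (p : seq nat * nat * nat * certificate) :=
  let: ((h, d, d0), (c0, tr, ps)) := p in let n := nth 0 h 1 in
  [&& 0 < n, 0 < nth 0 h 0, socdeg h < sumn h, n * sumn h == d0,
      adm_check h n, nparams h n == d & rigid_check h n c0 tr (schedule ps)].

Lemma certified_exists (cs : seq (seq nat * nat * nat * certificate)) x :
  all certified cs -> x \in [seq p.1 | p <- cs] -> exists c, certified (x, c).
Proof.
elim: cs => //= -[y c] cs IHcs /andP[cy /IHcs]; rewrite inE => IH /orP[/eqP ->|/IH //].
by exists c.
Qed.

Section CertifiedCase.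
Variables (K : closedFieldType) (charK0 : [pchar K]%R =i pred0).

Lemma certified_component h d d0 c : certified ((h, d, d0), c) ->
  let n := nth 0 h 1 in
  let mu := sumn h in
  let U : hilb K n mu -> Prop := translates (mod_distinguished h (mu := mu)) in
  [/\ elementary_component (zclosure U),
      has_dim (zclosure U) d,
      has_dim (principal_component (K := K) (n := n) (mu := mu)) d0 &
      sufficiently_general (fun C : Cidx h n -> K =>
        exists I : hilb K n mu,
          [/\ distinguished C I,
              exists2 e, tangent_dim I e & has_dim U e,
              zclosure U I &
              smooth_point I])].
Proof.
case: c => [[c0i tr] ps] /=.
set n := nth 0 h 1; case/and5P=> n_gt0 h0 lt_s /eqP <- /and3P[chk /eqP <-].
case/and5P=> uc c0P trP okS okst.
have mu_gt0 : 0 < sumn h by apply: leq_ltn_trans lt_s.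
have [D Drigid] := rigid_point h0 chk mu_gt0 K uc c0P trP okS okst.
have [Uel Udim Ugen] := mod_distinguished_component lt_s charK0 Drigid.
rewrite -(card_params h0 chk); split=> //.
exact: (principal_has_dim charK0 mu_gt0 n_gt0).
Qed.

End CertifiedCase.

Definition certificates := [::
 (([:: 1; 5; 9; 7], 123, 110),
  ([:: (3,6); (4,0); (5,5); (7,1); (8,2); (8,4); (9,4); (10,0); (11,2); (12,3); (14,1)],
   [:: 1; 5; 5; 5; 5],
   [:: 0x134b30b30a28c28b25425314308408328308238a30c0810441c41c304324304230430330210a10c10b041;
    0x120b24c20a28420420331318c2d32cc24a31418b14118410439c14414254a4d439334a2c114b0c11530c4;
    0x12822421cb14a31418c18314c10c10a10b2c20c204428a20230220c2ca2c42942931821011031020433d4;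
    0x11ca18c18b18a18114110a10130b1011020c40c208334330a29325324b18a1441431421411040c128b28c;
    0x114410210130b10110318b38a2cc2ca2c128b20a14314225324b18a30c18a2542d42cb20c20a1cb1cc102;
    0x120c20a0c128b29339328a29429328a20a30c18b1441421431020c40820840440430420411041cc1ca18c;
    0x11031cb20c20b34b2d428a2942cc25318c18a2542530c20c324a2d42d32ca2940830820840830811031cb;
    0x10c30830820811030c40c30c20c110210130b2d41ca1cb34b20a34b0c22932cb2ca2cc29424b24c084081;
    0x130a20b24c24a30a2cb2ca0440430840830820811031041cc1cb20c2d425420b2d324c24a14418b18a18c;
    0x11041020c10c30830820810840430410420c40c30c120a1441431421411ca1020440420c40c20c10c324a;
    0x11411442ca2d32ca0c229329428b18a24c24b24a2cc25324b24c20b10c10b24b38c10a10118c18b1cc103;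
    0x10c22932940c229328a20b24c24b24a2d42cb20c20a1cb1ca18b0c30c4143]%positive));
 (([:: 1; 5; 15; 7; 9], 268, 185),
  ([:: (0,0); (1,3); (7,3); (9,1); (9,4); (10,2); (11,4); (12,4); (12,7); (17,2); (18,0); (19,1);
   (20,0); (21,3); (23,6); (25,4); (26,1); (27,4)],
   [:: 6; 6; 12; 11; 11],
   [:: 0x11cb5c31c33416cb20a6c320268b1ca6831c254c18c54418458c58b18b58458318364b64c18a643644182;
    0x150144330c6942944031c46d36936546534d348348448b38238430230334c34b34434360b20b6032035cb;
    0x150a50c1812c228224b2046d35cc38b28b2436936542441cc5143cc28324c2ca29328a25424220c3c4502;
    0x145341c28c34b2c425434434331c2d360a20b18c3dc2841845ca5c250435c30420360c4c33cb38a2531c3;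
    0x11c21c11826d36d460b58a5822cb38328b20320218b18360360254351c3d329354a54b18c5421845c34ca;
    0x154c4134444415445014c24c14814434423d43024044013c33c23c13533933012c22042011cb1ca1c31c4;
    0x16035043cc3823412c32533042cc29328124c24b24a2421841822442412031c218a6546024ca5cb5832c1;
    0x130328428218a24c24a24224120220420220b20c35c1cc1ca1c41c31c11cc18b18c18a1841831821813c1;
    0x11831c41c31c22432442422c42543444d32c229329418a24c24124a24b20a20c1cb1ca44244440340b34c;
    0x130418a18c18b1cc1cb1ca24b24c24224a4cc30240440249c2442032022041cc18c18b18a18118b182181;
    0x12842531ca24b2412412032042032023c44cb44120a20b20c34b20144320218c2cc39428c2833843024c4;
    0x14c334c28428325344244a2c42543443433046d36936542d32932942532546534024013032d32cb293294;
    0x12013433422542c42c22d42532942cb2cc38a38234130a30b38b30b30a4c44c24d43042d42c325329428c;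
    0x14cb4814ca38c3832ca3824c238438338250330b30c48428b28c39328134a28b28128c28a3cb20b20a203;
    0x11c11c22432415044d34842422cc2c130a38a4822c328a2cb2ca2c120a28b2815014cc4c13414c32d4342;
    0x12c329329428a28228a29328218434a40340418318140430230328428128234a34b28c2d328a28b24a1ca;
    0x128a28c28328228425420a2022011c14c33443433423412ca2542c42c32c22c12cb28a2542c22d42532d3;
    0x12542c42c22c32932942533043012d32c22c12c42c22932941815134845024d330a30c3cc3cb3d338c28b;
    0x15015034814414023ca3c13c13813423ca3cc3015045033cb50248248330b38b38c38b3813ca38a30a2d3;
    0x16d3654501]%positive));
 (([:: 1; 5; 15; 7; 9; 11], 341, 240),
  ([:: (0,4); (1,1); (1,2); (1,4); (2,2); (7,0); (7,3); (8,0); (9,4); (10,0); (10,5); (12,0);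
   (12,4); (17,1); (17,2); (18,6); (19,1); (20,0); (21,4); (23,5); (24,3); (26,2); (27,0)],
   [:: 6; 6; 12; 11; 11],
   [:: 0x178374b40174474350134170c70b2814c14413c130148138188b64b84c84b64c18a883643844843644182;
    0x120b20c1cb31c24b24c24324458b18b5831838cc8c454b54318c54418480a80b8028037ca7cb7c27c378b;
    0x134428bbd3b93b14ad35ca5c244b40238b30a30244a4cb4836035c32026022032041c341c60b5cb20a60a;
    0x13832d329325330b85465425440b6d36932c3403404a5c4c34449dc99c6539138d385354c513893b5450a;
    0x13932c19d38948937033438d368c6843ca6946932942cc28c3cb50450328428380a8027ca7c22d4382384;
    0x154a5424433c22cb24218c184b1c44c5042c22541ca7cc7c350348240c3039136d329318b18350ca9334b;
    0x15842834c418224449c28c50b4443cc18a24c39c38a2c324a1cc1c41c280b8037cb78478370b78c5cc5c4;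
    0x129351c34b25334c30b30c28b28418b31c1cb54c18c54418418170c6542542dc2c4241a1474a74270458c;
    0x120c20a1841831c41c318c18a6d36d46d35024dc2ca49448a4814134844532d430a3c43816946934d334a;
    0x138330c3842544434413c138a38134128c1ca1c13132c129328224c38c24b2432422413ca30a24a24220b;
    0x170265454a5424c25014813c238a38b3022813013c43c34ca3c24c144a2ca3d33ca40334b34c2d3294253;
    0x141c18118c18a1821812c42c285478a7823c33c13422c170470320a2012041c318418341c182244484482;
    0x128328225424a24b1c224324224424220c1cb1c320245c1c21c41c31c21c118a18118b1841831822431c2;
    0x134134234130a20c20a28b28c3942cb9136d32932942548d38948936946932532d42ca2c32c229328a284;
    0x130140230240130128328c2813c434a4cb3443cc2cc2c22c14834822c43d33ca38c38a38238134b34c343;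
    0x124b1ca1c11cb3443413c339338b40438338234a20b34334230a2843042cc2ca5022c42c1493282302303;
    0x128a25429428b2842822c328a28125324a4c14c249348244248348424120b20a1cb35c1cc18c18b18b1cc;
    0x125329429344444228a2822cb2ca2842022015045023433422c42c34c22823023033023012c42c228328c;
    0x13043023012cc2cb2ca4015045015035022c42c33023032d42ca9139148d38d48938948532c2854654254;
    0x14442d34c328c28a28b25438434b34a34134334230a3cb3c13ca2d429329429338325334c30b30c30b2cb;
    0x128a28c2d32d42543cc28b28a28c5042cc2cb2ca2c42c329320320220118140450c282302303284453443;
    0x129325429428b25420220120320420320120b20a34b40340234a2534d33cb34c30b2d430a30c443441442;
    0x12d329428b28a28c2543cc38428b28a28328228450c28350350250a28228134234329329429325330b30c;
    0x129329425325465354c54b5445435014c13ca3821c130325429351c3dc34b34a4024042532942932d32d4;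
    0x12d3]%positive));
 (([:: 1; 5; 15; 9; 12], 332, 210),
  ([:: (7,1); (8,4); (9,9); (14,11); (17,2); (18,0); (19,4); (20,4); (22,6); (23,4); (23,8);
   (24,3)],
   [:: 6; 6; 12; 12; 13],
   [:: 0x168a1ca6836821c254c18c58c58b18b54418458458318364c64b64a18a6446436421827142d47547532d3;
    0x13423022c42c328b2831cb1cc1c31c460c60360450124c88a84a2ca28a28224a6cb6ca20a6c36c220268b;
    0x12442415cb4c24c448234a2cc34ca5c50438c3ca38330b30185c30360b20b20344b20451c44c442441404;
    0x128b6025ca5c35c251424249c4813d43cc38b38130c20b3c468428434b8dc38a34128c3042cb44335c24b;
    0x118368a6825cc54b5024c33442025421844144024013cb3c13822d42d32c224a54a18c31c1c1a1328244a;
    0x140c4024041814c16035435035045012431c21841831c41c34544033ca34324c3133023032cc2c118b182;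
    0x14415445022c449320320244344238c30c44430a30b3043032cb28328420b20c20a20118250c1cb34c48c;
    0x148144430a3c43cc39c38c3813d338a4823c234a34244c3432ca2c328124224118c18a18b1cc1cb34154c;
    0x12c224b24a20b3532011c318418218341418148134b3cb34a4ca60b4015833c33835143844c348a4834c2;
    0x14832442434824844c22814423d43c134434234330c30b3043034433024c440b3013022d37547137142d4;
    0x12021cb1ca1cc1ca1841831c41c21c345c1c418c18b18a7132d32d47145424d44c34943c338a38234b34a;
    0x138b34b3c234a34c3443433423413032cb2442432422c42c320a28b28c28a28328224b24220b20c20a203;
    0x14c450b4c24c124140224424224348220134330c30330230430b30a44438c38b4424413ca3c13cb3c1513;
    0x12424942442434822c138248334a3422813833813444d43035012442434824843c238248334b34a34c4c3;
    0x15014c148434434234330c24418218130430b30a44438c38b44244338c38a38b44234234434334244138c;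
    0x17132d32d47143ca64a502]%positive));
 (([:: 1; 5; 15; 10; 12], 347, 215),
  ([:: (1,4); (1,8); (3,2); (7,8); (8,3); (9,8); (11,11); (13,4); (16,8); (17,5); (17,11);
   (18,11); (19,1); (20,10); (21,4); (23,9); (26,0); (27,8)],
   [:: 6; 6; 12; 12; 13],
   [:: 0x148230a6c46c36c260c60b60a48130154c18c54418458c58b18b64c64b64a18a584583183644643642182;
    0x128c2047546043942032ca2cb74a71370b70a50a3c44c128428320c6cc6ca20a20b8822c44847442c32c2;
    0x17933cb3432422442022cc38a3cc68c44c4044038dc38b39c28a50b5024c43c33849d31c33025c44ca48a;
    0x160260454b58c58b5cb5cc4c338c34128b7d475374c5c39947041816844d43036035c23421c444344224c;
    0x148460378a78b54c54a3c238230c78274368258451434b2c22c318a18c1841cc30b60b74228224b7146cb;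
    0x12ca3932c12c32811cb18418271470268b64350350428228348345c44134230a20b20a1c181c85478c79c;
    0x130344279434c3cc38a3814ca34334130130b2c428a24324120c20420320220199c89c7933c14c170c4c4;
    0x134a30c1831813042cc2c42c128c2841ca7424044015147135cb54b5445425012424dc3824812c2482302;
    0x118c18b18a75475360b4c44c34c27137144c24c150150450348350248444344234244124b3d438238334b;
    0x14013011841813c430418c30c30124a2cc2ca2cb2ca2c42c228a20228328124a24120a2824932841c21c1;
    0x12421cb2432411c23c23843814814844022041c31c44033843833813cc3cb34c30b30a3024c4504402404;
    0x128220420320228349c4432431c241c4031c444440b24438b3ca24c3c334b28428134a1c33831ca1cb243;
    0x124a2cc39324b28c1ca1c379444338c34b38a3cc3cb44230340a38331438438220b20a3532c42c22012c3;
    0x13432cc28a2ca39328b28324b20a20220420320b20c1cb2432444441ca1cc38b28a20b20a35320c1cb1cc;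
    0x14044c34415035011c248a4044013c23433443844034027137144c24c43423447937533c44cb3c138b38c;
    0x144b1ca3833434ca4034543424c428c38b2c32c23c324c2c424224418c18a18b1cc44430434c341184182;
    0x11823c475324451c4543841c41c31c21c11841831821811831827544c44c34c2714713794793754344203;
    0x124c3c324c24a24b24a2cc38a38c24b2433dc34b30349424424220218c18a31418b1cc1c11c4182184183;
    0x124c7937547533c43c33c23c138c3ca38134434134279334434124a2cc2ca2cb20b20a28b28a28124b24a;
    0x12041c31c21c418418318224424324218c18b1cc4423cc3cb1cb1ca1c33d330230438a38c34234324b24a;
    0x134a3433027931cb20c2012047941cc1ca1c33833821841831c41c23423444034044c340438234b343342;
    0x175475375474a58a4423ca3443433c23c43c324c24a24b38c24c18c18a18b1cc1cb24324224444438b38a]%positive));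
 (([:: 1; 5; 15; 10; 15], 386, 230),
  ([:: (3,8); (6,11); (7,2); (8,4); (9,1); (9,8); (11,9); (13,14); (16,14); (17,0); (18,10);
   (19,4); (20,5); (21,14); (23,8); (24,4); (24,13)],
   [:: 6; 6; 12; 12; 13],
   [:: 0x118c58c18b544184584583183b4ab0aacaa8aa4a9ca98a8ca88a84a80a7ca64c64b64a18a644643642182;
    0x131c28458b48478a2ca7822c274a28a7422826cb6ca20a6c36c220268b68a1caac48c488468368248154c;
    0x134234130348b30ba1c7dc50181c34c2cb20b40238b2c35c320460320378c70c70270435460b60c5cb1cb;
    0x128b24c2444541c444c30a44340b3043ca2cc2c434a313283adc893403504494b1cad338248c4043c134b;
    0x12ca28a54a18c18189c74254264458a48320420345338b4c24c33cb34344274368368438a2c228c1cc30c;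
    0x118b95470a60a5ca58b7022c42822842834934822cb4942416ca68a5c358c41c51434a34b20c7035023c2;
    0x12cc24a24b38a38330a28120218318274a70460b48438130b2ca4c44017822c224a20b20a2011cb1c118a;
    0x124350238c4cc3c26034cb4c34c24c13ca3c16025845444814044033cc34c3c33031cb38b3541cc35c1ca;
    0x128b28a28124224418c18b3042441c41c218420420345c34444b30148c24144178a4c444340a40238b381;
    0x14c14034443ca3c13cc30c30a5033c33142c124b3c23cb38a50b24c24b38434b50a30b30a48a38330c2ca;
    0x14d340418120b35c30b31c1ca1c14131c41c318218418318250440140b64a34b34a34c3423413c3583502;
    0x13c438c38a31330a18440c30124c24a2cc2ca2cb2c22c428a28b28428324a20a2011cb18b18a183382344;
    0x138230c2c22c33831c338420345c2022832822841c22432422444444423023035024414c35015045034cb;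
    0x118418341c18240c3cc3ca34344c34240440340234b3d334c3cb3cc34331430a24424118c38c3013c4504;
    0x120c20b2042032021ca18c18a18170a4c14841c320420144334b34a34c3cb3443431c23ca342404403402;
    0x138a34b34a34c24c24b3cb3c23c138c34b34a34c3413cb34c34a34334434234134334138138330c281243;
    0x130b18c30c30a1c31c21c44021c418418318224450444230430224224350250330a30b4c224a2cc2c42c1;
    0x15c24423022442422435025034c23443423433cc34b34a34c3cb3ca4033ca3c238c38b38a38224c24b24a;
    0x17425cb]%positive));
 (([:: 1; 6; 5; 7], 132, 114),
  ([:: (3,1); (4,3); (8,6); (12,3); (13,3); (14,0); (15,2)],
   [:: 1; 1; 1; 4; 4; 4],
   [:: 0x10552152140541cd04d20d20c04c28d28c04b1c50452052040442852840432dc29d29c0dd0dc295294053;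
    0x10d546532518b14d0c30c53a50d40d30c40cd09325425309409508b24c24b08c08d0832442430840851d5;
    0x11830d518d14314411d0d305505404d04c18515514510410310c10b0c21130ca1421811020cb04214110d;
    0x114314518c0d50d311c11310d08b08229d29c0dd0dc2dc2142041850d40c40c51151951840810450440c3;
    0x110d18318518114b14214111310b0d40d30d50c40c30c509308308104b04321320b2031d31cb1c3182181;
    0x11131030c50c40c310c]%positive));
 (([:: 1; 6; 5; 7; 9], 186, 168),
  ([:: (3,0); (4,2); (4,3); (7,4); (8,8); (9,1); (13,0); (13,4); (14,2); (15,2); (15,3)],
   [:: 1; 1; 1; 4; 4; 4],
   [:: 0x13943543153142542532141d51d409405505412541529545545429405349c45c41d41c2dc29d29c0dd0dc;
    0x10450441a508b04b3cc3cb38c38b34c34b30d30c30b24c24b20c20b1cd1cc1cb08c04d04c1650933d43d3;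
    0x15254e56256656a510d10c10b0c40830433c43c33843833443433053043032442432042031c51c41c3084;
    0x111d10a18218a11318b1451410d30c204165461415414d0cb1041031840d50d414c1140cc18c5e55a5565;
    0x10cb0cd0c30d30cb2131d318411418c1040d511c14d0cc0cd1140ca0c514b14511514c08a082042144185;
    0x105304b3930dc0dd29c10311d1040d414d14c14b14341d41c45d45c49d49c10b15510c0dd0dc0d31030cc;
    0x13533131030d50d30d414d14b14c1030cd0cc0cb10c10d11311518514514314414b1411151130cd08b083]%positive));
 (([:: 1; 6; 10; 7; 9], 248, 198),
  ([:: (1,8); (2,6); (3,4); (4,0); (4,4); (5,0); (5,7); (6,5); (7,7); (7,8); (8,5); (8,6); (9,7);
   (10,1); (12,6); (13,0); (14,6); (14,7); (16,5); (17,3); (20,8); (21,2); (21,5); (22,1); (22,5);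
   (23,7)],
   [:: 1; 1; 5; 5; 5; 5],
   [:: 0x15955942132035451c30c114118110120c04c28c04b34a0811ca44d1cd48d48c1cc54d54c1cb04d34b04a;
    0x138c2d42cd2444952154d44d52142041c54841c450c24c24d40351345355d29d59c59d29c28224b2430ca;
    0x12d524520571c65c61c1d35dd50538231d08d3dd3132841450cb0835dc0c25d451404210a14a455454444;
    0x11d518418310c31c30d14d2941020455c508a0824134152dd2c30cc3932d32cc0c319314210d6e5405354;
    0x10ca1c50454c52c40c219d0c41442850c52956a54cc4cb40c35330308c50b35d3045dc2dc084085255254;
    0x118a2050441855042c50c441440a38234229d3252532441ca15410b10404145310d35c1d41811651050cd;
    0x136514518c35530b30224d2444c42040c318b14124c08c2cc08b08404244444538d285255085043284102;
    0x131c2dd14c0cc2541943d414a4551d54541c51c40456250441851841824954133942155145154d54d4214;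
    0x10435dd4155134933141d31cb1cd1cc18314d10d0c120d08d0820426e559d3952452442430841a53d539c;
    0x12dc2d32d528525324c21320b2031841811c208b04b16529318c14a14359414210c10a0cb0c50c2083044;
    0x10411d310359d1024533d33932141d43653542dd2dc08b5dc35331331c3dc31325319308339c55d29d325;
    0x10cd18318518210a14a14541314314214110a1040ca0cd0cc0cb0ca0c30c208a08208104d04a04504204b;
    0x128214d29410d10a0421050ca04310b14b2552542532422152142d421339d2151d51d41c51c41840cb0ca;
    0x10cb0ca0c12c329c21329431d29d2931d418418514c14514410d4143e53dd3132d331c32531429d315283;
    0x129c3153142dc2d41d32953942951d51d31821021051020450440420430c50c30c40c21031011ca1c210b;
    0x13d31831841441451021050433534153d439339514b04d04a10d10a10b35435535334a31d31c2dc29d2dd;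
    0x108210410510418318408a10c14c04342514b14d04531d31c2dc2dd2dc2952932151d5084083085044185;
    0x10433d53d43d338a2951d51d33552143542dd1d518308c08a08d08134231c084083085044185045044085;
    0x13944144133943952dc2dd29c31d2542551d304514d10a10c08a10c14c14b103105045042042105084085;
    0x13d339510508408219419c08504519d3d53d43931451431440c50c30c40831030c20c508c08d044355415;
    0x10821040cb0ca0c508c08a08304d04c04b04a04308d04c0cc15d0cb0cd15c0c308c08b41d4152dc0cc41c;
    0x108a0c208408504c08c16504a04410a10d10c10b0c30c50c414b14d3e535d2931d51d4144145084083085;
    0x131c31d2dc2dd29d29c2542552141d51d43542152132942542532142552542531d318404514d14c10c10d;
    0x131c0840850443d51851843953532552542532d42d529514c10c10d2942542552131d52142151d41d3355;
    0x114c10c10d29429539441449410210408241304531d]%positive));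
 (([:: 1; 6; 10; 9; 12], 302, 228),
  ([:: (1,1); (1,6); (1,7); (1,8); (3,5); (4,8); (6,9); (6,11); (8,4); (9,7); (10,9); (11,8);
   (11,10); (12,2); (12,7); (14,3); (15,1); (15,2); (16,11); (17,0); (18,2); (18,9); (19,3);
   (19,9); (19,10); (20,6); (21,10)],
   [:: 1; 1; 5; 5; 5; 5],
   [:: 0x11c51c404528234204234a14110154d28d60d28b58d58c58b28c04b04a545285605283585584583284043;
    0x12455cc2cc0cc30c0cb0cd2c40c43040c30c53c40c24c42040443cc0ca44d1cd04d4cc20c48d20d04c445;
    0x108365d5d45d310251451545545318314b1434d421449549421559559321338514a14224c24d182504244;
    0x118d14439308208561d3d525510a15310365c4135544548e514c14d8657e57a57256a561c6154d32d308a;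
    0x110438238a31d31310b1c235518510d08d6e55cb50c44431c31429410a0845551053d318441534b353253;
    0x114a1019656535c355340b3c339d39528d28524c1d41ca08c6551a54141d51654031d35d350331529310c;
    0x121520d20b4d52143a529436535420a1841441420ca08208165c51445528b28324a24418318214c254513;
    0x114d0852d514310c10b10a0c208a0844554531d53dd3132051850441550416a5614104102105394284253;
    0x108d1cd04d04a1c504504404241319539441c61c61d59455549549331c08b41441525424d24414b14a31d;
    0x125314d1433d53d439339c3531451441420820420435d34d448430a10251425424c10314c1041930c108a;
    0x131404a04b04d04c08d35d35c1d53552142151d435408365c31c31d2d32132932951d51d31d4183153144;
    0x10c50c408d08a0850840825132933d53d43d345510a4533533543953531451434154142d321339d3933dd;
    0x128a1ca1c41c210c10a10b08408308518518414c14b10a10114a14414110d0cc0cd0cc0ca10b10c1040cd;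
    0x135510b10c08c3d52d314d1441453d43932c229329425525424a1041031053942422041d41d31cd1cc14c;
    0x110314c14b4141d31431040cb0cc0c408b08308565c3133d331d18441541310539439361c31c31d61d353;
    0x118441508b08d2d33dc2d51d508c2942152132142151d43542552542532d42d52d32d42932541d5185182;
    0x10cd0cb0cc08b08a08b0cc0cb0cd0ca08c08b0cc0cb0cd0cb0ca10a10b0840830853951851830820813d3;
    0x139329435431531331c3032d32152132d52d42542552532d429329510d10a08a10c10b04d10d31315504b;
    0x10851431453d40840851040420450440430c50c30c40840820830850830c40c30c50c40c30c2103105394;
    0x13541d439539331d31c3141041053942532d42d51d32951d31d410510410308c14c08d08b08414b14d144;
    0x13d52932942542532552142132d339d2152142132941d508c3551d51d41d329529329408c355294293353;
    0x10842d414b0c30c50c30c210210314c14d14b10d08408b08a10c10b08408539518518408d08c08b415414;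
    0x108d35d1d53551d41d329514a10c08c08a08b08d31d31c3153143133dc0830c4254104105394254255253;
    0x131531d31331431c31329325425521421510d08d08c08b0cc0cb0cd04b04a08c08d3dd31429529404d04c;
    0x131529308c1d52951d335535431c]%positive));
 (([:: 1; 6; 10; 10; 9], 272, 216),
  ([:: (0,4); (0,8); (1,3); (2,7); (3,7); (4,0); (5,8); (6,5); (7,3); (8,4); (9,1); (9,2); (10,6);
   (12,5); (13,0); (13,2); (13,7); (14,2); (15,0); (15,1); (15,7); (16,7); (17,5); (18,8); (19,3);
   (20,1); (21,6); (23,5); (24,1); (25,8); (26,4); (26,6)],
   [:: 1; 1; 5; 5; 5; 5],
   [:: 0x11c45441c30824531d54944951d41821811010413c23822c22423022822023ca38a2ca24a14a30a28a20a;
    0x165461359d59c5955145134d44d330b3032cb2c328b28324c24b24424320c20b2042031d31cd1cc1cb1c5;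
    0x12cc2c428424d24520d20508565d04269454c40c40535314d14b10d28d0cd66555d61d61c625185184183;
    0x15030c219d2144133d43d528b0457dc04a6935d551550d48548445544c4453cd5dc1441433c338d30c304;
    0x14c308468b44d3143030cc0c33950c404d1954cb2933941941021031a510a10b2832850c520b08a08d683;
    0x121365c31330b0cb5dd54d3c235534d2d525525421520d2d418d65d1c504510c04c1040ca08c5454d54cd;
    0x155c25369c48304b3933823422942052cb08b5042440842951cd04d69d5952040852c52c42c30831a5594;
    0x10c418a50c24c08c20c08d0425d41d535d31331530b5cc2cc61529328318230d10a2d30cb15315d5dc043;
    0x128524d20a14a2cc0cc0c20c15934cc44541c40a40230321520b1cb18551551425414c14d14b0ca0c319d;
    0x144d0820813c23ca6542d32d52141cc1c304c04b10210316508a24408408268b64b59d61349541530a2cb;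
    0x104204161d6935141cd08b04d2540426535d404a5135150c208a4d44944554532ca29528a14514124c24a;
    0x138238a31331529324d24c24b20b1d335d1d51cc18418114d14c14214a14414259c59d18318210108c08a;
    0x135514b10a10b0ca0c108204c1c50454132143a52132943e51430cd10d04a0411026935c355d0c508d3d5;
    0x135329331530b2d32cb2542531d41cb1841831851840433935dc5dd1d536514b14a1441050cb0c3085215;
    0x118518414355d18518318404a10d55c1431426134545d34534154143d43d310c04d0453951d51d4355354;
    0x135521514c14b0855dd59c65d65361d4143d514514461c5dc59d59355d55c5134d410a0ca4d3413353143;
    0x12143542532d42d521521314b3533553544153551d31d51d41d329514d14b14c14561d61c2952151d41d3;
    0x118418318541341514d14c61d61c5dc5dd10a10b59c59d18355c55d1d329514d14c145415254255214215;
    0x141541441341541461c61d59c1021030cd04b3944143542933152132d51d421521425514304a10d0cd625;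
    0x108d61c1854134141451431443d529435335421421339504565d59c61c69d10210408d04c69c61d14d14c;
    0x114414521355d61d2d514d14c14b3553543532941d41d331529329529429355c1841830cb0ca10b10d0c5;
    0x129325514461c1453d52941441431451442942933532d33143153132d3293295294293255214213215214;
    0x141404d3d43d33d53933950ca10b10a08a04a04510c10d10b10c3d32d51d51d3295253255214215213294;
    0x10cb0ca0cc08b04569d10504d3d439565d3d33d52532d42d33d44134150c504304210504d69d3d42d5393;
    0x12d42542532d42d325510a0cb0ca0436655dc5dd10b10d10c10b08b0cc0cb0840850443940cd04b65c103;
    0x110c0c408c08d08304c08210469c65d3142d42542532552542532d42d32d52532d42d33933953942d32d5;
    0x110c10208b0cc08c08d08c08408504d04c65c41c3d310304b04504439439531331531331431525408c08a;
    0x108b0cc0cb0cd0cc08b08a10c1021030c40c20c504b25465d65c0443943930435dc04b0cd0cb0cc08b08a;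
    0x104d04c69c69d3d42d33133dc2d42d33935dc65c4130c30c21031053d43d53133143133d32542552532d4;
    0x169d69c0cb0cd0cc08c08b08d04c1040850c308408319c0c508504504304404210510308c08d08c04b104;
    0x10c40830821040831030c30c20c50c319c08408508408308210404c08d08c08b0cc0cb0cd04d04b04c69c;
    0x169d0cb0cc08c08b08d04c69c1041050840830c40c30c5]%positive));
 (([:: 1; 6; 21; 7; 9], 461, 264),
  ([:: (1,0); (2,3); (6,4); (7,2); (10,3); (11,4); (12,1); (16,2); (17,1); (19,6); (20,2); (20,4);
   (25,3); (27,4); (31,0); (32,2); (33,1); (34,8); (35,0); (36,4); (37,0); (39,5); (41,1); (41,4);
   (42,3); (45,0); (46,0); (47,2); (48,0); (48,2)],
   [:: 7; 7; 7; 13; 12; 12],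
   [:: 0x184c20b8442037541d474c1cc7441c47157141d570d70c1cd7057041c58158141d380d80c1cb8058041c3;
    0x128328189c7d42547cc24c7c424479421478c20c78420481d29d85d85c29c89425388c24b884243854213;
    0x13c15c458454248c44d44440a3542dc30c4cc4822943dd30334d3443456c239338228d28c28461560528b;
    0x128c28d28528430524d20489d5cd58d2cc21520d2055412956814143154cd3d460d3432dd60434c25564a;
    0x13651cd88c80560341329d79321420c1c585584c84d8455cb3cc2d424c8847832432457d57c555440d294;
    0x139439534a2c425424c24d2dc89c8947c478c7147136cc6656441cd46534231d24480d54345354538c1d5;
    0x134330b30a2d42943cd28a2821c51c41c17cc75474c74574431471570d6e55855024e54043c454d3d53c5;
    0x13cc4d44434c54c448b48a44b50d44a34144240b50b50a4013cb6c439c2d528b28d4142cc50438d38c381;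
    0x189c70c6425c270562561c60b5134ca3c160a60258d58256550a38240c5155252dd3853846045055012c2;
    0x144144a35534a34b3443133023012cd2cb29328358328154a38a7d425424a24224120a2042022011ca1c2;
    0x168264460160c5c358158555454150c6c26415024cc4c148448248144d44b5654414044023c235455544c;
    0x12531c51c31c42052031d41d31cd1cc1cb1ca1c588d48381d81c51d85d85c40b40d3427d35427947846c4;
    0x12151d41c21ca3553533d53153cb4c23c13ca1cd1cb28d68538d3c538a2cb34d31c30c30a30d29c353294;
    0x148b4033832834854842152132d53cc31530a3cb38b34c28b50b4ca4d544b44539540c40251340a401214;
    0x144c4444436e569d58144144244a34d2132151d41ca44d44c1cd1cc20d20b20a48d38364360348548148c;
    0x14c13d33c339439529354b34434134531c31d6cc4cb68b5425454cd4cc30b30d30c30130a4c34c248d485;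
    0x14424432814c528c4dd4cd45344344b44a44234150d50150250150245434134d2cb48b4d44cb4ca4c14ca;
    0x16014c54c330230a3014d33cd34b1d51d329528a28145334d44a4033ca3c240b40d38b1d33552d334c34a;
    0x124a2423843852dc2dd1c51c31c46451c328560540540428430528330d3012052032c568360c4c44c34c2;
    0x12935035014dd4c42c14dc3c33933442042031c52051c41c168168b5954cb4cd4c13dd28128228a353415;
    0x15c56dc6c430530430c30428b4dd28d6c56856c16834934844834815c169c48148250c1d51d31d4355353;
    0x129d31d30b89c85c31c2dc2dd29c29d81d5cb5c148238a38151c54b54154d54b54a541414415414404384;
    0x165d4cc2cb30c3143d33d53d33c53133dd28229568168c38d1d51d421534c30330b30d29d29c29328b38b;
    0x138c24124b2cc28d1cd1cb1c11cc1cb28d28c20d20b2cd1cc20d20c24d24b24a48c48a48b2ca54c294295;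
    0x134235325425521420a3542023952132d52532d42c25cb2c23dc38b2ca39338a38239431d20b28c684545;
    0x128b28329329c2dd25325521421329428a2442045e52052045842051c45851c32852826553d43d5343341;
    0x14444651c124d20c44420d1cd1cc1c11ca1c31c26a558d1c11ca1d51c235535334b40d34a34231d29d29c;
    0x129c2932836c168568361c3c328b3153dc28b28c24b1c51c42052022012011d31cc1cb2cd24c24d20c20b;
    0x12542143a521521434431329d29c2dd2dc2d32432c42c330c2d32c33142dd2142132d52842042032c529d;
    0x164a6424016532cc24c24b4a548520d20c20b28c68450430428d6854142cc2ca2c124c24d4842cb34d34c;
    0x14cc4cd5434cb30b31330a30230161d4134154146023c13832836434033d33036133c23ca41340a402682;
    0x12052041cd1cc1c51c36dd5815826456446152853853815d42455c424148439438d2dc31c31d31330331c;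
    0x12452432c42c529d3e529528329c28329d2932042032052032841d421521425524c24a24424220c1c51c4;
    0x12dd6c52852844153553426656536454054024043823952151d51d41d33433451d4215204203202201204;
    0x11d51d41d31c51c45851c26456032c46042445e52c520328458354c3d42542553842532d43836dd654665;
    0x138c61454450441d3d42953c53c42942822932542432422132552542532d439d21521420b20421320a201;
    0x12542532442432452411cb1ca1c31c21d35d32432442425c45c15c25c36d46c26c360360168b64354154c;
    0x128d5cb6c16c52cc2cb2c368344234d34134c28b28c6c431d31c2dc2dd24c24d24c24b2cc2cd2c42dc2c3;
    0x120b49d20a38d2022032844153934046445ca5d32c36c361d2846c26056dc5045052cd5454cd3952d428c;
    0x134561c54b3d33c338b3442dc5032933e529531c31d38c52528b28d6852cc25324b24324124a4842cb213;
    0x185c6c35c15435014cb48139334b]%positive));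
 (([:: 1; 7; 3; 4; 5; 6; 7], 252, 231),
  ([:: (0,3); (1,1); (1,4); (2,0); (3,5); (4,2); (5,6); (6,5); (8,0); (9,1); (10,5); (11,4);
   (12,0); (12,1); (13,0); (14,2); (16,3); (17,1); (20,5); (21,1); (23,3); (23,4); (24,3)],
   [:: 1; 1; 1; 1; 1; 3; 3],
   [:: 0x15964565d54553152150560533c62c620640630644644530520504604114110a1031010830431c2142082;
    0x10d40d30c309305c49535525505548534524504519c19318115314a11310c08a5163d62d6216556416316;
    0x161e60d5de59e55e50d6665e65cd58d5a65260864d53952952964c53852852860dc09c08c08b15414c11c;
    0x134d31e30d2e52e62cd4e54cd3de3ce10d64d51e4de4a54a649e48d46645e44d41e40e40d3e53e614565d;
    0x11c51561557ee0de0660cd1c61de0d60966ae6ee0ce2a629e25e24d22522620d38d21e2de3a639e36635e;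
    0x10a509e28d08d04d18d1a61a51160dd0c64e54a54263a52a52a618614e0ee05e36532532626614d265065;
    0x134d28e08d1ae16e0d60951061054dd39d29d09d0856556450e52ce20e04e6654654253e62e622622511e;
    0x135e3de2de21e31e31d21d05e0456153ce05d5e554d52520e04e40e04d48d44d40d30e30d4cd38d28d34e;
    0x109452650e50d25e1540e50d404664d61d60551e0dd1260c55052ce24e39d29d09d29e49d45d41d3dd35d;
    0x12051dc0541c218a14419d10c1141c40c205604c62560d5dd08c5cd18414c5a559d58d5850cc56555d545;
    0x13553453153052d62d52c62c50dd0de1150c50c615514609c05504b0445c551d50665d4dd285216215206;
    0x10de09e05d15d11606511e05e15515614d14211d10329509509608d08e04e0e608a0851ee08405604a046;
    0x10c60c40c309308b0830450414554153d63d53ce28d24d20e1c518521e21d0dd0c52a50a50a629d29e25d;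
    0x104d1ae09504e0960e60e50d609e18d0d50ce0cd0a50a626506514d18614e0661c60cd04d0d61061050ce;
    0x10850860850830560554454053c63c511d1150dd0de09d09e05d0c50c60a505e15515610b10a1060dd08d;
    0x109509608d1ae04e0e60e50d60d509d0660cd09d09e08d08e04d0ce0cd09d1c618606614e0cd0a50a6094;
    0x11810a50a60a506518511d1150dd0de09d09e05d0c50c605e15515614d14e0a606514d1451050a50a604d;
    0x14954853a539d36535d32531d2e52de2dd2a529d25d22622521e21d1c518d]%positive));
 (([:: 1; 7; 5; 7; 9; 11], 341, 280),
  ([:: (3,0); (4,4); (7,1); (7,5); (8,2); (12,5); (13,1); (13,5); (14,4); (15,4); (18,7); (20,3);
   (21,2); (22,1); (22,3)],
   [:: 1; 1; 1; 1; 4; 4; 4],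
   [:: 0x135e35d35c29d29c25d25c21e21d21c09d05e05d12e7256e56a56666654e54a54664653252e62e50e60e5;
    0x125525421621521409505605516e09c05c61d61c5dd5dc59d59c55d55c51e51d51c41d41c3dd3dc39d39c;
    0x108d04e04d1ae0940546156145d55d45955945555545165155144154143d53d4395394356355354295294;
    0x104c60d60c5cd5cc58d58c54d54c50e50d50c40d40c3cd3cc38d38c34e34d34c28d28c24d24c20e20d20c;
    0x15855845455445065055044054043c53c43853843463453442852842452442062052040850460451ee08c;
    0x118618e1961150cd14511d8ae86e82e7ee7ae76e0c69ee8ee92e96e9ae11c1551de0840446056045c55c4;
    0x11d315c1851151461040d508a0830931e604104a15e10d14c1540cc0c41c61441840d610e0de0dd0dc1c5;
    0x108105c0440541661261251c611d0cc0cd0ce18d18e14519619414d1460ce04c04b11e1d51ca1c41c3144;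
    0x17256e56a56664e54a54653253262e52e646666518a18c18b0c40d419c1010dc0c609c09408c0841cc1e5;
    0x11441460de0dd1c60d60d510d1161140e50de0dc0dd0d60d51851151161c510d10414b11c11310a0dc0cc;
    0x114214110c0d40cd0cc0ce11d11c11e10c0de0dc0dd0d61c50d50d40c60c51141150dc0c60c504404114d;
    0x11c118c18415414c144]%positive));
 (([:: 1; 7; 10; 10; 15], 460, 301),
  ([:: (0,8); (0,9); (0,13); (1,4); (1,5); (1,11); (2,5); (3,11); (4,11); (4,12); (6,1); (6,10);
   (7,7); (8,3); (8,4); (8,5); (8,11); (9,5); (10,0); (10,1); (11,3); (11,14); (12,1); (13,8);
   (14,10); (15,12); (15,13); (16,8); (17,2); (17,4); (17,7); (18,10); (18,11); (19,2); (20,2);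
   (21,6); (21,8); (21,10); (21,11); (22,5); (23,4); (24,3); (24,13); (25,2); (25,12); (26,14);
   (27,0)],
   [:: 1; 1; 1; 5; 5; 5; 5],
   [:: 0x11ca0c114148e20e04e04a0ca38b0414ce24e50d24d04d38e58e2ce5ce5cd2cd64e64d64c2cc04c38d04b;
    0x15d42540815c42445955942145855842041c10c31cb0d314b4434033c334b3432434534133d3353313253;
    0x121520518a6dc69c65c61c5dc59c51c4dc35434c34469431430c6843042d42c461429428d28e28c284102;
    0x16053053060c58261cd6c464455c55549e49c48430e55d54d51d4dd49d34e2952855165152555052454d6;
    0x148545540c3d435534d31630d2d52c62060c49e51848a686508405304261560454c5455044c5383304216;
    0x12d60d60ce8e66cc286a66825a251dc0c61867e67a61967266dd69d08b10365d61e5dd59d51e0834de496;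
    0x150e3dd35c3542d41431130cb35d31c0d405619496672568c60c5d504404355e48644c31e2962562461c3;
    0x121c21e1460866d445e44b41530b10b093115105046654586aa541d41618d41e15415c08e10695d6dc695;
    0x105534c0cc1c41c12c63443462c40448ee1a525e28508504a6de69e69c65e5de59444d40639338c31d24b;
    0x10457ee65e65c61c4de4dd19e04140b31630c21620b1cb35e10d4534431030d505461d61e3cc39531529e;
    0x12de28d28c28604351d25d14108d3de0467ae4d439d55d29d29429608a295095255256096206205246245;
    0x114d14b14310a1cd18315e15515314a0ca0c30c41840c172e0821810830811ee82e58445d4563d53cd59e;
    0x15464dd4dc4c449d40339e34e34331e31430e29525e3c324321621520c18214e10624e08e18b49e21e8a6;
    0x159c21520e20618610e2162144262d605445c18c16e1440d50c546e3563540d40d31659666dc0536dd446;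
    0x15dc14c0d614e08b1955d455d31d31c2542442031c318b11308329d29e2850cb0ce1c608505504272621c;
    0x150435c34c30530424d08d3ae21e20e20c1431c210b19318d08418c18115311509308c05304e04c6d5103;
    0x118518418614d1420cb10c10b0931c31020d53550d40d30cd0c30c60c108b08504d04b04a04404504355e;
    0x11050531162dd2d42c325c29c28d28c25d25521d20551e1c31c20430421ce0c31cb1c518a0840c5095094;
    0x145e45c41c39e3833540ce29c31d31e31530c2de2dc29d1e51050c61dc3dd155106103104056146156083;
    0x10c429509504c04d08e08c28508508408105304c04541c04445e69c09311361c59d49e45c44b08645d18e;
    0x11150d60d50d311409610e09510d21e10608b08318b10a10b10141d0540d60d50c60560440cd0cc0cb344;
    0x105615514615611611510b0d309314b08608408310511605305404514404641e14414211521d21c114116;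
    0x141c41e41d14415414e14c1461451041061051031040cd0c40c509305521d18611311414535c185184115;
    0x135d31e2de29d16e0ce2dd1c425c1c525d3ee3de18e08518d08e05521e1060c50c40c30c639d045043044;
    0x11161c425c31e41d04508605504d04b04604404345c45d29c25e21e21d0cd0cc04e1a63e53dd39e2dc35e;
    0x104c04d08e08d08b08c0cd0ce0cc09509408d05441c0440431030c40c30c60c50c308c104146106105156;
    0x115414508c1040c409315511518418610c39c14441e04639e39d39c15c1451131141541440540d60d504e;
    0x104509605518518405439c41d1661440d40d30941651451461561161140d30d40d60541c41561462dd155;
    0x10c604441c41e3dc3a539d09535d2dc2de2dc31c31d29c25d25c21c1e60ce0cb0cc19c05618610d35c426;
    0x104e04d04604521e3ae35c35d2dc2de2dd29e1c608b0551ae19d0cd4651c51c40cc1a61c618d3de0c40c5;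
    0x115508525e1c63de0541461141541441450932dc4260960830430551de1051041061dd086056053055053;
    0x10960850540444663ae10b10e04539d08d3de39c25d04639e29d3dd1c53ee25e21d21c21e3a621d1c4156;
    0x118c0d619e10d08b08d08c08e0860850842de21e21c39e10c05614c14d10e10d18c18d1030c40c6095094;
    0x109504510d0d409405610c10e10b29d3e531e0d60cc0cd0d40d509509409604e04645e45c3dd35d35c35e;
    0x105504d04c04b04e04b04604545c31e29d29c31d42542604441c29c21d04d1a608518d08618e18c14c096;
    0x108608529c18e18d29e25d25e1c61c40cc0ce0cd0c40c509508d08c08e08d08535c45d45e18e0860840c5;
    0x124524420418e18c18b18414c1440531160d40cb09508d08c08e08d08505604631c29d16510e10c10d084;
    0x145c3dc35c35d31c31d3042dc2dd2dc2cb2c428425c]%positive));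
 (([:: 1; 7; 10; 16], 371, 238),
  ([:: (0,8); (0,9); (0,13); (1,3); (1,4); (1,10); (2,3); (3,8); (4,7); (4,8); (6,4); (7,0);
   (7,11); (7,12); (7,13); (8,3); (8,12); (9,6); (9,7); (11,3); (11,5); (12,11); (13,12); (13,14);
   (14,13); (14,14); (15,8); (16,1); (16,3); (16,6); (17,8); (17,9); (17,12); (17,15); (18,14);
   (20,0)],
   [:: 1; 1; 1; 5; 5; 5; 5],
   [:: 0x135334b3433133032d32c329328b2832532432132032cc04c20e20c04e24e24d24c04d38b38e38c38d04b;
    0x134e34c34430d2d42c42162142063ce0813dd35534d3453153052d52c529528e28525524521520518a041;
    0x149c44d3563463143042d62942842542441d582e75c4154053d53cd3c53953851138651d340e3de3dc354;
    0x10424ae4e639418c11511656e52e4ee46545d4464132c628d1d604a85e7de71e1d46e565c59c55c51c4dc;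
    0x184371d62545c40645e39c2552962562862452460d679e6e666619652639631630b3061c108e082206046;
    0x11057e53443433462c40c62c62852042051653540d414d1564141141540566c344e38629518110d30c08c;
    0x118225625404204118e18a18c18b2841421414431030810833de3dc0cc45546e40c40b4033d635634c345;
    0x11131430c10d30ca0c308a04d44141e3dd2942822811c110210110404b04c21621404a2d60541c409604e;
    0x110539d0c414b1dc1161461441c20ca0ce4dc41c2432442461150c210a0421823860433143033021d5153;
    0x10460414660c345e05310339c25521320618318114e15614c14a11410d10b0cb0c10930845e545d41d454;
    0x11840d414d14c14514610339c14308c0441c51561541951441551d61d514c1541041531010950d409408e;
    0x11c208c08108a18d11610b0d315c14a14409308b1060c40841e505504339e1050cb08d08308219c196044;
    0x141e41c1040c33dd3431832832451c51c10d618614e1560cb1c305346e10339c39e10510408339d14b153;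
    0x115310d10c04414d1551451d31d405509604e04c04b04d08e08608405605504404346545d0d410c0cb45c;
    0x11c51c418414d14414314604415514e0d30cd0840c509404308b0561de10b1c514c0c608c0851c6156154;
    0x139e0830840550431dd0840830550540431c305311609409311511315c10b0c60c41850d50450861cb0c5;
    0x141d0ce0cd18610e09608e08504504308d08b08c08e0cc41c1c30861830541c405311611310b0d311415d;
    0x10d40d604e04d04b0961ae08c04514e15615310c14b1150c404414c1c60c608519e04c04646645c0cc41c;
    0x10d510d08b0931060831051040c30560430c40840551e50c60ce0cd10e19d0940850451ee1650d31c510d;
    0x10860850560540cb09419c1c405405304c04539e0cc1a508d0460951840d609604641e41d18610e1c6185;
    0x105441c1c31c405311611515c14e0d405616605514414615514c14d0440c60850cd0840c60c409608e08c;
    0x104609518418610c09610e09408618516504510d10b0850cd0840c508b0930431c51ae1140cc08d08c08e;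
    0x11061050cd0850c60c504310b0d30950940960460d40d60d50531030cb0c408c05605504e04c0451e608d;
    0x10d604e04d04b04c0ce41e0ce0460960cb09339e0930860cc0cd18609508d0461841851830ce09408b056;
    0x10d40d30d60560541c41c61041051030cc0ce0830cb45c41e41c1c30530cb10c10d0950850860450d50d4;
    0x13dc45e0c310415314d11305339c14311310b0cd0cc0ce0950860450d50d309408b05605311611415d106;
    0x104618418318610e0d40440451850d510d10c09308b1060cb0831050550430840c50c414b1041030c341d;
    0x108e41c1c309508d0461841860cc04609608e08c0cd0440c608510e0d60961860540d604508618509508d;
    0x141c39c24d15414c1030d40d60560541c41c30530cb10c10e0c40c60850561c60cd0cc09508c09409608d;
    0x10cc04e04c0ce41e]%positive))].

Lemma certificates_certified : all certified certificates.
Proof. by vm_compute. Qed.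

Theorem mainTheorem1 (K : closedFieldType) (charK0 : [pchar K]%R =i pred0)
    (HF : seq nat) (d d0 : nat)
    (HFdd0 : (HF, d, d0) \in
      [:: ([:: 1; 5; 9; 7], 123, 110);
          ([:: 1; 5; 15; 7; 9], 268, 185);
          ([:: 1; 5; 15; 7; 9; 11], 341, 240);
          ([:: 1; 5; 15; 9; 12], 332, 210);
          ([:: 1; 5; 15; 10; 12], 347, 215);
          ([:: 1; 5; 15; 10; 15], 386, 230);
          ([:: 1; 6; 5; 7], 132, 114);
          ([:: 1; 6; 5; 7; 9], 186, 168);
          ([:: 1; 6; 10; 7; 9], 248, 198);
          ([:: 1; 6; 10; 9; 12], 302, 228);
          ([:: 1; 6; 10; 10; 9], 272, 216);
          ([:: 1; 6; 21; 7; 9], 461, 264);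
          ([:: 1; 7; 3; 4; 5; 6; 7], 252, 231);
          ([:: 1; 7; 5; 7; 9; 11], 341, 280);
          ([:: 1; 7; 10; 10; 15], 460, 301);
          ([:: 1; 7; 10; 16], 371, 238)]) :
  let n := nth 0 HF 1 in
  let mu := sumn HF in
  let U : hilb K n mu -> Prop := translates (mod_distinguished HF (mu := mu)) in
  [/\ elementary_component (zclosure U),
      has_dim (zclosure U) d,
      has_dim (principal_component (K := K) (n := n) (mu := mu)) d0 &
      sufficiently_general (fun C : Cidx HF n -> K =>
        exists I : hilb K n mu,
          [/\ distinguished C I,
              exists2 e, tangent_dim I e & has_dim U e,
              zclosure U I &
              smooth_point I])].
Proof.
(* The list in the statement is convertible to the list of first components of [certificates]. *)
have [c] := certified_exists certificates_certified (HFdd0 : _ \in [seq p.1 | p <- certificates]).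
exact: certified_component.
Qed.
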